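(* There exists $c_1>0$ such that for each fixed $c\in(0,c_1)$ the following three statements hold. 1. There exists a unique couple $(\hat y_1(c),\hat y_2(c))$ with $1<\hat y_1(c)<y_c\le y_v(c)<\hat y_2(c)$ solving (in $(y_1,y_2)$) the system $$\frac{\partial H_l}{\partial y}(y_1)=\frac{\partial H_r}{\partial y}(y_2;c),\qquad H_l(y_1)-\frac{\partial H_l}{\partial y}(y_1)\,y_1=H_r(y_2;c)-\frac{\partial H_r}{\partial y}(y_2;c)\,y_2.$$ Moreover $\hat y_1(c)<\Psi(f_0)$. 2. Let $A(c)=\frac{\partial H_l}{\partial y}(\hat y_1(c))=\frac{\partial H_r}{\partial y}(\hat y_2(c);c)$ and $B(c)=H_l(\hat y_1(c))-A(c)\hat y_1(c)=H_r(\hat y_2(c);c)-A(c)\hat y_2(c)$. The function $$W(y;c):=\begin{cases}H_l(y), & 1\le y\le\hat y_1(c),\\ A(c)y+B(c), & \hat y_1(c)<y<\hat y_2(c),\\ H_r(y;c), & y\ge\hat y_2(c),\end{cases}$$ is the greatest nonpositive convex minorant of $H(\cdot;c)$ on $[1,\infty)$ and lies in $C^1[1,\infty)$. The straight line $y\mapsto A(c)y+B(c)$, $y>1$, also lies below $H(\cdot;c)$ (i.e. $A(c)y+B(c)\le H(y;c)$ for $y>1$). 3. Setting $F(c)=\Psi^{-1}(\hat y_1(c))$ and $G(c)=\Psi^{-1}(\hat y_2(c))$, the value function $\tilde V(\cdot;c)$ satisfies, for $x\ge 0$, $$\tilde V(x;c)=\begin{cases}\delta x^2, & 0\le x\le F(c),\\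 \frac{\lambda}{\alpha}x^2+\frac{\lambda}{\alpha^2}+A(c)e^{x\sqrt{2\alpha}}+B(c)e^{-x\sqrt{2\alpha}}, & F(c)<x<G(c),\\ \tilde V_0(x-c)+c, & x\ge G(c).\end{cases}$$ The principle of smooth fit holds across the free boundary points $F(c)$ and $G(c)$ (i.e. $x\mapsto\tilde V(x;c)$ is continuously differentiable at these points).
   Context: Fix $\alpha>0$, $\delta>0$ and $0<\lambda<\alpha\delta$. Let $f_0=\frac{1}{\sqrt{2\alpha}}\left(\sqrt{\frac{\alpha\delta+\lambda}{\alpha\delta-\lambda}}-1\right)>0$, the unique positive root of $\rho(x)=x^2+\frac{2x}{\sqrt{2\alpha}}-\frac{\lambda/\alpha}{\alpha\delta-\lambda}$. Standing assumption: $f_0>\frac{\alpha}{2\lambda}$ (equivalently $\lambda\in(\lambda^\dagger,\alpha\delta)$, where $\lambda^\dagger$ is the unique value of $\lambda$ at which $f_0=\frac{\alpha}{2\lambda}$), so that $\frac{1}{2\delta}<\frac{\alpha}{2\lambda}<f_0$. Let $B_0=-\frac{2f_0}{\alpha\sqrt{2\alpha}}(\alpha\delta-\lambda)e^{f_0\sqrt{2\alpha}}$ and $\Psi(x)=e^{2\sqrt{2\alpha}\,x}$. Obstacles. For $x\ge 0$, $c>0$ put $h_l(x)=\left(\delta-\frac{\lambda}{\alpha}\right)x^2-\frac{\lambda}{\alpha^2}$, $h_{r1}(x;c)=\delta c(c-2x)+\left(\delta-\frac{\lambda}{\alpha}\right)x^2+c-\frac{\lambda}{\alpha^2}$, $h_{r2}(x;c)=\frac{\lambda}{\alpha}c(c-2x)+c+B_0e^{-(x-c)\sqrt{2\alpha}}$,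 $h_r(x;c)=h_{r1}(x;c)$ for $x\in[0,f_0+c]$, $h_r(x;c)=h_{r2}(x;c)$ for $x\ge f_0+c$, and $h(x;c)=\min\{h_l(x),h_r(x;c)\}$. The transformed obstacles are, for $y\ge 1$ and $x=\Psi^{-1}(y)$, $H_l(y)=e^{\sqrt{2\alpha}\,x}h_l(x)$, $H_r(y;c)=e^{\sqrt{2\alpha}\,x}h_r(x;c)$, $H(y;c)=e^{\sqrt{2\alpha}\,x}h(x;c)$. Put $x_c=\frac{1}{2\delta}+\frac{c}{2}$, $y_c=\Psi(x_c)$, $\hat y_3(c)=\Psi(f_0+c)$, and let $y_v(c)\in[y_c,\hat y_3(c))$ be the unique point such that $H_r(\cdot;c)$ is strictly convex on $(y_v(c),\infty)$ and strictly concave on $(y_c,y_v(c))$ (if $y_v(c)>y_c$). Value functions. Let $X_t=x+W_t$ with $W$ a standard Brownian motion adapted to a filtration satisfying the usual conditions, and let $\mathcal S$ be the set of stopping times of this filtration (terminal costs are $0$ on $\{\tau=\infty\}$). Define, for $x\in\mathbb{R}$, $\tilde V_0(x)=\inf_{\tau\in\mathcal S}\mathsf E\left[\int_0^\tau e^{-\alpha t}\lambda X_t^2\,dt+e^{-\alpha\tau}\delta X_\tau^2\right]$, $\tilde V(x;c)=\inf_{\tau\in\mathcal S}\mathsf E\left[\int_0^\tau e^{-\alpha t}\lambda X_t^2\,dt+e^{-\alpha\tau}\min\left(c+\tilde V_0(X_\tau-c),\ \delta X_\tau^2\right)\right]$. The function $\tilde V_0$ is even, with $\tilde V_0(x)=\delta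 x^2$ for $0\le x\le f_0$ and $\tilde V_0(x)=\frac{\lambda}{\alpha^2}+\frac{\lambda}{\alpha}x^2+B_0e^{-x\sqrt{2\alpha}}$ for $x>f_0$. The greatest nonpositive convex minorant of a function $K$ is the pointwise largest convex function that is $\le 0$ and $\le K$ on the stated domain. *)

(* Defs.v *)
From HB Require Import structures.
From mathcomp Require Import all_boot all_order all_algebra.
From mathcomp Require Import all_classical all_reals all_analysis.

Set Implicit Arguments.
Unset Strict Implicit.
Unset Printing Implicit Defensive.
Import Order.TTheory GRing.Theory Num.Theory.
Import numFieldNormedType.Exports.
Local Open Scope classical_set_scope.
Local Open Scope ring_scope.

Section probability_setting.
Context {R : realType} {d : measure_display} {Omega : measurableType d}.
Variable P : probability Omega R.

(* Times are reals; [F t] and [W t] are only constrained, and only used, for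
   [0 <= t]. *)
Implicit Types (F : R -> set (set Omega)) (W : R -> Omega -> R).

(* [P.-negligible] sets are arbitrary subsets of null events, so
   [usual_complete] also makes [P] itself complete. *)
Record usual_filtration F : Prop := UsualFiltration {
  usual_sigma : forall t : R, 0 <= t -> sigma_algebra [set: Omega] (F t) ;
  usual_measurable : forall t : R, 0 <= t -> F t `<=` measurable ;
  usual_nondecreasing : forall s t : R, 0 <= s -> s <= t -> F s `<=` F t ;
  usual_right_continuous : forall t : R, 0 <= t ->
    \bigcap_(s in [set s | t < s]) F s `<=` F t ;
  usual_complete : P.-negligible `<=` F 0 }.

(* Standard Brownian motion relative to the filtration: increments are
   independent of the past sigma-algebra of [F], not just of the past of [W].
   The second parameter of [normal_prob] is a standard deviation. *)
Record brownian_motion F W : Prop := BrownianMotion {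
  bm_adapted : forall t : R, 0 <= t ->
    forall B : set R, measurable B -> F t (W t @^-1` B) ;
  bm_start : {ae P, forall w, W 0 w = 0} ;
  bm_continuous :
    {ae P, forall w, {within `[0, +oo[, continuous (fun t => W t w)}} ;
  bm_independent : forall s t : R, 0 <= s -> s < t ->
    forall (A : set Omega) (B : set R), F s A -> measurable B ->
    P (A `&` ((fun w => W t w - W s w)%R @^-1` B)) =
      (P A * P ((fun w => W t w - W s w)%R @^-1` B))%E ;
  bm_gaussian : forall s t : R, 0 <= s -> s < t ->
    forall B : set R, measurable B ->
    P ((fun w => W t w - W s w)%R @^-1` B) =
      normal_prob 0 (Num.sqrt (t - s)) B }.

Definition stopping_time F : set (Omega -> \bar R) :=
  [set tau | (forall w, (0 <= tau w)%E) /\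
     (forall t : R, 0 <= t -> F t [set w | (tau w <= t%:E)%E])].

Section cost.
Variables (F : R -> set (set Omega)) (W : R -> Omega -> R) (alpha lambda : R).

Definition running_cost (x : R) (tau : Omega -> \bar R) (w : Omega) : \bar R :=
  (\int[lebesgue_measure]_(t in [set t : R | (0 <= t)%R /\ t%:E <= tau w])
     (expR (- (alpha * t)) * (lambda * (x + W t w) ^+ 2))%:E)%E.

(* Nothing is paid on {tau = +oo}; tau = -oo never occurs for a stopping time. *)
Definition terminal_cost (g : R -> \bar R) (x : R) (tau : Omega -> \bar R)
    (w : Omega) : \bar R :=
  match tau w with
  | t%:E => ((expR (- (alpha * t)))%:E * g (x + W t w)%R)%E
  | _ => 0%E
  end.

Definition stopping_value (g : R -> \bar R) (x : R) : \bar R :=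
  ereal_inf [set (\int[P]_w (running_cost x tau w + terminal_cost g x tau w))%E
            | tau in stopping_time F].

Definition V0 (delta : R) : R -> \bar R :=
  stopping_value (fun x => (delta * x ^+ 2)%:E).

Definition V (delta c : R) : R -> \bar R :=
  stopping_value
    (fun x => Order.min (c%:E + V0 delta (x - c)%R)%E (delta * x ^+ 2)%:E).
End cost.

End probability_setting.

Section obstacles.
Context {R : realType}.
Variables alpha delta lambda : R.

Definition f0 : R :=
  (Num.sqrt (2 * alpha))^-1 *
  (Num.sqrt ((alpha * delta + lambda) / (alpha * delta - lambda)) - 1).

Definition B0 : R :=
  - (2 * f0 / (alpha * Num.sqrt (2 * alpha))) * (alpha * delta - lambda) *
  expR (f0 * Num.sqrt (2 * alpha)).

Definition Psi (x : R) : R := expR (2 * Num.sqrt (2 * alpha) * x).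
Definition Psi_inv (y : R) : R := ln y / (2 * Num.sqrt (2 * alpha)).

Lemma PsiK : 0 < alpha -> cancel Psi Psi_inv.
Proof.
move=> a0 x; rewrite /Psi_inv /Psi expRK mulrAC divff ?mul1r//.
by rewrite mulf_neq0// gt_eqF// sqrtr_gt0 mulr_gt0.
Qed.

Lemma Psi_invK : 0 < alpha -> {in Num.pos, cancel Psi_inv Psi}.
Proof.
move=> a0 y y0; rewrite /Psi_inv /Psi mulrC divfK ?lnK//.
by rewrite mulf_neq0// gt_eqF// sqrtr_gt0 mulr_gt0.
Qed.

Definition h_l (x : R) : R :=
  (delta - lambda / alpha) * x ^+ 2 - lambda / alpha ^+ 2.

Definition h_r1 (c x : R) : R :=
  delta * c * (c - 2 * x) + (delta - lambda / alpha) * x ^+ 2 + c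
  - lambda / alpha ^+ 2.

Definition h_r2 (c x : R) : R :=
  lambda / alpha * c * (c - 2 * x) + c
  + B0 * expR (- ((x - c) * Num.sqrt (2 * alpha))).

Definition h_r (c x : R) : R :=
  if x <= f0 + c then h_r1 c x else h_r2 c x.

Definition h (c x : R) : R := Num.min (h_l x) (h_r c x).

Definition transform (k : R -> R) (y : R) : R :=
  expR (Num.sqrt (2 * alpha) * Psi_inv y) * k (Psi_inv y).

Definition H_l : R -> R := transform h_l.
Definition H_r (c : R) : R -> R := transform (h_r c).
Definition H (c : R) : R -> R := transform (h c).

Definition x_c (c : R) : R := (2 * delta)^-1 + c / 2.
Definition y_c (c : R) : R := Psi (x_c c).
Definition y_hat3 (c : R) : R := Psi (f0 + c).

End obstacles.

Section convexity_and_smoothness.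
Context {R : realType}.
Implicit Types (D : set R) (f K W : R -> R).

Definition strictly_convex_on D f := forall x y t,
  D x -> D y -> x != y -> 0 < t -> t < 1 ->
  f (t * x + (1 - t) * y) < t * f x + (1 - t) * f y.

Definition strictly_concave_on D f := strictly_convex_on D (fun x => - f x).

Definition nonpositive_convex_minorant D K W :=
  @convex_function R R^o D W /\
  (forall y, D y -> W y <= 0 /\ W y <= K y).

Definition greatest_nonpositive_convex_minorant D K W :=
  nonpositive_convex_minorant D K W /\
  (forall V, nonpositive_convex_minorant D K V ->
     forall y, D y -> V y <= W y).

(* Derivatives are taken within [a, +oo), hence one-sided at [a]. *)
Definition C1_from (a : R) f := exists2 f' : R -> R,
  {within `[a, +oo[, continuous f'} &
  forall y, a <= y ->
    (f z - f y) / (z - y) @[z --> within `[a, +oo[ y^'] --> f' y.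

Definition C1_at f (x : R) :=
  (\forall z \near x, derivable f z 1) /\ {for x, continuous (derive1 f)}.

End convexity_and_smoothness.

Section free_boundary.
Context {R : realType}.
Variables alpha delta lambda c : R.

(* For [y = y_c] the interval of strict concavity is empty. *)
Definition convexity_threshold (y : R) :=
  [/\ y_c alpha delta c <= y < y_hat3 alpha delta lambda c,
      strictly_convex_on `]y, +oo[ (H_r alpha delta lambda c) &
      strictly_concave_on `]y_c alpha delta c, y[ (H_r alpha delta lambda c)].

Definition tangency_system (y1 y2 : R) :=
  derive1 (H_l alpha delta lambda) y1 = derive1 (H_r alpha delta lambda c) y2 /\
  H_l alpha delta lambda y1 - derive1 (H_l alpha delta lambda) y1 * y1 =
  H_r alpha delta lambda c y2 - derive1 (H_r alpha delta lambda c) y2 * y2.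

Definition tangency_couple (yv y1 y2 : R) :=
  [/\ 1 < y1, y1 < y_c alpha delta c, y_c alpha delta c <= yv, yv < y2 &
      tangency_system y1 y2].

(* By [tangency_system] these are also the slope and intercept of the tangent
   to [H_r] at [y2]. *)
Definition slope_A (y1 : R) : R := derive1 (H_l alpha delta lambda) y1.
Definition intercept_B (y1 : R) : R :=
  H_l alpha delta lambda y1 - slope_A y1 * y1.

Definition W_piecewise (y1 y2 y : R) : R :=
  if y <= y1 then H_l alpha delta lambda y
  else if y < y2 then slope_A y1 * y + intercept_B y1
  else H_r alpha delta lambda c y.

End free_boundary.

(* Main.v *)
Require Import Defs.
From HB Require Import structures.
From mathcomp Require Import all_boot all_order all_algebra.
From mathcomp Require Import all_classical all_reals all_analysis.
From mathcomp Require Import measurable_realfun ring lra.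

Set Implicit Arguments.
Unset Strict Implicit.
Unset Printing Implicit Defensive.
Import Order.TTheory GRing.Theory Num.Theory.
Import numFieldNormedType.Exports.
Local Open Scope classical_set_scope.
Local Open Scope ring_scope.

(** Why the theorem holds. Write [beta = Num.sqrt (2 * alpha)]. Never stopping
    costs [perpetual_cost z = lambda / alpha * z^2 + lambda / alpha^2], and after
    subtracting it a stopping problem for the discounted Brownian motion becomes
    a problem about the two exponential martingales
    [expR (- alpha * t) * expR (+- beta * X t)]. In the variable
    [y = Psi x = expR (2 * beta * x)] their combinations are, up to the factor
    [expR (- beta * x)], the affine functions, and the value of the problem is
    [perpetual_cost x + expR (- beta * x) * W (Psi x)], where [W] is the greatest
    nonpositive convex minorant of the transformed obstacle.

    Only a little stochastic analysis is needed for this. A tangent [a * y + b] of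
    [W] lies below the obstacle, and [b <= a <= 0], so that it stays below the
    reflected obstacle for negative states too; integrating at a stopping time
    bounds every cost from below, since stopped exponentials can only lose mass
    ([stopping_value_ge], [stopping_value_ge_convex]). For the upper bound one
    stops at the first exit from the region where [W] is affine; there the
    exponentials are bounded and lose no mass ([stopping_value_le_first_zero]).
    Both rest on optional stopping, obtained directly by rounding the stopping
    time up to a grid, Fatou's lemma, and a domination argument for the converse
    inequality ([caloric_stopping_le], [caloric_stopping_ge]), and on the identity
    [expected_running_cost].

    The rest is convex analysis on the line. The second derivative of the
    transform of [k] has the sign of [k^`(2) / 2 - alpha * k], which for the first
    piece of [h_r c] is a concave quadratic polynomial ([curvature]). It is
    positive for small [c], so that [H_r c] is strictly convex on the whole
    half-line and the convexity threshold is [y_c]. For [c = 0] the function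
    [H_r 0] is convex, coincides with [H_l] up to [Psi f0], and is the transform
    of [V0]. At [y_c] the obstacles cross and the slope drops by an amount of
    order [c], while the slopes at [1] and far to the right stay away from that at
    [y_c] ([small_cost]). Under these conditions two convex functions that meet
    have exactly one common tangent with contact points on the two sides
    ([bitangent_exists], [bitangent_unique]), and replacing the graphs between
    the contact points by this tangent gives a [C1] convex function, the greatest
    minorant ([bitangent_glue], [greatest_minorant_gap]). Smooth fit is the
    continuity of its derivative. *)

(** * Gaussian integrals *)

Section density.
Local Open Scope ereal_scope.
Context d (T : measurableType d) (R : realType).
Variables (mu nu : {measure set T -> \bar R}) (g : T -> R).
Hypothesis mg : measurable_fun setT g.
Hypothesis g0 : forall x, (0 <= g x)%R.
Hypothesis nuE : forall A, measurable A -> nu A = \int[mu]_(x in A) (g x)%:E.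

Import HBNNSimple.

Let integral_density_nnsfun (h : {nnsfun T >-> R}) :
  \int[nu]_x (h x)%:E = \int[mu]_x ((h x)%:E * (g x)%:E).
Proof.
under [LHS]eq_integral do rewrite fimfunE -fsumEFin//.
rewrite [LHS]ge0_integral_fsum//; last 2 first.
  - by move=> r; exact/measurable_EFinP/measurableT_comp.
  - by move=> n x _; rewrite EFinM nnfun_muleindic_ge0.
under [RHS]eq_integral.
  move=> x xD; rewrite fimfunE -fsumEFin// ge0_mule_fsuml; last first.
    by move=> r; rewrite EFinM nnfun_muleindic_ge0.
  over.
rewrite [RHS]ge0_integral_fsum//; last 2 first.
  - move=> r; apply: emeasurable_funM; last exact/measurable_EFinP.
    exact/measurable_EFinP/measurableT_comp.
  - move=> n x _; apply: mule_ge0; last by rewrite lee_fin.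
    by rewrite EFinM nnfun_muleindic_ge0.
apply: eq_fsbigr => r _.
have mE : measurable (h @^-1` [set r]) by exact: measurable_sfunP.
rewrite integralZl_indic_nnsfun// integral_indic// setIT nuE//.
have [r0|r0] := ltP r 0%R.
  rewrite preimage_nnfun0// integral_set0 mule0.
  by under eq_integral do rewrite indic0 mulr0 mul0e; rewrite integral0.
rewrite -ge0_integralZl//=; last 2 first.
- exact/measurable_EFinP/measurable_funTS.
- by move=> x _; rewrite lee_fin.
rewrite integral_mkcond/=; apply: eq_integral => x _.
rewrite patchE indicE; case: ifPn => /= _; first by rewrite mulr1.
by rewrite mulr0 mul0e.
Qed.

(** Simple functions reduce the formula to its hypothesis on sets, and monotone
    convergence extends it to nonnegative measurable functions. *)
Lemma ge0_integral_density (f : T -> \bar R) :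
  measurable_fun setT f -> (forall x, 0 <= f x) ->
  \int[nu]_x f x = \int[mu]_x (f x * (g x)%:E).
Proof.
move=> mf f0; pose f_ := nnsfun_approx measurableT mf.
have fE x : (fun n => (f_ n x)%:E) @ \oo --> f x.
  by apply: cvg_nnsfun_approx.
have ndf x m n : (m <= n)%N -> (f_ m x)%:E <= (f_ n x)%:E.
  by move=> mn; rewrite lee_fin; exact/lefP/nd_nnsfun_approx.
transitivity (limn (fun n => \int[nu]_x (f_ n x)%:E)).
  rewrite -monotone_convergence//.
  - by apply: eq_integral => x _; apply/esym/cvg_lim => //; exact: fE.
  - by move=> n; exact/measurable_EFinP.
  - by move=> n x _; rewrite lee_fin.
  - by move=> x _ m n; exact: ndf.
transitivity (limn (fun n => \int[mu]_x ((f_ n x)%:E * (g x)%:E))).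
  by congr (limn _); apply/funext => n; exact: integral_density_nnsfun.
rewrite -monotone_convergence//.
- apply: eq_integral => x _; apply/cvg_lim => //.
  by apply: cvgeZr => //; exact: fE.
- by move=> n; apply: emeasurable_funM; apply/measurable_EFinP.
- by move=> n x _; rewrite mule_ge0 ?lee_fin.
- by move=> x _ m n mn; rewrite lee_wpmul2r ?lee_fin//; exact: (ndf).
Qed.

End density.

Section normal_moments.
Local Open Scope ereal_scope.
Context {R : realType}.
Notation mu := (@lebesgue_measure R).
Implicit Types (s x m : R).

Lemma ge0_integral_normal_prob s (f : R -> R) : measurable_fun setT f ->
  (forall x, 0 <= f x)%R ->
  \int[normal_prob 0 s]_x (f x)%:E =
  \int[mu]_x (f x * normal_pdf 0 s x)%:E.
Proof.
move=> mf f0; under [RHS]eq_integral do rewrite EFinM.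
apply: (@ge0_integral_density _ _ _ mu (normal_prob 0 s) (normal_pdf 0 s)).
- exact: measurable_normal_pdf.
- by move=> x; exact: normal_pdf_ge0.
- by [].
- exact/measurable_EFinP.
- by move=> x; rewrite lee_fin.
Qed.

Lemma normal_pdf_expR m s x : (0 < s)%R ->
  normal_pdf m s x =
  ((s * Num.sqrt (pi *+ 2))^-1 * expR (- (x - m) ^+ 2 / (s ^+ 2 *+ 2)))%R.
Proof.
move=> s0; rewrite normal_pdfE ?gt_eqF// /normal_peak /normal_fun.
by rewrite -mulrnAr sqrtrM ?sqr_ge0// sqrtr_sqr gtr0_norm.
Qed.

Lemma normal_mgf s a : (0 < s)%R ->
  \int[normal_prob 0 s]_z (expR (a * z))%:E = (expR (a ^+ 2 * s ^+ 2 / 2))%:E.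
Proof.
move=> s0; rewrite ge0_integral_normal_prob; last 2 first.
- by apply: measurableT_comp => //; exact: mulrl_measurable.
- by move=> z; exact: expR_ge0.
(* completing the square: tilting N(0,s^2) by [expR (a z)] shifts its mean *)
transitivity (\int[mu]_z
    ((expR (a ^+ 2 * s ^+ 2 / 2))%:E * (normal_pdf (a * s ^+ 2) s z)%:E)).
  apply: eq_integral => z _; rewrite -EFinM; congr EFin.
  rewrite !normal_pdf_expR// mulrCA [RHS]mulrCA -!expRD; congr (_ * expR _)%R.
  by field; rewrite gt_eqF.
rewrite ge0_integralZl//; last 2 first.
- by apply/measurable_EFinP; exact: measurable_normal_pdf.
- by move=> z _; rewrite lee_fin normal_pdf_ge0.
by rewrite integral_normal_pdf mule1.
Qed.

Lemma ge0_integral_normal_probN s (f : R -> R) : (0 < s)%R ->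
  measurable_fun setT f -> (forall x, 0 <= f x)%R ->
  \int[normal_prob 0 s]_x (f (- x)%R)%:E = \int[normal_prob 0 s]_x (f x)%:E.
Proof.
move=> s0 mf f0.
rewrite !ge0_integral_normal_prob//; last exact: measurableT_comp.
have E z : normal_pdf 0 s z = normal_pdf 0 s (- z).
  by rewrite !normal_pdf_expR// !subr0 sqrrN.
under eq_integral do rewrite E.
pose F := fun z : R => (f z * normal_pdf 0 s z)%:E.
have mF : measurable_fun setT F.
  by rewrite /F; apply/measurable_EFinP/measurable_funM => //; exact: measurable_normal_pdf.
transitivity (\int[pushforward mu (-%R : R -> measurableTypeR R)]_z F z).
  by rewrite ge0_integral_pushforward// => z _; rewrite lee_fin mulr_ge0 ?normal_pdf_ge0.
by apply: eq_measure_integral => A mA _; exact: lebesgue_measureN.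
Qed.

(** Compare [N(0, s^2)] with [N(0, v^2)], whose density is that of the former
    times [s / v * expR (th v * z^2)]. Since [expR u >= 1 + u], integrating gives
    [1 + th v * m <= v / s] for the second moment [m]: an upper bound on [m] for
    [v > s] and a lower bound for [v < s], both tending to [s^2] as [v] tends to
    [s]. If [m] were not [s^2], taking [v^2] halfway between them would
    contradict one of the two bounds. *)
Lemma normal_second_moment s : (0 < s)%R ->
  \int[normal_prob 0 s]_z (z ^+ 2)%:E = (s ^+ 2)%:E.
Proof.
move=> s0; rewrite ge0_integral_normal_prob; last 2 first.
- exact: measurable_funX.
- by move=> z; exact: sqr_ge0.
set m := LHS.
have m0 : 0 <= m.
  by apply: integral_ge0 => z _; rewrite lee_fin mulr_ge0 ?sqr_ge0 ?normal_pdf_ge0.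
pose th v : R := (((s ^+ 2)^-1 - (v ^+ 2)^-1) / 2)%R.
have tilt v z : (0 < v)%R ->
    (v / s * normal_pdf 0 v z = expR (th v * z ^+ 2) * normal_pdf 0 s z)%R.
  move=> v0; rewrite !normal_pdf_expR// !subr0.
  rewrite [RHS]mulrCA -expRD !invfM !mulrA; congr (_ * _ * expR _)%R.
    by field; rewrite !gt_eqF//.
  by rewrite /th; field; rewrite !gt_eqF.
have I1 v : (0 < v)%R -> \int[mu]_z (v / s * normal_pdf 0 v z)%:E = (v / s)%:E.
  move=> v0; under eq_integral do rewrite EFinM.
  rewrite ge0_integralZl//; last 3 first.
  - by apply/measurable_EFinP; exact: measurable_normal_pdf.
  - by move=> z _; rewrite lee_fin normal_pdf_ge0.
  - by rewrite lee_fin divr_ge0// ltW.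
  by rewrite integral_normal_pdf mule1.
have mpr v : measurable_fun [set: measurableTypeR R] (normal_pdf 0 v : measurableTypeR R -> R).
  exact: measurable_normal_pdf.
have mzr : measurable_fun [set: measurableTypeR R]
    (fun z : measurableTypeR R => (z ^+ 2 * normal_pdf 0 s z)%R).
  by apply: measurable_funM; first exact: measurable_funX.
have mp v : measurable_fun [set: measurableTypeR R] (fun z : measurableTypeR R => (normal_pdf 0 v z)%:E).
  by apply/measurable_EFinP; exact: measurable_normal_pdf.
have mz : measurable_fun [set: measurableTypeR R] (fun z : measurableTypeR R => (z ^+ 2 * normal_pdf 0 s z)%:E).
  apply/measurable_EFinP/measurable_funM; first exact: measurable_funX.
  exact: measurable_normal_pdf.
have z0 z : 0 <= (z ^+ 2 * normal_pdf 0 s z)%:E.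
  by rewrite lee_fin mulr_ge0 ?sqr_ge0 ?normal_pdf_ge0.
have p0 v (z : R) : 0 <= (normal_pdf 0 v z)%:E by rewrite lee_fin normal_pdf_ge0.
have Izl k : (0 <= k)%R ->
    \int[mu]_z (normal_pdf 0 s z + k * (z ^+ 2 * normal_pdf 0 s z))%:E = 1 + k%:E * m.
  move=> k0; under eq_integral do rewrite EFinD.
  rewrite ge0_integralD//; last 2 first.
  - by move=> z _; rewrite EFinM mule_ge0// lee_fin.
  - exact/measurable_EFinP/measurable_funM.
  rewrite integral_normal_pdf; congr (_ + _).
  by under eq_integral do rewrite EFinM; rewrite ge0_integralZl// lee_fin.
have up v : (s < v)%R -> 1 + (th v)%:E * m <= (v / s)%:E.
  move=> sv; have v0 : (0 < v)%R by exact: lt_trans sv.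
  have th0 : (0 <= th v)%R.
    rewrite /th divr_ge0// subr_ge0 lef_pV2 ?posrE ?exprn_gt0//.
    by rewrite ler_sqr ?nnegrE ?ltW.
  rewrite -(Izl (th v))// -(I1 v)//; apply: ge0_le_integral => //.
  - by move=> z _; rewrite EFinD adde_ge0// EFinM mule_ge0// lee_fin.
  - apply/measurable_EFinP/measurable_funD => //; exact: measurable_funM.
  - by apply/measurable_EFinP/measurable_funM.
  - move=> z _; rewrite lee_fin tilt// mulrA -{1}[normal_pdf 0 s z]mul1r -mulrDl.
    by rewrite ler_wpM2r ?normal_pdf_ge0// expR_ge1Dx.
have dn v : (0 < v < s)%R -> 1 <= (v / s)%:E + (- th v)%:E * m.
  move=> /andP[v0 vs].
  have th0 : (0 <= - th v)%R.
    rewrite /th -mulNr divr_ge0// opprB subr_ge0 lef_pV2 ?posrE ?exprn_gt0//.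
    by rewrite ler_sqr ?nnegrE ?ltW.
  rewrite -[leLHS](integral_normal_pdf 0 s) -(I1 v)//.
  have -> : (- th v)%:E * m = \int[mu]_z ((- th v)%:E * (z ^+ 2 * normal_pdf 0 s z)%:E).
    by rewrite ge0_integralZl.
  rewrite -ge0_integralD//; last 4 first.
  - by move=> z _; rewrite lee_fin mulr_ge0 ?normal_pdf_ge0// divr_ge0// ltW.
  - by apply/measurable_EFinP/measurable_funM.
  - by move=> z _; apply: mule_ge0 => //; rewrite lee_fin.
  - exact: emeasurable_funM.
  apply: ge0_le_integral => //.
  - apply: emeasurable_funD; last exact: emeasurable_funM.
    by apply/measurable_EFinP/measurable_funM.
  - move=> z _; rewrite -EFinM -EFinD lee_fin tilt// [(- th v * _)%R]mulrA -mulrDl.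
    rewrite ler_peMl ?normal_pdf_ge0//.
    have := expR_ge1Dx (th v * z ^+ 2)%R; lra.
have mfin : m \is a fin_num.
  rewrite ge0_fin_numE//; have := up (s + s)%R.
  have t0 : (0 < th (s + s))%R.
    rewrite /th divr_gt0// subr_gt0 ltf_pV2 ?posrE ?exprn_gt0 ?addr_gt0//.
    by rewrite ltr_sqr ?nnegrE ?addr_ge0 ?ltW// ltrDl.
  rewrite ltrDl => /(_ s0).
  case: (m) m0 => [r _ _|_|//]; first by rewrite ltry.
  by rewrite mulry gtr0_sg// mul1e addey// leye_eq.
move: m m0 mfin up dn {Izl} => [r| |]// m0 _ up dn; congr EFin.
rewrite lee_fin in m0.
apply/eqP; rewrite eq_le; apply/andP; split; rewrite leNgt; apply/negP => rs.
- (* [w ^+ 2] is the midpoint of [s ^+ 2] and the supposed moment [r] *)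
  pose w := Num.sqrt ((s ^+ 2 + r) / 2)%R.
  have w2 : (w ^+ 2 = (s ^+ 2 + r) / 2)%R by rewrite sqr_sqrtr// divr_ge0// addr_ge0// sqr_ge0.
  have sw : (s < w)%R.
    by rewrite -ltr_sqr ?nnegrE ?sqrtr_ge0 ?ltW// w2; lra.
  have w0 : (0 < w)%R by exact: lt_trans sw.
  have := up w sw; rewrite -EFinM -EFinD lee_fin => H.
  have : (r <= w ^+ 2)%R; last by rewrite w2; lra.
  have E : (th w = (w - s) * (w + s) / (2 * s ^+ 2 * w ^+ 2))%R.
    by rewrite /th; field; rewrite !gt_eqF.
  have E2 : ((w - s) * (w + s) * r <= (w - s) * (2 * s * w ^+ 2))%R.
    have : (th w * r <= w / s - 1)%R by lra.
    rewrite E -(ler_pM2r (_ : 0 < 2 * s ^+ 2 * w ^+ 2)%R); last by rewrite !mulr_gt0 ?exprn_gt0.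
    have -> : ((w - s) * (w + s) / (2 * s ^+ 2 * w ^+ 2) * r * (2 * s ^+ 2 * w ^+ 2) = (w - s) * (w + s) * r)%R.
      by field; rewrite !gt_eqF.
    have -> // : ((w / s - 1) * (2 * s ^+ 2 * w ^+ 2) = (w - s) * (2 * s * w ^+ 2))%R.
    by field; rewrite !gt_eqF.
  rewrite -mulrA ler_pM2l ?subr_gt0// in E2.
  have : ((w + s) * r <= (w + s) * w ^+ 2)%R.
    by apply: le_trans E2 _; rewrite ler_wpM2r ?sqr_ge0//; lra.
  by rewrite ler_pM2l// addr_gt0.
- pose w := Num.sqrt ((s ^+ 2 + r) / 2)%R.
  have w2 : (w ^+ 2 = (s ^+ 2 + r) / 2)%R by rewrite sqr_sqrtr// divr_ge0// addr_ge0// sqr_ge0.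
  have ws : (w < s)%R.
    by rewrite -ltr_sqr ?nnegrE ?sqrtr_ge0 ?ltW// w2; lra.
  have w0 : (0 < w)%R by rewrite sqrtr_gt0 divr_gt0// ltr_wpDr// exprn_gt0.
  have := dn w; rewrite w0 ws => /(_ isT).
  rewrite -EFinM -EFinD lee_fin => H.
  have : (w ^+ 2 <= r)%R; last by rewrite w2; lra.
  have E : (- th w = (s - w) * (w + s) / (2 * s ^+ 2 * w ^+ 2))%R.
    by rewrite /th; field; rewrite !gt_eqF.
  have E2 : ((s - w) * (2 * s * w ^+ 2) <= (s - w) * (w + s) * r)%R.
    have : (1 - w / s <= - th w * r)%R by lra.
    rewrite E -(ler_pM2r (_ : 0 < 2 * s ^+ 2 * w ^+ 2)%R); last by rewrite !mulr_gt0 ?exprn_gt0.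
    have -> : ((s - w) * (w + s) / (2 * s ^+ 2 * w ^+ 2) * r * (2 * s ^+ 2 * w ^+ 2) = (s - w) * (w + s) * r)%R.
      by field; rewrite !gt_eqF.
    have -> // : ((1 - w / s) * (2 * s ^+ 2 * w ^+ 2) = (s - w) * (2 * s * w ^+ 2))%R.
    by field; rewrite !gt_eqF.
  rewrite -[leRHS]mulrA ler_pM2l ?subr_gt0// in E2.
  have : ((w + s) * w ^+ 2 <= (w + s) * r)%R.
    by apply: le_trans E2; rewrite ler_wpM2r ?sqr_ge0//; lra.
  by rewrite ler_pM2l// addr_gt0.
Qed.

(** Averaging over [z] and [- z] removes the linear term, so that only integrals
    of nonnegative functions occur. *)
Lemma normal_shifted_second_moment s x : (0 < s)%R ->
  \int[normal_prob 0 s]_z ((x + z) ^+ 2)%:E = (x ^+ 2 + s ^+ 2)%:E.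
Proof.
move=> s0; set I := LHS.
have mf y : measurable_fun setT (fun z : R => ((y + z) ^+ 2)%R).
  by apply: measurable_funX; exact: measurable_funD.
have IN : \int[normal_prob 0 s]_z ((x - z) ^+ 2)%:E = I.
  by apply: (@ge0_integral_normal_probN s (fun z => (x + z) ^+ 2)%R) => // z; exact: sqr_ge0.
have : I + I = (2 * (x ^+ 2 + s ^+ 2))%:E.
  rewrite -{2}IN -ge0_integralD//=; last 4 first.
  - by move=> z _; rewrite lee_fin sqr_ge0.
  - by apply/measurable_EFinP; exact: (mf x).
  - by move=> z _; rewrite lee_fin sqr_ge0.
  - by apply/measurable_EFinP/measurable_funX; exact: measurable_funB.
  transitivity (\int[normal_prob 0 s]_z ((2 * x ^+ 2)%:E + 2%:E * (z ^+ 2)%:E)).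
    by apply: eq_integral => z _; rewrite -EFinM -!EFinD; congr EFin; ring.
  rewrite ge0_integralD//=; last 3 first.
  - by move=> z _; rewrite lee_fin mulr_ge0// sqr_ge0.
  - by move=> z _; rewrite -EFinM lee_fin mulr_ge0// sqr_ge0.
  - by apply/measurable_EFinP/measurable_funM => //; exact: measurable_funX.
  rewrite integral_cst//= probability_setT mule1 ge0_integralZl//=; last 2 first.
  - exact/measurable_EFinP/measurable_funX.
  - by move=> z _; rewrite lee_fin sqr_ge0.
  by rewrite normal_second_moment// -EFinM -EFinD; congr EFin; ring.
by case: I {IN} => [r| |]//= [] H; congr EFin; lra.
Qed.

End normal_moments.

(** * Functions invariant under the heat semigroup *)

Section caloric.
Context {R : realType}.
Implicit Types (phi psi : R -> R -> R) (s t x a : R).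

(** Nonnegative space-time functions that the Gaussian semigroup transports up to
    the horizon [s]; along a Brownian motion they give martingales. Nonnegativity
    lets every expectation below be taken in [\bar R] without integrability
    conditions. *)
Record caloric s phi : Prop := Caloric {
  caloric_continuous : continuous (fun z : R * R => phi z.1 z.2) ;
  caloric_jointly_measurable : measurable_fun setT (fun z : R * R => phi z.1 z.2) ;
  caloric_ge0 : forall t x, 0 <= t <= s -> 0 <= phi t x ;
  caloric_heat : forall t x, 0 <= t < s ->
    (\int[normal_prob 0 (Num.sqrt (s - t))]_z (phi s (x + z))%:E =
     (phi t x)%:E)%E }.

Lemma caloric_measurable s phi : caloric s phi ->
  forall t, measurable_fun [set: R] (phi t).
Proof. by move=> /caloric_jointly_measurable m t; exact: (measurable_fun_pair2 t m). Qed.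

Lemma caloric_expR s a : caloric s (fun t x => expR (a * x - a ^+ 2 / 2 * t)).
Proof.
split.
- move=> z; apply: continuous_comp; last exact: continuous_expR.
  by apply: cvgB; apply: cvgM; (try exact: cvg_cst); [exact: cvg_snd|exact: cvg_fst].
- apply: measurableT_comp => //; apply: measurable_funB; exact: measurable_funM.
- by move=> t x _; exact: expR_ge0.
- move=> t x /andP[t0 ts].
  have st0 : 0 < Num.sqrt (s - t) by rewrite sqrtr_gt0 subr_gt0.
  transitivity (\int[normal_prob 0 (Num.sqrt (s - t))]_z
    ((expR (a * x - a ^+ 2 / 2 * s))%:E * (expR (a * z))%:E)%E)%E.
    apply: eq_integral => z _; rewrite -EFinM -expRD; congr (expR _)%:E; ring.
  rewrite ge0_integralZl//=; last first.
    apply/measurable_EFinP; apply: measurableT_comp => //; exact: mulrl_measurable.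
  rewrite normal_mgf// -EFinM -expRD sqr_sqrtr ?subr_ge0 ?ltW//.
  by congr (expR _)%:E; field.
Qed.

(** The constant [s] makes the martingale [x ^+ 2 - t] nonnegative up to time
    [s]. *)
Lemma caloric_sqr s : caloric s (fun t x => x ^+ 2 + (s - t)).
Proof.
split.
- move=> z; apply: cvgD; last by apply: cvgB; [exact: cvg_cst|exact: cvg_fst].
  apply: (@continuous_comp _ _ _ snd (fun x => x ^+ 2)); first exact: cvg_snd.
  exact: exprn_continuous.
- apply: measurable_funD; first by apply: measurable_funX; exact: measurable_snd.
  by apply: measurable_funB => //; exact: measurable_fst.
- by move=> t x /andP[t0 ts]; rewrite addr_ge0 ?sqr_ge0 ?subr_ge0.
- move=> t x /andP[t0 ts].
  have st0 : 0 < Num.sqrt (s - t) by rewrite sqrtr_gt0 subr_gt0.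
  under eq_integral do rewrite subrr addr0.
  by rewrite normal_shifted_second_moment// sqr_sqrtr ?subr_ge0 ?ltW.
Qed.

Lemma caloricD s phi psi : caloric s phi -> caloric s psi ->
  caloric s (fun t x => phi t x + psi t x).
Proof.
move=> cphi cpsi; split.
- move=> z; apply: cvgD; [exact: (caloric_continuous cphi)|exact: (caloric_continuous cpsi)].
- apply: measurable_funD; [exact: (caloric_jointly_measurable cphi)|].
  exact: (caloric_jointly_measurable cpsi).
- move=> t x ts; apply: addr_ge0; [exact: (caloric_ge0 cphi)|exact: (caloric_ge0 cpsi)].
- move=> t x /andP[t0 ts]; have s0 := le_trans t0 (ltW ts).
  under eq_integral do rewrite EFinD.
  have m0 (f : R -> R -> R) : caloric s f -> measurable_fun setT (fun z => (f s (x + z))%:E).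
    move=> cf; apply/measurable_EFinP; apply: measurableT_comp; first exact: (caloric_measurable cf).
    exact: measurable_funD.
  rewrite ge0_integralD//=; [|move=> z _; rewrite lee_fin| |move=> z _; rewrite lee_fin|].
  + by rewrite (caloric_heat cphi) ?t0// (caloric_heat cpsi) ?t0.
  + by apply: (caloric_ge0 cphi); rewrite s0 lexx.
  + exact: m0.
  + by apply: (caloric_ge0 cpsi); rewrite s0 lexx.
  + exact: m0.
Qed.

(** Subtracting from a larger caloric function preserves nonnegativity, and
    hence allows Fatou's lemma to be used in the other direction. *)
Lemma caloric_majorantB s phi psi (e C : R) : 0 <= e -> 0 <= C ->
  caloric s phi -> caloric s psi ->
  (forall t x, 0 <= t <= s -> phi t x <= e * psi t x + C) ->
  caloric s (fun t x => e * psi t x + C - phi t x).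
Proof.
move=> e0 C0 cphi cpsi le; split.
- move=> z; apply: cvgB; last exact: (caloric_continuous cphi).
  apply: cvgD; last exact: cvg_cst.
  apply: cvgM; [exact: cvg_cst|exact: (caloric_continuous cpsi)].
- apply: measurable_funB; last exact: (caloric_jointly_measurable cphi).
  apply: measurable_funD => //; apply: measurable_funM => //.
  exact: (caloric_jointly_measurable cpsi).
- by move=> t x ts; rewrite subr_ge0 le.
- move=> t x /andP[t0 ts]; have s0 := le_trans t0 (ltW ts).
  have ss : 0 <= s <= s by rewrite s0 lexx.
  have m0 (f : R -> R -> R) : caloric s f -> measurable_fun setT (fun z => f s (x + z)).
    move=> cf; apply: measurableT_comp; first exact: (caloric_measurable cf).
    exact: measurable_funD.
  set N := normal_prob 0 _.
  have H : (\int[N]_z (e * psi s (x + z)%R + C - phi s (x + z)%R)%:E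
            + (phi t x)%:E = (e * psi t x + C)%:E)%E.
    rewrite -(caloric_heat cphi) ?t0// -ge0_integralD//=.
    + transitivity (\int[N]_z (e%:E * (psi s (x + z))%:E + C%:E))%E.
        by apply: eq_integral => z _; rewrite -EFinM -!EFinD; congr EFin; ring.
      rewrite ge0_integralD//=.
      * rewrite integral_cst//= probability_setT mule1 ge0_integralZl//=.
        -- by rewrite (caloric_heat cpsi) ?t0.
        -- by apply/measurable_EFinP; exact: (m0 _ cpsi).
        -- by move=> z _; rewrite lee_fin (caloric_ge0 cpsi).
      * by move=> z _; rewrite mule_ge0// lee_fin (caloric_ge0 cpsi).
      * apply/measurable_EFinP; apply: measurable_funM => //; exact: (m0 _ cpsi).
    + by move=> z _; rewrite lee_fin subr_ge0 le.
    + apply/measurable_EFinP; apply: measurable_funB; last exact: (m0 _ cphi).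
      apply: measurable_funD => //; apply: measurable_funM => //; exact: (m0 _ cpsi).
    + by move=> z _; rewrite lee_fin (caloric_ge0 cphi).
    + by apply/measurable_EFinP; exact: (m0 _ cphi).
  move: H; case: (integral _ _ _) => [r| |]//= [] H.
  by congr EFin; apply/eqP; rewrite eq_sym subr_eq; apply/eqP.
Qed.

End caloric.

(** * Independence of increments as an integral identity *)

Section restricted_law.
Context {R : realType} d d' (T : measurableType d) (U : measurableType d').
Variables (P : probability T R) (A : set T) (X : T -> U).

(** The proofs of measurability are arguments so that the measure structure can
    be attached to the function of sets. *)
Definition restricted_law of measurable A & measurable_fun setT X :
  set U -> \bar R := fun B => P (A `&` X @^-1` B).

Hypotheses (mA : measurable A) (mX : measurable_fun setT X).

Let m0 : restricted_law mA mX set0 = 0%E.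
Proof. by rewrite /restricted_law preimage_set0 setI0 measure0. Qed.

Let mge0 B : (0 <= restricted_law mA mX B)%E. Proof. exact: measure_ge0. Qed.

Let mpre B : measurable B -> measurable (A `&` X @^-1` B).
Proof. by move=> mB; apply: measurableI => //; rewrite -[_ @^-1` _]setTI; exact: mX. Qed.

Let msa : semi_sigma_additive (restricted_law mA mX).
Proof.
move=> F mF tF mUF; rewrite /restricted_law preimage_bigcup setI_bigcupr.
apply: measure_semi_sigma_additive.
- by move=> n; exact: mpre.
- apply/trivIsetP => i j _ _ ij; rewrite setIACA setIid -preimage_setI.
  by move/trivIsetP : tF => -> //; rewrite preimage_set0 setI0.
- by rewrite -setI_bigcupr -preimage_bigcup; exact: mpre.
Qed.

HB.instance Definition _ := isMeasure.Build _ _ _ (restricted_law mA mX) m0 mge0 msa.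

Let mfin : fin_num_fun (restricted_law mA mX).
Proof. by move=> B mB; apply: fin_num_measure; exact: mpre. Qed.

HB.instance Definition _ := Measure_isFinite.Build _ _ _ (restricted_law mA mX) mfin.

Lemma ge0_integral_restricted_law (f : U -> \bar R) :
  measurable_fun setT f -> (forall x, 0 <= f x)%E ->
  (\int[restricted_law mA mX]_x f x = \int[P]_(w in A) f (X w))%E.
Proof.
move=> mf f0; have mfX : measurable_fun setT (f \o X) by exact: measurableT_comp.
transitivity (\int[pushforward (mrestr P mA) X]_x f x)%E.
  by apply: eq_measure_integral => B mB _; rewrite /= /restricted_law setIC.
rewrite ge0_integral_pushforward//=.
rewrite (@ge0_negligible_integral _ _ _ (mrestr P mA) _ (~` A))//=.
- rewrite preimage_setT setTD setCK; apply: eq_measure_integral => B mB BA.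
  by rewrite /= /mrestr setIidl.
- exact: measurableC.
- by rewrite preimage_setT.
- by rewrite /mrestr setICl measure0.
Qed.

End restricted_law.

Section freezing.
Local Open Scope ereal_scope.
Context {R : realType} d d1 d2 (T : measurableType d) (U1 : measurableType d1)
  (U2 : measurableType d2) (P : probability T R).

(** If the increment [D] is independent of [A] and [X], with law [N], it can be
    integrated out first with [X] frozen: on [A], the joint law of [X] and [D]
    is a product measure. *)
Lemma ge0_integral_freezing (A : set T) (X : T -> U1) (D : T -> U2)
    (N : probability U2 R) (f : U1 * U2 -> \bar R) :
  measurable A -> measurable_fun setT X -> measurable_fun setT D ->
  (forall (B : set U1) (C : set U2), measurable B -> measurable C ->
    P ((A `&` X @^-1` B) `&` D @^-1` C) = P (A `&` X @^-1` B) * N C) ->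
  measurable_fun setT f -> (forall z, 0 <= f z) ->
  \int[P]_(w in A) f (X w, D w) = \int[P]_(w in A) \int[N]_z f (X w, z).
Proof.
move=> mA mX mD ind mf f0.
have mXD : measurable_fun setT (fun w => (X w, D w)) by exact: measurable_fun_pair.
rewrite -(ge0_integral_restricted_law P mA mXD mf f0).
rewrite -(ge0_integral_restricted_law P mA mX (f := fun x => \int[N]_z f (x, z))); last 2 first.
- exact: (measurable_fun_fubini_tonelli_F f).
- by move=> x; apply: integral_ge0 => z _; exact: f0.
rewrite -(fubini_tonelli1 f)//; apply: eq_measure_integral => B mB _.
apply/esym; apply: product_measure_unique => // B1 B2 mB1 mB2.
by rewrite /restricted_law -ind//= -setIA.
Qed.

End freezing.

(** * Brownian motion with everywhere continuous paths *)

Section filtration_sets.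
Context {T : pointedType} (G : set (set T)).
Hypothesis sG : sigma_algebra [set: T] G.

Lemma sigma_algebra_setI A B : G A -> G B -> G (A `&` B).
Proof.
rewrite -(measurable_g_measurableTypeE sG) => GA GB.
exact: (@measurableI _ (g_sigma_algebraType G)).
Qed.

Lemma sigma_algebra_setC A : G A -> G (~` A).
Proof.
rewrite -(measurable_g_measurableTypeE sG) => GA.
exact: (@measurableC _ (g_sigma_algebraType G)).
Qed.

Lemma sigma_algebra_setU A B : G A -> G B -> G (A `|` B).
Proof.
rewrite -(measurable_g_measurableTypeE sG) => GA GB.
exact: (@measurableU _ (g_sigma_algebraType G)).
Qed.

Lemma sigma_algebra_setD A B : G A -> G B -> G (A `\` B).
Proof.
rewrite -(measurable_g_measurableTypeE sG) => GA GB.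
exact: (@measurableD _ (g_sigma_algebraType G)).
Qed.

Lemma sigma_algebra_bigsetU (F : nat -> set T) n :
  (forall k, (k < n)%N -> G (F k)) -> G (\big[setU/set0]_(k < n) F k).
Proof.
rewrite -(measurable_g_measurableTypeE sG) => GF.
by apply: (@bigsetU_measurable _ (g_sigma_algebraType G)) => k _; exact: GF.
Qed.

Lemma sigma_algebra_bigcapT (F : nat -> set T) :
  (forall k, G (F k)) -> G (\bigcap_k F k).
Proof.
rewrite -(measurable_g_measurableTypeE sG) => GF.
exact: (@bigcapT_measurable _ (g_sigma_algebraType G)).
Qed.

End filtration_sets.

Section continuous_process.
Context {R : realType} d (T : measurableType d) (B : R -> T -> R).
Hypotheses (mB : forall t, measurable_fun setT (B t))
  (cB : forall w, continuous (B ^~ w))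
  (B0 : forall t w, t <= 0 -> B t w = 0).

(** The process is the limit of its interpolations from the left on the grids
    [k / n], each of which takes countably many measurable slices. *)
Lemma measurable_process : measurable_fun setT (fun z : R * T => B z.1 z.2).
Proof.
pose k n (t : R) := Num.truncn (Num.max t 0 * n.+1%:R).
pose Bn n (z : R * T) := B ((k n z.1)%:R / n.+1%:R) z.2.
apply: (@measurable_fun_cvg _ _ _ _ Bn).
- move=> n _ D mD; rewrite setTI.
  pose I j : set R := (fun t => Num.max t 0 * n.+1%:R) @^-1` `[j%:R, j.+1%:R[.
  have mI j : measurable (I j).
    rewrite -[I j]setTI; suff m : measurable_fun [set: R] (fun t : R => Num.max t 0 * n.+1%:R).
      by apply: m => //; exact: measurable_itv.
    apply: measurable_funM => //; exact: measurable_maxr.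
  have IE j t : I j t <-> k n t = j.
    rewrite /I /= in_itv /= /k; split => [|<-]; first exact: truncn_def.
    by apply: truncn_itv; rewrite mulr_ge0// le_max lexx orbT.
  have -> : Bn n @^-1` D = \bigcup_j (I j `*` (B (j%:R / n.+1%:R) @^-1` D)).
    apply/seteqP; split => [[t w] /= Dz|[t w] [j _ [/= /IE <-]]//].
    by exists (k n t) => //; split => //=; exact/IE.
  apply: bigcupT_measurable => j; apply: measurableX => //.
  by rewrite -[_ @^-1` _]setTI; exact: mB.
- move=> [t w] _; have -> : B t w = B (Num.max t 0) w.
    by rewrite maxEle; case: ifPn => // t0; rewrite !B0.
  apply: (@cvg_comp _ _ _ (fun n => (k n t)%:R / n.+1%:R : R) (B ^~ w) \oo
    (nbhs (Num.max t 0))); last exact: cB.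
  have m0 : 0 <= Num.max t 0 by rewrite le_max lexx orbT.
  apply/cvgrPdist_le => e e0; near=> n.
  have n0 : (0 : R) < n.+1%:R by [].
  have /andP[lo hi] := truncn_itv (mulr_ge0 m0 (ltW n0)).
  rewrite -/(k n t) in lo hi; rewrite ger0_norm ?subr_ge0 ?ler_pdivrMr//.
  apply: (@le_trans _ _ (n.+1%:R^-1)).
    by rewrite lerBlDl -[X in _ + X]mul1r -mulrDl ler_pdivlMr// natr1 ltW.
  near: n; have /cvgrPdist_le/(_ _ e0) := @cvg_harmonic R; apply: filterS => n /=.
  by rewrite sub0r normrN ger0_norm.
Unshelve. all: by end_near. Qed.

End continuous_process.

Section continuous_bm.
Context {R : realType} d (Omega : measurableType d) (P : probability Omega R).
Implicit Types (F : R -> set (set Omega)) (B : R -> Omega -> R).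

(** Extending the paths by [0] to negative times makes continuity a statement on
    the whole line; independence and Gaussian law of the increments are one
    product formula. *)
Record continuous_bm F B : Prop := ContinuousBM {
  cbm_filtration : forall t, 0 <= t -> sigma_algebra [set: Omega] (F t) ;
  cbm_filtration_measurable : forall t, 0 <= t -> F t `<=` measurable ;
  cbm_filtration_nondecreasing : forall s t, 0 <= s -> s <= t -> F s `<=` F t ;
  cbm_adapted : forall t, 0 <= t ->
    forall D : set R, measurable D -> F t (B t @^-1` D) ;
  cbm_nonpositive_time : forall t w, t <= 0 -> B t w = 0 ;
  cbm_continuous : forall w, continuous (B ^~ w) ;
  cbm_increment : forall s t, 0 <= s -> s < t ->
    forall (A : set Omega) (D : set R), F s A -> measurable D ->
    P (A `&` (fun w => B t w - B s w) @^-1` D) =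
    (P A * normal_prob 0 (Num.sqrt (t - s)) D)%E }.

Variables (F : R -> set (set Omega)) (B : R -> Omega -> R).
Hypothesis bm : continuous_bm F B.

Let mF t (t0 : 0 <= t) := cbm_filtration_measurable bm t0.

Lemma cbm_measurable t : measurable_fun setT (B t).
Proof.
move=> _ D mD; rewrite setTI; have [t0|/ltW t0] := leP 0 t.
  by apply: (mF t0); exact: (cbm_adapted bm).
rewrite (_ : B t = cst 0).
  by rewrite preimage_cst; case: ifP => _; [exact: measurableT|exact: measurable0].
by apply/funext => w; exact: (cbm_nonpositive_time bm).
Qed.

Lemma cbm_jointly_measurable : measurable_fun setT (fun z : R * Omega => B z.1 z.2).
Proof.
exact: measurable_process cbm_measurable (cbm_continuous bm) (cbm_nonpositive_time bm).
Qed.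

(** The increment over [t, s] is independent of [F t]: freeze [B t] and integrate
    the increment out with [caloric_heat]. *)
Lemma caloric_martingale phi s t (x : R) A : caloric s phi -> 0 <= t <= s -> F t A ->
  (\int[P]_(w in A) (phi s (x + B s w))%:E = \int[P]_(w in A) (phi t (x + B t w))%:E)%E.
Proof.
move=> cphi /andP[t0]; rewrite le_eqVlt => /predU1P[->//|ts] FA.
have s0 := le_trans t0 (ltW ts).
have mA := mF t0 FA.
pose f (z : R * R) := (phi s (x + z.1 + z.2))%:E.
transitivity (\int[P]_(w in A) f (B t w, (B s w - B t w)%R))%E.
  by apply: eq_integral => w _; rewrite /f /= -addrA subrKC.
rewrite (@ge0_integral_freezing R _ _ _ Omega R (measurableTypeR R) P A (B t)
    (fun w => B s w - B t w) (normal_prob 0 (Num.sqrt (s - t))))//.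
- apply: eq_integral => w _.
  by rewrite -(caloric_heat cphi) ?t0//; apply: eq_integral => z _.
- exact: cbm_measurable.
- apply: measurable_funB; exact: cbm_measurable.
- move=> D E mD mE; apply: (cbm_increment bm) => //.
  apply: sigma_algebra_setI => //; first exact: (cbm_filtration bm).
  exact: (cbm_adapted bm).
- apply/measurable_EFinP; apply: measurableT_comp; first exact: (caloric_measurable cphi).
  by apply: measurable_funD => //; exact: measurable_funD.
- by move=> z; rewrite lee_fin (caloric_ge0 cphi)// s0 lexx.
Qed.

End continuous_bm.

(** * Optional stopping *)

Section optional_stopping.
Context {R : realType} d (Omega : measurableType d) (P : probability Omega R).
Variables (F : R -> set (set Omega)) (B : R -> Omega -> R).
Hypothesis bm : continuous_bm P F B.
Variables (tau : Omega -> \bar R) (x : R).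
Hypothesis stau : stopping_time F tau.

Let mF t (t0 : 0 <= t) := cbm_filtration_measurable bm t0.

Lemma stopping_time_measurable : measurable_fun setT tau.
Proof.
apply: (measurability _ (ErealGenOInfty.measurableE R)) => // _ [_ [t ->] <-].
rewrite setTI; have -> : tau @^-1` `]t%:E, +oo[ = ~` [set w | (tau w <= t%:E)%E].
  by apply/seteqP; split => w /=; rewrite in_itv/= andbT ltNge => /negP.
apply: measurableC; have [t0|t0] := leP 0 t.
  by apply: (mF t0); case: stau => _; exact.
rewrite (_ : [set _ | _] = set0)//; apply/seteqP; split => w //= /(le_trans (stau.1 w)).
by rewrite lee_fin leNgt t0.
Qed.

Let tau0 w : (0 <= tau w)%E. Proof. by case: stau => + _; exact. Qed.

Definition stopped (phi : R -> R -> R) (w : Omega) : R :=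
  phi (fine (tau w)) (x + B (fine (tau w)) w).

Lemma measurable_stopped_before s : 0 <= s -> measurable [set w | (tau w <= s%:E)%E].
Proof. by move=> s0; apply: (mF s0); case: stau => _; exact. Qed.

Lemma measurable_stopped phi : measurable_fun setT (fun z : R * R => phi z.1 z.2) ->
  measurable_fun setT (stopped phi).
Proof.
move=> mphi.
have mtau : measurable_fun setT (fun w => fine (tau w)).
  by apply: measurableT_comp => //; exact: stopping_time_measurable.
have mX : measurable_fun setT (fun w => x + B (fine (tau w)) w).
  apply: measurable_funD => //.
  apply: (measurableT_comp (cbm_jointly_measurable bm)
    (g := fun w => (fine (tau w), w))).
  exact: measurable_fun_pair.
exact: (measurableT_comp mphi (measurable_fun_pair mtau mX)).
Qed.

(** Fatou's lemma along the grids [s k / n]: the stopping time is rounded up to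
    the grid, where the martingale property applies piece by piece. *)
Lemma caloric_stopping_le phi s : 0 <= s -> caloric s phi ->
  (\int[P]_(w in [set w | (tau w <= s%:E)%E]) (stopped phi w)%:E
   <= \int[P]_(w in [set w | (tau w <= s%:E)%E]) (phi s (x + B s w))%:E)%E.
Proof.
move=> s0 cphi; set E := [set w | _].
have mE : measurable E by exact: measurable_stopped_before.
pose t n (k : nat) : R := s * (k%:R / n.+1%:R).
have t0 n k : 0 <= t n k by rewrite mulr_ge0// divr_ge0.
have tn n : t n n.+1 = s by rewrite /t divff ?mulr1.
have tle n k l : (k <= l)%N -> t n k <= t n l.
  by move=> kl; rewrite ler_wpM2l// ler_wpM2r ?ler_nat// invr_ge0.
pose L n k := [set w | (tau w <= (t n k)%:E)%E].
pose A n := seqDU (L n).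
have FL n k j : (k <= j)%N -> F (t n j) (L n k).
  move=> kj; apply: (cbm_filtration_nondecreasing bm) (t0 n k) (tle n _ _ kj) _ _.
  by case: stau => _; exact.
have FA n k : F (t n k) (A n k).
  apply: sigma_algebra_setD; first exact: (cbm_filtration bm).
    exact: FL.
  apply: sigma_algebra_bigsetU; first exact: (cbm_filtration bm).
  by move=> j jk; apply: FL; exact: ltnW.
have mA n k : measurable (A n k) by apply: (mF (t0 n k)); exact: FA.
have mphi r : measurable_fun setT (fun w => (phi r (x + B r w))%:E).
  apply/measurable_EFinP; apply: measurableT_comp; first exact: (caloric_measurable cphi).
  apply: measurable_funD => //; exact: (cbm_measurable bm).
have EA n : \big[setU/set0]_(k < n.+2) A n k = E.
  rewrite -bigsetU_seqDU; apply/seteqP; split => [w|w Ew].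
    rewrite -bigcup_mkord => -[k /= kn] /le_trans; apply.
    by rewrite lee_fin -(tn n); exact: tle.
  by rewrite big_ord_recr/= /L tn; right.
pose f n w := (\sum_(k < n.+2) ((fun w => (phi (t n k) (x + B (t n k) w))%:E) \_ (A n k)) w)%E.
have tns n (k : 'I_n.+2) : 0 <= t n k <= s.
  by rewrite t0 /= -(tn n); apply: tle; rewrite -ltnS.
have fk0 n (k : 'I_n.+2) w : (0 <= ((fun w => (phi (t n k) (x + B (t n k) w))%:E) \_ (A n k)) w)%E.
  by rewrite patchE; case: ifPn => // _; rewrite lee_fin (caloric_ge0 cphi).
have mfk n (k : 'I_n.+2) : measurable_fun setT
    ((fun w => (phi (t n k) (x + B (t n k) w))%:E) \_ (A n k)).
  by apply/(measurable_restrictT _ (mA n k)); exact: measurable_funTS.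
have If n : (\int[P]_w f n w = \int[P]_(w in E) (phi s (x + B s w))%:E)%E.
  rewrite ge0_integral_sum//.
  rewrite -(EA n) -(big_mkord xpredT (A n)) ge0_integral_bigsetU//; last 4 first.
  - exact: iota_uniq.
  - by apply: sub_trivIset (@trivIset_seqDU _ (L n)).
  - exact: measurable_funTS.
  - by move=> w _; rewrite lee_fin (caloric_ge0 cphi)// s0 lexx.
  rewrite big_mkord; apply: eq_bigr => k _.
  by rewrite -integral_mkcond; apply/esym/(caloric_martingale bm).
rewrite integral_mkcond.
have fcvg w : f n w @[n --> \oo] --> ((fun w => (stopped phi w)%:E) \_ E) w.
  rewrite patchE; case: ifPn => [|]; rewrite ?inE ?notin_setE => Ew; last first.
    rewrite (_ : (fun n => f n w) = cst 0%E); first exact: cvg_cst.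
    apply/funext => n; rewrite /f big1// => k _; rewrite patchE ifF//.
    apply/negbTE; rewrite notin_setE => Aw; apply: Ew; rewrite -(EA n).
    by rewrite -bigcup_mkord; exists k => //=.
  have tauE : (fine (tau w))%:E = tau w.
    rewrite fineK// ge0_fin_numE//; apply: le_lt_trans Ew _; exact: ltry.
  have /choice[q qP] : forall n, exists q, f n w = (phi q (x + B q w))%:E /\
      `|fine (tau w) - q| <= s / n.+1%:R.
    move=> n; have : E w by []; rewrite -{1}(EA n) -bigcup_mkord => -[k /= kn Ak].
    exists (t n k); split.
      rewrite /f (bigD1 (Ordinal kn))//= patchE mem_set// big1 ?adde0// => j jk.
      rewrite patchE ifF//; apply/negbTE; rewrite notin_setE => Aj.
      have := @trivIset_seqDU _ (L n) j k Logic.I Logic.I.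
      move=> jkE; move: jk; rewrite -val_eqE/= jkE ?eqxx//; exists w; split => //; exact: Aj.
    have tk : fine (tau w) <= t n k.
      by rewrite -lee_fin tauE; case: Ak.
    rewrite ler0_norm ?subr_le0// opprB; move: Ak tk; case: k kn => [kn [] _ _ _|k kn [] _ nA _].
      rewrite {1}/t mul0r mulr0 sub0r lerNl (@le_trans _ _ 0)// ?oppr_le0 ?divr_ge0//.
      by rewrite fine_ge0.
    have : t n k < fine (tau w).
      rewrite -lte_fin tauE ltNge; apply/negP => tk; apply: nA.
      by rewrite -bigcup_mkord; exists k => /=.
    move=> /ltW tk; rewrite lerBlDl; apply: (@le_trans _ _ (t n k + s / n.+1%:R)).
      by rewrite /t -mulrDr -[X in _ + X]mul1r -mulrDl natr1.
    by rewrite lerD2r.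
  under eq_fun do rewrite (qP _).1.
  apply/cvg_EFin; first by apply: nearW.
  rewrite /comp /=; have qtau : q n @[n --> \oo] --> fine (tau w).
    apply/cvgrPdist_le => e e0.
    have es : 0 < e / (s + 1) by rewrite divr_gt0// ltr_wpDl.
    have /cvgrPdist_le/(_ _ es) := @cvg_harmonic R; apply: filterS => n /=.
    rewrite sub0r normrN ger0_norm// => ne.
    apply: le_trans (qP n).2 _; apply: (@le_trans _ _ ((s + 1) * n.+1%:R^-1)).
      by rewrite ler_wpM2r// lerDl.
    by rewrite mulrC -ler_pdivlMr// ltr_wpDl.
  have cphi2 : continuous (fun z : R * R => phi z.1 z.2) by exact: caloric_continuous cphi.
  rewrite /stopped; apply: (@continuous2_cvg _ _ _ _ \oo _ q (fun n => x + B (q n) w)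
    phi (fine (tau w)) (x + B (fine (tau w)) w)).
  - exact: (cphi2 (_, _)).
  - exact: qtau.
  - apply: cvgD; first exact: cvg_cst.
    apply: (@cvg_comp _ _ _ q (B ^~ w) \oo (nbhs (fine (tau w)))) => //.
    exact: (cbm_continuous bm).
have : (\int[P]_w limn_einf (fun n => f n w) <= limn_einf (fun n => \int[P]_w f n w))%E.
  apply: fatou => //.
  - by move=> n; apply: emeasurable_sum => k; exact: mfk.
  - by move=> n w _; apply: sume_ge0 => k _.
under [X in limn_einf X]eq_fun do rewrite If.
rewrite is_cvg_limn_einfE; last exact: is_cvg_cst.
rewrite lim_cst//; congr (_ <= _)%E.
apply: eq_integral => w _; rewrite is_cvg_limn_einfE; last by apply/cvg_ex; eexists; exact: fcvg.
by apply/cvg_lim => //; exact: fcvg.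
Qed.

End optional_stopping.

Section optional_stopping_identities.
Context {R : realType} d (Omega : measurableType d) (P : probability Omega R).
Variables (F : R -> set (set Omega)) (B : R -> Omega -> R).
Hypothesis bm : continuous_bm P F B.
Variables (tau : Omega -> \bar R) (x : R).
Hypothesis stau : stopping_time F tau.
Local Notation stopped := (stopped B tau x).
Local Notation before s := [set w | (tau w <= s%:E)%E].

Let mb s : 0 <= s -> measurable (before s).
Proof. exact: (measurable_stopped_before bm stau). Qed.

Let tau0 w : (0 <= tau w)%E. Proof. by case: stau => + _; exact. Qed.

Let tau_before s w : 0 <= s -> before s w -> 0 <= fine (tau w) <= s.
Proof.
move=> s0 Ew; rewrite fine_ge0//= -lee_fin fineK// ge0_fin_numE//.
exact: le_lt_trans Ew (ltry _).
Qed.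

Let mX phi s : caloric s phi -> measurable_fun setT (fun w => (phi s (x + B s w))%:E).
Proof.
move=> c; apply/measurable_EFinP; apply: measurableT_comp; first exact: (caloric_measurable c).
apply: measurable_funD => //; exact: (cbm_measurable bm).
Qed.

Let mstop phi s : caloric s phi -> measurable_fun setT (fun w => (stopped phi w)%:E).
Proof.
by move=> c; apply/measurable_EFinP; apply: (measurable_stopped bm x stau);
  exact: (caloric_jointly_measurable c).
Qed.

Lemma caloric_mean phi s : 0 <= s -> caloric s phi ->
  (\int[P]_w (phi s (x + B s w))%:E = (phi 0 x)%:E)%E.
Proof.
move=> s0 c; rewrite (caloric_martingale bm (t := 0) x c); last 2 first.
- by rewrite lexx.
- have := cbm_filtration bm (lexx 0) => -[_ + _] => /(_ set0).
  by rewrite setD0; apply; case: (cbm_filtration bm (lexx 0)).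
under eq_integral do rewrite (cbm_nonpositive_time bm) ?addr0//.
by rewrite integral_cst//= probability_setT mule1.
Qed.

(** When [phi] is dominated by [e * psi + C] with [psi] caloric and [e]
    arbitrarily small, no mass escapes in Fatou's lemma. *)
Lemma caloric_stopping_ge phi psi s : 0 <= s -> caloric s phi -> caloric s psi ->
  (forall e, 0 < e -> exists2 C, 0 <= C &
    forall t z, 0 <= t <= s -> phi t z <= e * psi t z + C) ->
  (\int[P]_(w in before s) (phi s (x + B s w))%:E <=
   \int[P]_(w in before s) (stopped phi w)%:E)%E.
Proof.
move=> s0 cphi cpsi dom; apply/lee_addgt0Pr => e e0.
have ss : 0 <= s <= s by rewrite s0 lexx.
have psi0 : 0 <= psi 0 x by apply: (caloric_ge0 cpsi); rewrite lexx.
pose e' := e / (psi 0 x + 1); have e'0 : 0 < e' by rewrite divr_gt0// ltr_wpDl.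
have [C C0 le] := dom _ e'0.
pose chi t z := e' * psi t z + C - phi t z.
have cchi : caloric s chi by apply: caloric_majorantB => //; exact: ltW.
have stopped0 f w : caloric s f -> before s w -> (0 <= (stopped f w)%:E)%E.
  by move=> c Ew; rewrite lee_fin (caloric_ge0 c)// tau_before.
have X0 f w : caloric s f -> (0 <= (f s (x + B s w))%:E)%E.
  by move=> c; rewrite lee_fin (caloric_ge0 c).
have key (u p q : Omega -> R) :
    measurable_fun setT (fun w => (u w)%:E) -> measurable_fun setT (fun w => (p w)%:E) ->
    measurable_fun setT (fun w => (q w)%:E) ->
    (forall w, before s w -> 0 <= (u w)%:E)%E -> (forall w, before s w -> 0 <= (p w)%:E)%E ->
    (forall w, before s w -> 0 <= (q w)%:E)%E -> (forall w, u w = e' * q w + C - p w) ->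
    (\int[P]_(w in before s) (u w)%:E + \int[P]_(w in before s) (p w)%:E =
     e'%:E * \int[P]_(w in before s) (q w)%:E + C%:E * P (before s))%E.
  move=> mu mp mq u0 p0 q0 uE; have mE := mb s0.
  rewrite -ge0_integralD//; [|exact: measurable_funTS..].
  transitivity (\int[P]_(w in before s) (e'%:E * (q w)%:E + C%:E))%E.
    by apply: eq_integral => w _; rewrite -EFinM -!EFinD uE subrK.
  rewrite ge0_integralD//.
  - rewrite integral_cst// ge0_integralZl//; last by rewrite lee_fin ltW.
    exact: measurable_funTS.
  - by move=> w Ew; rewrite mule_ge0 ?q0// lee_fin ltW.
  - by apply: emeasurable_funM => //; exact: measurable_funTS.
have Istop := key _ _ _ (mstop cchi) (mstop cphi) (mstop cpsi)
  (fun w => stopped0 chi w cchi) (fun w => stopped0 phi w cphi) (fun w => stopped0 psi w cpsi)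
  (fun=> erefl).
have IX := key _ _ _ (mX cchi) (mX cphi) (mX cpsi)
  (fun w _ => X0 chi w cchi) (fun w _ => X0 phi w cphi) (fun w _ => X0 psi w cpsi)
  (fun=> erefl).
have psile : (\int[P]_(w in before s) (psi s (x + B s w))%:E <= (psi 0 x)%:E)%E.
  rewrite -(caloric_mean s0 cpsi); apply: ge0_subset_integral => //.
  - exact: mb.
  - exact: mX.
  - by move=> w _; exact: X0.
have chile := caloric_stopping_le bm x stau s0 cchi.
have i0 (f : Omega -> R) : (forall w, before s w -> (0 <= (f w)%:E)%E) ->
   (0 <= \int[P]_(w in before s) (f w)%:E)%E by move=> f0; exact: integral_ge0.
have a0 := i0 _ (fun w => stopped0 chi w cchi).
have b0 := i0 _ (fun w => stopped0 phi w cphi).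
have c0 := i0 _ (fun w => stopped0 psi w cpsi).
have a0' := i0 _ (fun w (_ : before s w) => X0 chi w cchi).
have b0' := i0 _ (fun w (_ : before s w) => X0 phi w cphi).
have c0' := i0 _ (fun w (_ : before s w) => X0 psi w cpsi).
have pE : P (before s) \is a fin_num by apply: fin_num_measure; exact: mb.
have e'psi : e' * psi 0 x <= e.
  by rewrite /e' mulrAC ler_pdivrMr ?ltr_wpDl// ler_pM2l// lerDl.
move: Istop IX psile chile a0 b0 c0 a0' b0' c0'.
rewrite -(fineK pE); move: (fine (P _)) => p.
move: (integral P _ (fun w => (phi s _)%:E)) => Jp.
move: (integral P _ (fun w => (chi s _)%:E)) => Jc.
move: (integral P _ (fun w => (psi s _)%:E)) => Js.
move: (integral P _ (fun w => (stopped phi w)%:E)) => Ip.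
move: (integral P _ (fun w => (stopped chi w)%:E)) => Ic.
move: (integral P _ (fun w => (stopped psi w)%:E)) => Is.
move=> H1 H2 H3 H4 h1 h2 h3 h4 h5 h6.
case: Js H2 H3 h6 => [js| |]// H2 H3 h6.
case: Jp H2 h5 => [jp| |]// H2 h5; last by case: Jc H2 {H4 h4}.
case: Jc H2 H4 h4 => [jc| |]// H2 H4 h4.
case: Ic H1 H4 h1 => [ic| |]// H1 H4 h1.
case: Ip H1 h2 => [ip| |]// H1 h2; last by rewrite leey.
case: Is H1 h3 => [js'| |]// H1 h3; last by move: H1; rewrite mulry gtr0_sg// mul1e.
move: H1 H2 H3 H4 h1 h2 h3 h4 h5 h6 => [H1] [H2]; rewrite -EFinD !lee_fin => H3 H4 *.
have h : e' * js <= e' * psi 0 x by rewrite ler_pM2l.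
have h0 : 0 <= e' * js' by rewrite mulr_ge0// ltW.
lra.
Qed.

Local Notation expM a := (fun t z : R => expR (a * z - a ^+ 2 / 2 * t)).

Let cosh_caloric a s : caloric s (fun t z => expM a t z + expM (- a) t z).
Proof. by apply: caloricD; exact: caloric_expR. Qed.

(** The exponential martingale of parameter [2 * a] dominates that of parameter
    [a], by [u <= e * k * u^2 + 1 / (4 * e * k)]. *)
Lemma exponential_stopping_ge a s : 0 <= s ->
  (\int[P]_(w in before s) (expM a s (x + B s w))%:E <=
   \int[P]_(w in before s) (stopped (expM a) w)%:E)%E.
Proof.
move=> s0; apply: (@caloric_stopping_ge _ (expM (2 * a)) s s0); try exact: caloric_expR.
move=> e e0; pose k := expR (- (2 * a ^+ 2 * s)).
have k0 : 0 < k by exact: expR_gt0.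
exists (4 * e * k)^-1; first by rewrite invr_ge0 !mulr_ge0// ltW.
move=> t z /andP[t0 ts]; pose u := expR (a * z).
have le1 : expM a t z <= u.
  by rewrite ler_expR lerBlDr lerDl mulr_ge0// divr_ge0// sqr_ge0.
have le2 : k * u ^+ 2 <= expM (2 * a) t z.
  rewrite /k /u -expRM_natl -expRD ler_expR -subr_ge0.
  have -> : 2 * a * z - (2 * a) ^+ 2 / 2 * t - (- (2 * a ^+ 2 * s) + 2 * (a * z)) =
    2 * a ^+ 2 * (s - t) by field.
  by rewrite mulr_ge0 ?subr_ge0// mulr_ge0 ?sqr_ge0.
apply: le_trans le1 _; apply: (@le_trans _ _ (e * (k * u ^+ 2) + (4 * e * k)^-1)).
  have ek : 0 < e * k by rewrite mulr_gt0.
  rewrite -subr_ge0.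
  have -> : e * (k * u ^+ 2) + (4 * e * k)^-1 - u = (2 * (e * k) * u - 1) ^+ 2 / (4 * (e * k)).
    by field; rewrite !gt_eqF.
  by rewrite divr_ge0 ?sqr_ge0// mulr_ge0// ltW.
by rewrite lerD2r ler_pM2l.
Qed.

(** Both Fatou bounds apply: the square is negligible with respect to the sum of
    the exponential martingales of parameters [1] and [- 1]. *)
Lemma square_stopping s : 0 <= s ->
  (\int[P]_(w in before s) ((x + B s w) ^+ 2)%:E =
   \int[P]_(w in before s) (stopped (fun t z => z ^+ 2 + (s - t)) w)%:E)%E.
Proof.
move=> s0; have sE : (\int[P]_(w in before s) ((x + B s w) ^+ 2)%:E =
  \int[P]_(w in before s) ((x + B s w) ^+ 2 + (s - s))%:E)%E.
  by apply: eq_integral => w _; rewrite subrr addr0.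
rewrite sE; apply/eqP; rewrite eq_le; apply/andP; split; last first.
  exact: (caloric_stopping_le bm x stau s0 (caloric_sqr s)).
apply: (@caloric_stopping_ge (fun t z => z ^+ 2 + (s - t))
   (fun t z => expM 1 t z + expM (- 1) t z) s s0 (caloric_sqr s) (cosh_caloric 1 s)).
move=> e e0; pose k := expR (- (s / 2)); have k0 : 0 < k by exact: expR_gt0.
have ek : 0 < e * k by rewrite mulr_gt0.
exists (64 / (e * k) + s); first by rewrite addr_ge0// divr_ge0// ltW.
move=> t z /andP[t0 ts]; pose v := expR (`|z| / 2).
have v2 : v ^+ 2 <= expR z + expR (- z).
  rewrite /v -expRM_natl mulrC divfK//.
  by case: (ger0P z) => _; rewrite ?lerDl ?lerDr expR_ge0.
have z2 : z ^+ 2 <= 16 * v.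
  have -> : v = expR (`|z| / 4) ^+ 2.
    by rewrite -expRM_natl; congr expR; field.
  have h : `|z| / 4 <= expR (`|z| / 4).
    by apply: le_trans (expR_ge1Dx _); rewrite lerDr.
  have -> : z ^+ 2 = 16 * (`|z| / 4) ^+ 2.
    by rewrite -(real_normK (num_real z)); field.
  by rewrite ler_pM2l// ler_sqr ?nnegrE ?expR_ge0 ?divr_ge0.
have le2 : k * v ^+ 2 <= expM 1 t z + expM (- 1) t z.
  apply: (@le_trans _ _ (k * (expR z + expR (- z)))); first by rewrite ler_pM2l.
  rewrite mulrDr -!expRD lerD// ler_expR; lra.
have le3 : 16 * v <= e * (k * v ^+ 2) + 64 / (e * k).
  rewrite -subr_ge0.
  have -> : e * (k * v ^+ 2) + 64 / (e * k) - 16 * v = (e * k * v - 8) ^+ 2 / (e * k).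
    by field; rewrite !gt_eqF.
  by rewrite divr_ge0 ?sqr_ge0// ltW.
have le4 : e * (k * v ^+ 2) <= e * (expM 1 t z + expM (- 1) t z) by rewrite ler_pM2l.
lra.
Qed.

Lemma exponential_stopping_le a s : 0 <= s ->
  (\int[P]_(w in before s) (stopped (expM a) w)%:E <= (expR (a * x))%:E)%E.
Proof.
move=> s0; have c := caloric_expR s a.
apply: le_trans (caloric_stopping_le bm x stau s0 c) _.
apply: (@le_trans _ _ (\int[P]_w (expM a s (x + B s w))%:E)%E).
  apply: ge0_subset_integral => //; [exact: mb|exact: (mX c)].
by rewrite (caloric_mean s0 c) mulr0 subr0.
Qed.

Local Notation finite := [set w | (tau w < +oo)%E].

Lemma finite_bigcup : finite = \bigcup_n before n%:R.
Proof.
apply/seteqP; split => w /=; last first.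
  by move=> [n _ /= /le_lt_trans]; apply; exact: ltry.
move=> tw; exists (Num.truncn (fine (tau w))).+1 => //=.
rewrite -[tau w]fineK ?ge0_fin_numE// lee_fin ltW//; exact: truncnS_gt.
Qed.

Lemma measurable_finite : measurable finite.
Proof. by rewrite finite_bigcup; apply: bigcupT_measurable => n; exact: mb. Qed.

Lemma exponential_stopping_finite_le a :
  (\int[P]_(w in finite) (stopped (expM a) w)%:E <= (expR (a * x))%:E)%E.
Proof.
have := @ge0_nondecreasing_set_cvg_integral _ _ _ (fun n => before n%:R)
  (fun w => (stopped (expM a) w)%:E) P.
rewrite -finite_bigcup => cv.
have {}cv : (\int[P]_(w in before n%:R) (stopped (expM a) w)%:E @[n --> \oo] -->
   \int[P]_(w in finite) (stopped (expM a) w)%:E)%E.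
  apply: cv.
  - move=> m n mn; apply/subsetPset => w /=/le_trans; apply.
    by rewrite lee_fin ler_nat.
  - by move=> n; exact: mb.
  - by move=> n; apply: measurable_funTS; exact: mstop (caloric_expR 0 a).
  - by move=> n w _; rewrite lee_fin expR_ge0.
rewrite -(cvg_lim _ cv)//; apply: lime_le; first by apply/cvg_ex; eexists; exact: cv.
by apply: nearW => n; exact: exponential_stopping_le.
Qed.

(** If the exponential martingale stays bounded until [tau], the part of the
    mean which is still alive at time [s] is discounted away. *)
Lemma exponential_stopping_finite_ge a M : a != 0 -> 0 <= M ->
  (forall s w, 0 <= s -> ~ before s w -> expR (a * (x + B s w)) <= M) ->
  ((expR (a * x))%:E <= \int[P]_(w in finite) (stopped (expM a) w)%:E)%E.
Proof.
move=> a0 M0 bnd; apply/lee_addgt0Pr => e e0.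
pose k := a ^+ 2 / 2; have k0 : 0 < k by rewrite divr_gt0// exprn_even_gt0.
pose s := M / (k * e); have s0 : 0 <= s by rewrite divr_ge0// mulr_ge0// ltW.
have Me : M * expR (- (k * s)) <= e.
  rewrite expRN ler_pdivrMr ?expR_gt0//.
  apply: (@le_trans _ _ (e * (1 + k * s))); last by rewrite ler_pM2l// expR_ge1Dx.
  have -> : e * (1 + k * s) = e + M by rewrite /s; field; rewrite !gt_eqF.
  by rewrite lerDr ltW.
have c := caloric_expR s a.
have -> : ((expR (a * x))%:E = \int[P]_w (expM a s (x + B s w))%:E)%E.
  by rewrite (caloric_mean s0 c) mulr0 subr0.
rewrite -(setvU (before s)) ge0_integral_setU//; last 4 first.
- apply: measurableC; exact: mb.
- exact: mb.
- by rewrite setvU; exact: (mX c).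
- by rewrite /disj_set setICl.
rewrite addeC; apply: leeD.
  apply: le_trans (exponential_stopping_ge a s0) _.
  apply: ge0_subset_integral; [exact: mb|exact: measurable_finite| | |].
  - apply: measurable_funTS; exact: mstop c.
  - by move=> w _; rewrite lee_fin expR_ge0.
  - by move=> w /= /le_lt_trans; apply; exact: ltry.
apply: (@le_trans _ _ (\int[P]_(w in ~` before s) (cst e%:E w))%E).
  apply: ge0_le_integral => //.
  - apply: measurableC; exact: mb.
  - apply: measurable_funTS; exact: (mX c).
  - move=> w Ew; rewrite lee_fin expRD; apply: le_trans Me.
    by rewrite ler_wpM2r ?expR_ge0//; exact: bnd.
rewrite integral_cst//=; last by apply: measurableC; exact: mb.
rewrite -[leRHS]mule1; apply: lee_wpmul2l; first by rewrite lee_fin ltW.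
apply: probability_le1; apply: measurableC; exact: mb.
Qed.

End optional_stopping_identities.

(** * Derivatives *)

Section derivation_facts.
Context {R : realType}.
Implicit Types (f g : R -> R) (x a b c : R).

Lemma is_derive_derive1 f x a : is_derive x 1 f a -> derive1 f x = a.
Proof. by move=> df; rewrite derive1E; exact: derive_val. Qed.

Lemma is_derive_derivable f x a : is_derive x 1 f a -> derivable f x 1.
Proof. by case. Qed.

Lemma is_derive_continuous f x a : is_derive x 1 f a -> {for x, continuous f}.
Proof. by case=> df _; exact/differentiable_continuous/derivable1_diffP. Qed.

End derivation_facts.

Section discounted_integral.
Context {R : realType}.
Notation mu := (@lebesgue_measure R).

(** The integrand has an explicit antiderivative, which tends to [0] at infinity. *)
Lemma integral_discounted_affine (alpha lambda q a : R) :
  0 < alpha -> 0 <= lambda -> 0 <= q ->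
  (\int[mu]_(t in `[a, +oo[) (expR (- (alpha * t)) * (lambda * (q + (t - a))))%:E =
   (expR (- (alpha * a)) * (lambda / alpha * q + lambda / alpha ^+ 2))%:E)%E.
Proof.
move=> al0 la0 q0.
pose u (t : R) := (q + (t - a)) / alpha + (alpha ^+ 2)^-1.
pose G (t : R) := - (expR (- (alpha * t)) * (lambda * u t)).
have dG (t : R) : is_derive t 1 G (expR (- (alpha * t)) * (lambda * (q + (t - a)))).
  rewrite /G /u; apply: is_derive_eq; rewrite /GRing.scale /=.
  by field; rewrite gt_eqF.
rewrite (@ge0_continuous_FTC2y _ _ G a 0).
- rewrite sub0e -EFinN /G /u subrr addr0; congr EFin.
  by field; rewrite gt_eqF.
- by move=> t at_; rewrite mulr_ge0 ?expR_ge0// mulr_ge0// addr_ge0// subr_ge0.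
- apply: continuous_subspaceT => t; exact: is_derive_continuous.
- pose K := lambda * ((q + `|a|) / alpha + 3 / alpha ^+ 2).
  have K0 : 0 <= K.
    by rewrite mulr_ge0// addr_ge0// divr_ge0 ?addr_ge0 ?sqr_ge0// ltW.
  apply/cvgrPdist_le => e e0; near=> t.
  have t0 : 0 <= t by near: t; exact: nbhs_pinfty_ge.
  have te : 2 * K / (alpha * e) <= t by near: t; apply: nbhs_pinfty_ge; exact: num_real.
  have at_ : a <= t by near: t; apply: nbhs_pinfty_ge; exact: num_real.
  have u0 : 0 <= u t.
    apply: addr_ge0; last by rewrite invr_ge0 sqr_ge0.
    by apply: divr_ge0; [rewrite addr_ge0 ?subr_ge0|exact: ltW].
  rewrite sub0r normrN /G normrN ger0_norm ?mulr_ge0 ?expR_ge0//.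
  pose v := expR (alpha / 2 * t).
  have v1 : 1 + alpha / 2 * t <= v by exact: expR_ge1Dx.
  have at0 : 0 <= alpha / 2 * t by rewrite mulr_ge0// divr_ge0// ltW.
  have v0 : 0 < v by exact: expR_gt0.
  have Ev : expR (- (alpha * t)) = v^-1 * v^-1.
    by rewrite /v -expRN -expRD; congr expR; field.
  have uK : lambda * u t <= K * v.
    rewrite /K -mulrA ler_wpM2l// /u.
    have h1 : (q - a) / alpha <= (q + `|a|) / alpha * v.
      apply: (@le_trans _ _ ((q + `|a|) / alpha)).
        rewrite ler_pM2r ?invr_gt0// lerD2l; have := ler_norm (- a); rewrite normrN; lra.
      rewrite ler_peMr ?divr_ge0 ?addr_ge0// ?(ltW al0)//; lra.
    have h2 : t / alpha <= 2 / alpha ^+ 2 * v.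
      have -> : t / alpha = 2 / alpha ^+ 2 * (alpha / 2 * t) by field; rewrite gt_eqF.
      by rewrite ler_wpM2l ?divr_ge0 ?sqr_ge0//; lra.
    have h3 : (alpha ^+ 2)^-1 <= (alpha ^+ 2)^-1 * v.
      by rewrite ler_peMr ?invr_ge0 ?sqr_ge0//; lra.
    have -> : (q + (t - a)) / alpha = (q - a) / alpha + t / alpha by ring.
    have -> : 3 / alpha ^+ 2 = 2 / alpha ^+ 2 + (alpha ^+ 2)^-1 by ring.
    rewrite !mulrDl; lra.
  apply: (@le_trans _ _ (v^-1 * K)).
    rewrite Ev -mulrA ler_pM2l ?invr_gt0// mulrC ler_pdivrMr//.
  rewrite mulrC ler_pdivrMr//; apply: (@le_trans _ _ (e * (alpha / 2 * t))).
    move: te; rewrite ler_pdivrMr ?mulr_gt0//; lra.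
  rewrite ler_pM2l//; lra.
- by move=> t _; exact: is_derive_derivable (dG t).
- by apply: cvg_at_right_filter; exact: is_derive_continuous (dG a).
- by move=> t _; exact: is_derive_derive1 (dG t).
Unshelve. all: by end_near. Qed.

End discounted_integral.

(** * The expected running cost of a stopping time *)

Lemma mem_set_bool (T : Type) (b : T -> bool) (w : T) : (w \in [set w | b w]) = b w.
Proof. by apply/idP/idP; rewrite inE. Qed.

(** The second part is an integral over the whole line of a function cut off by a
    test on [T], the form in which Tonelli's theorem can move the integral over
    time outside when [T] is random. *)
Lemma ge0_integral_split_time {R : realType} (f : R -> \bar R) (T : \bar R) :
  (0 <= T)%E -> measurable_fun [set: measurableTypeR R] (f : measurableTypeR R -> \bar R) ->
  (forall t, 0 <= f t)%E ->
  (\int[@lebesgue_measure R]_(t in `[0%R, +oo[) f t =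
   \int[@lebesgue_measure R]_(t in [set t : R | (0 <= t)%R /\ t%:E <= T]) f t +
   \int[@lebesgue_measure R]_t (if (0 <= t)%R && (T <= t%:E) then f t else 0))%E.
Proof.
move=> T0 mf f0; case: T T0 => [r r0|_|//]; last first.
  rewrite [X in (_ + X)%E]integral0_eq ?adde0; last first.
    by move=> t _; rewrite leye_eq/= andbF.
  by congr integral; apply/seteqP; split => t /=; rewrite in_itv/= andbT ?leey//; case.
rewrite lee_fin in r0.
have -> : [set t : R | 0 <= t /\ (t%:E <= r%:E)%E] = `[0, r]%classic.
  by apply/seteqP; split => t /=; rewrite in_itv/= lee_fin => /andP.
have -> : `[0, +oo[%classic = `[0, r]%classic `|` `]r, +oo[%classic :> set R.
  by rewrite -itv_bndbnd_setU// bnd_simp.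
rewrite ge0_integral_setU//=; last 2 first.
- exact: measurable_funTS.
- apply/disj_setPS => t [] /=; rewrite !in_itv/= andbT => /andP[_ tr].
  by rewrite ltNge tr.
congr (_ + _)%E; rewrite integral_itv_obnd_cbnd; last exact: measurable_funTS.
rewrite integral_mkcond; apply: eq_integral => t _.
rewrite patchE mem_setE in_itv/= andbT lee_fin.
case: ifPn => rt; first by rewrite (le_trans r0 rt).
by rewrite andbF.
Qed.

Section running_cost_identity.
Local Open Scope ereal_scope.
Context {R : realType} d (Omega : measurableType d) (P : probability Omega R).
Variables (F : R -> set (set Omega)) (B : R -> Omega -> R).
Hypothesis bm : continuous_bm P F B.
Variables (tau : Omega -> \bar R) (x : R).
Hypothesis stau : stopping_time F tau.
Variables (alpha lambda : R).
Hypotheses (al0 : (0 < alpha)%R) (la0 : (0 < lambda)%R).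
Notation mu := (@lebesgue_measure R).

(** The expected discounted running cost of never stopping, from the state [z]. *)
Definition perpetual_cost (z : R) : R := (lambda / alpha * z ^+ 2 + lambda / alpha ^+ 2)%R.

Let X (t : R) w : R := (x + B t w)%R.
Let tau0 w : 0 <= tau w. Proof. by case: stau => + _; exact. Qed.

Let rate t (z : R) : R := (expR (- (alpha * t)) * (lambda * z))%R.
Let rate0 t z : (0 <= z)%R -> (0 <= rate t z)%R.
Proof. by move=> z0; rewrite /rate mulr_ge0 ?expR_ge0// mulr_ge0// ltW. Qed.

(* integrands over [Omega * R], extended by zero outside their domain *)
Let run (z : Omega * measurableTypeR R) : \bar R :=
  if (0 <= z.2)%R then (rate z.2 (X z.2 z.1 ^+ 2))%:E else 0.
Let run1 (z : Omega * measurableTypeR R) : \bar R :=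
  if (0 <= z.2)%R && (z.2%:E <= tau z.1) then (rate z.2 (X z.2 z.1 ^+ 2))%:E else 0.
Let tail (z : Omega * measurableTypeR R) : \bar R :=
  if (0 <= z.2)%R && (tau z.1 <= z.2%:E) then (rate z.2 (X z.2 z.1 ^+ 2))%:E else 0.
Let frozen (z : Omega * measurableTypeR R) : \bar R :=
  if (0 <= z.2)%R && (tau z.1 <= z.2%:E)
  then (rate z.2 (X (fine (tau z.1)) z.1 ^+ 2 + (z.2 - fine (tau z.1))))%:E else 0.

Let mt : measurable_fun setT (fun z : Omega * measurableTypeR R => z.2 : R).
Proof. exact: measurable_snd. Qed.

Let mX : measurable_fun setT (fun z : Omega * measurableTypeR R => X z.2 z.1).
Proof.
apply: measurable_funD => //.
apply: (measurableT_comp (cbm_jointly_measurable bm)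
  (g := fun z : Omega * measurableTypeR R => (z.2 : R, z.1))).
by apply: measurable_fun_pair.
Qed.

Let mtau : measurable_fun setT (fun z : Omega * measurableTypeR R => tau z.1).
Proof.
by apply: measurableT_comp; [exact: (stopping_time_measurable bm stau)|exact: measurable_fst].
Qed.

Let mftau : measurable_fun setT (fun z : Omega * measurableTypeR R => fine (tau z.1)).
Proof. by apply: measurableT_comp => //. Qed.

Let mXtau : measurable_fun setT
  (fun z : Omega * measurableTypeR R => X (fine (tau z.1)) z.1).
Proof.
apply: measurable_funD => //.
apply: (measurableT_comp (cbm_jointly_measurable bm)
  (g := fun z : Omega * measurableTypeR R => (fine (tau z.1), z.1))).
by apply: measurable_fun_pair.
Qed.

Let mrate (f g : Omega * measurableTypeR R -> R) : measurable_fun setT f ->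
  measurable_fun setT g -> measurable_fun setT (fun z => (rate (f z) (g z))%:E).
Proof.
move=> mf mg; apply/measurable_EFinP; apply: measurable_funM; last exact: measurable_funM.
by apply: measurableT_comp => //; apply: measurableT_comp => //; exact: measurable_funM.
Qed.

Let mnonneg : measurable_fun setT (fun z : Omega * measurableTypeR R => (0 <= z.2)%R).
Proof. exact: measurable_fun_ler. Qed.

Let mbefore : measurable_fun setT
  (fun z : Omega * measurableTypeR R => (0 <= z.2)%R && (tau z.1 <= z.2%:E)).
Proof.
apply: measurable_and => //; apply: measurable_fun_lee => //.
exact/measurable_EFinP.
Qed.

Let mrun : measurable_fun setT run.
Proof. by apply: measurable_fun_ifT => //; apply: mrate => //; exact: measurable_funX. Qed.

Let mrun1 : measurable_fun setT run1.
Proof.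
apply: measurable_fun_ifT => //; last by apply: mrate => //; exact: measurable_funX.
apply: measurable_and => //; apply: measurable_fun_lee => //.
exact/measurable_EFinP.
Qed.

Let run1_ge0 z : 0 <= run1 z.
Proof. by rewrite /run1; case: ifP => // _; rewrite lee_fin rate0// sqr_ge0. Qed.

Let running_costE w : running_cost B alpha lambda x tau w = \int[mu]_t run1 (w, t).
Proof.
rewrite /running_cost integral_mkcond; apply: eq_integral => t _.
rewrite patchE /run1/=; case: ifPn => [|].
  by rewrite inE/= => -[-> ->].
by rewrite notin_setE/= => nt; case: ifPn => // /andP.
Qed.

Lemma measurable_running_cost : measurable_fun setT (running_cost B alpha lambda x tau).
Proof.
have -> : running_cost B alpha lambda x tau = fubini_F mu run1.
  by apply/funext => w; rewrite running_costE.
exact: (measurable_fun_fubini_tonelli_F run1 mrun1 run1_ge0).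
Qed.

Lemma running_cost_ge0 w : 0 <= running_cost B alpha lambda x tau w.
Proof. by rewrite running_costE; exact: integral_ge0. Qed.

Let mtail : measurable_fun setT tail.
Proof. by apply: measurable_fun_ifT => //; apply: mrate => //; exact: measurable_funX. Qed.

Let mfrozen : measurable_fun setT frozen.
Proof.
apply: measurable_fun_ifT => //; apply: mrate => //.
by apply: measurable_funD; [exact: measurable_funX|exact: measurable_funB].
Qed.

Let run_ge0 z : 0 <= run z.
Proof. by rewrite /run; case: ifP => // _; rewrite lee_fin rate0// sqr_ge0. Qed.

Let tail_ge0 z : 0 <= tail z.
Proof. by rewrite /tail; case: ifP => // _; rewrite lee_fin rate0// sqr_ge0. Qed.

Let frozen_ge0 z : 0 <= frozen z.
Proof.
rewrite /frozen; case: ifP => // /andP[z0 tz]; rewrite lee_fin rate0// addr_ge0 ?sqr_ge0//.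
rewrite subr_ge0 -lee_fin fineK// ge0_fin_numE//.
exact: le_lt_trans tz (ltry _).
Qed.

Let Itail_frozen (t : R) : \int[P]_w tail (w, t) = \int[P]_w frozen (w, t).
Proof.
have [t0|t0] := leP 0%R t; last first.
  by under eq_integral do rewrite /tail /= leNgt t0 /=;
     under [RHS]eq_integral do rewrite /frozen /= leNgt t0 /=.
have mb : measurable [set w | tau w <= t%:E] by exact: (measurable_stopped_before bm stau t0).
pose k : R := (expR (- (alpha * t)) * lambda)%R.
have k0 : 0 <= k%:E by rewrite lee_fin mulr_ge0 ?expR_ge0// ltW.
have E1 : \int[P]_w tail (w, t) = k%:E * \int[P]_(w in [set w | tau w <= t%:E]) (X t w ^+ 2)%:E.
  rewrite -ge0_integralZl//.
  - rewrite [RHS]integral_mkcond; apply: eq_integral => w _; rewrite /tail patchE/= t0/=.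
    rewrite (mem_set_bool (fun w => tau w <= t%:E)); case: ifPn => // _; by rewrite -EFinM /rate mulrA.
  - apply: measurable_funTS; apply/measurable_EFinP/measurable_funX.
    apply: measurable_funD => //; exact: (cbm_measurable bm).
  - by move=> w _; rewrite lee_fin sqr_ge0.
have E2 : \int[P]_w frozen (w, t) =
   k%:E * \int[P]_(w in [set w | tau w <= t%:E]) (stopped B tau x (fun r z => z ^+ 2 + (t - r))%R w)%:E.
  rewrite -ge0_integralZl//.
  - rewrite [RHS]integral_mkcond; apply: eq_integral => w _; rewrite /frozen patchE/= t0/=.
    rewrite (mem_set_bool (fun w => tau w <= t%:E)); case: ifPn => // _; by rewrite -EFinM /rate mulrA.
  - apply: measurable_funTS; apply/measurable_EFinP; apply: (measurable_stopped bm x stau).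
    exact: (caloric_jointly_measurable (caloric_sqr t)).
  - move=> w tw; rewrite lee_fin addr_ge0 ?sqr_ge0// subr_ge0 -lee_fin fineK// ge0_fin_numE//.
    exact: le_lt_trans tw (ltry _).
by rewrite E1 E2 (square_stopping bm x stau).
Qed.

Let Irun (t : R) : \int[P]_w run (w, t) =
  (if (0 <= t)%R then (rate t (x ^+ 2 + (t - 0)))%:E else 0).
Proof.
rewrite /run /=; case: ifP => t0; last by rewrite integral0.
under eq_integral do rewrite /rate mulrA EFinM.
rewrite ge0_integralZl//; last 3 first.
- apply/measurable_EFinP/measurable_funX.
  apply: measurable_funD => //; exact: (cbm_measurable bm).
- by move=> w _; rewrite lee_fin sqr_ge0.
- by rewrite lee_fin mulr_ge0 ?expR_ge0// ltW.
have <- : \int[P]_w ((x + B t w) ^+ 2 + (t - t))%:E = \int[P]_w (X t w ^+ 2)%:E.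
  by apply: eq_integral => w _; rewrite subrr addr0.
by rewrite (caloric_mean bm x t0 (caloric_sqr t)) -EFinM -mulrA.
Qed.

(** Running on after [tau] costs, in mean, the perpetual cost from the state at
    [tau], discounted. By Tonelli this can be seen time by time: on
    [tau <= t] the mean of [X t ^+ 2] is that of [X tau ^+ 2 + (t - tau)], by
    [square_stopping], and the resulting integral over time is explicit. *)
Lemma expected_running_cost :
  \int[P]_w running_cost B alpha lambda x tau w +
  \int[P]_(w in [set w | tau w < +oo])
     (stopped B tau x (fun t z => expR (- (alpha * t)) * perpetual_cost z)%R w)%:E =
  (perpetual_cost x)%:E.
Proof.
have Efrozen : \int[P]_w \int[mu]_t frozen (w, t) = \int[P]_(w in [set w | tau w < +oo])
     (stopped B tau x (fun t z => expR (- (alpha * t)) * perpetual_cost z)%R w)%:E.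
  rewrite [RHS]integral_mkcond; apply: eq_integral => w _; rewrite patchE (mem_set_bool (fun w => tau w < +oo)).
  case: ifPn => tw; last first.
    rewrite integral0_eq// => t _; rewrite /frozen /= ifF//; apply/negbTE; rewrite negb_and.
    by apply/orP; right; move: tw; rewrite -leNgt leye_eq => /eqP ->; rewrite -ltNge ltry.
  have tauE : (fine (tau w))%:E = tau w by rewrite fineK// ge0_fin_numE.
  rewrite /stopped -/(X _ _) -(integral_discounted_affine _ al0 (ltW la0) (sqr_ge0 _)).
  rewrite [RHS]integral_mkcond; apply: eq_integral => t _; rewrite patchE mem_setE in_itv/= andbT.
  rewrite /frozen /= -{1}tauE lee_fin; case: ifPn => [/andP[_ ->]//|].
  rewrite negb_and; case: ifPn => // tt; rewrite orbF -ltNge => t0; exfalso.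
  by move: tt; rewrite leNgt (lt_le_trans t0)// fine_ge0.
have Esplit w : \int[mu]_t run (w, t) =
    running_cost B alpha lambda x tau w + \int[mu]_t tail (w, t).
  pose f t := (rate t (X t w ^+ 2))%:E.
  have f0 t : 0 <= f t by rewrite lee_fin rate0// sqr_ge0.
  have mf : measurable_fun [set: measurableTypeR R] (f : measurableTypeR R -> \bar R).
    exact: (measurable_fun_pair2 w (mrate mt (measurable_funX 2 mX))).
  have Er : \int[mu]_t run (w, t) = \int[mu]_(t in `[0%R, +oo[) f t.
    rewrite [RHS]integral_mkcond; apply: eq_integral => t _.
    by rewrite patchE mem_setE in_itv/= andbT.
  by rewrite Er (ge0_integral_split_time (tau0 w) mf f0).
have total : \int[P]_w \int[mu]_t run (w, t) = (perpetual_cost x)%:E.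
  rewrite (fubini_tonelli run mrun run_ge0); under eq_integral do rewrite Irun.
  transitivity (\int[mu]_(t in `[0%R, +oo[) (rate t (x ^+ 2 + (t - 0)))%:E).
    rewrite [RHS]integral_mkcond; apply: eq_integral => t _.
    by rewrite patchE mem_setE in_itv/= andbT.
  by rewrite integral_discounted_affine ?sqr_ge0// ?ltW// mulr0 oppr0 expR0 mul1r.
have Etail : \int[P]_w \int[mu]_t tail (w, t) = \int[P]_w \int[mu]_t frozen (w, t).
  rewrite (fubini_tonelli tail mtail tail_ge0) (fubini_tonelli frozen mfrozen frozen_ge0).
  by apply: eq_integral => t _; exact: Itail_frozen.
rewrite -Efrozen -Etail -ge0_integralD; first last.
- exact: (measurable_fun_fubini_tonelli_F tail mtail tail_ge0).
- by move=> w _; apply: integral_ge0 => t _; exact: tail_ge0.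
- exact: measurable_running_cost.
- by move=> w _; exact: running_cost_ge0.
- exact: measurableT.
by rewrite -total; apply: eq_integral => w _; rewrite Esplit.
Qed.

End running_cost_identity.

(** * First zeros *)

Section first_zero.
Context {R : realType} d (Omega : measurableType d) (P : probability Omega R).
Variables (F : R -> set (set Omega)) (B : R -> Omega -> R).
Hypothesis bm : continuous_bm P F B.
Variables (k : R -> R) (x : R).
Hypotheses (ck : continuous k) (kx : 0 < k x).
Let Y s w := k (x + B s w).

Let cY w : continuous (Y ^~ w).
Proof.
move=> s; apply: (@continuous_comp _ _ _ (fun s => x + B s w) k); last exact: ck.
by apply: cvgD; [exact: cvg_cst|exact: (cbm_continuous bm)].
Qed.

(** A continuous path is positive on [[0, t]] when it is bounded below by some
    [1 / (m + 1)] at the countably many times [min t (i / (j + 1))]. *)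
Let alive t := [set w | forall s, 0 <= s <= t -> 0 < Y s w].

Let grid t (ij : nat * nat) : R := Num.min t (ij.1%:R / ij.2.+1%:R).

Let grid_cvg t s : 0 <= s <= t ->
  grid t (Num.truncn (s * j.+1%:R), j) @[j --> \oo] --> s.
Proof.
move=> /andP[s0 st]; apply/cvgrPdist_le => e e0.
have /cvgrPdist_le/(_ _ e0) := @cvg_harmonic R; apply: filterS => j /=.
rewrite sub0r normrN ger0_norm// => je.
have j0 : (0 : R) < j.+1%:R by [].
have /andP[lo hi] := truncn_itv (mulr_ge0 s0 (ltW j0)).
have le : (Num.truncn (s * j.+1%:R))%:R / j.+1%:R <= s by rewrite ler_pdivrMr.
rewrite /grid /= min_r ?(le_trans le)// ger0_norm ?subr_ge0//.
apply: le_trans je; rewrite lerBlDl -[X in _ + X]mul1r -mulrDl ler_pdivlMr// natr1.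
exact: ltW.
Qed.

Let aliveE t : 0 <= t -> alive t =
  \bigcup_m \bigcap_i \bigcap_j [set w | m.+1%:R^-1 <= Y (grid t (i, j)) w].
Proof.
move=> t0; apply/seteqP; split => w /=.
  move=> al; have [|c + cmin] := @EVT_min R (Y ^~ w) 0 t t0.
    exact/continuous_subspaceT/cY.
  rewrite in_itv/= => c0t; have := al _ c0t => Yc.
  exists (Num.truncn (Y c w)^-1) => // i _ j _ /=.
  apply: (@le_trans _ _ (Y c w)).
    rewrite -[leRHS]invrK lef_pV2 ?posrE ?invr_gt0// ltW//; exact: truncnS_gt.
  apply: cmin; rewrite in_itv/= /grid/= ge_min lexx le_min t0/= andbT.
  by rewrite divr_ge0.
move=> [m _ mY] s s0t; apply: (@lt_le_trans _ _ m.+1%:R^-1); first by rewrite invr_gt0.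
have cv : Y (grid t (Num.truncn (s * j.+1%:R), j)) w @[j --> \oo] --> Y s w.
  apply: (@cvg_comp _ _ _ (fun j => grid t (Num.truncn (s * j.+1%:R), j)) (Y ^~ w) \oo (nbhs s)).
    exact: grid_cvg.
  exact: cY.
rewrite -(cvg_lim _ cv)//; apply: limr_ge; first by apply/cvg_ex; eexists; exact: cv.
by apply: nearW => j; exact: mY.
Qed.

Let F_alive t : 0 <= t -> F t (alive t).
Proof.
move=> t0; have sF := cbm_filtration bm t0; rewrite aliveE//.
case: (sF) => _ _; apply => m; apply: sigma_algebra_bigcapT => // i.
apply: sigma_algebra_bigcapT => // j.
have g0 ij : 0 <= grid t ij <= t.
  by rewrite /grid ge_min lexx le_min t0/= divr_ge0.
have /andP[g1 g2] := g0 (i, j).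
apply: (cbm_filtration_nondecreasing bm g1 g2).
rewrite (_ : [set w | _] = B (grid t (i, j)) @^-1` ((fun b => k (x + b)) @^-1` `[m.+1%:R^-1, +oo[)).
  apply: (cbm_adapted bm) => //; rewrite -[X in measurable X]setTI.
  have mk : measurable_fun [set: R] (fun b => k (x + b)).
    apply: continuous_measurable_fun => b.
    apply: (@continuous_comp _ _ _ (fun b => x + b) k); last exact: ck.
    by apply: cvgD; [exact: cvg_cst|exact: cvg_id].
  by apply: mk => //; exact: measurable_itv.
by apply/seteqP; split => w /=; rewrite in_itv/= andbT.
Qed.

Definition first_zero (w : Omega) : \bar R :=
  ereal_inf [set s%:E | s in [set s | 0 <= s /\ Y s w <= 0]].

Let first_zero_le w t : 0 <= t -> (first_zero w <= t%:E)%E <-> ~ alive t w.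
Proof.
move=> t0; split.
  move=> le al.
  (* positivity on [0, t] persists slightly after t *)
  have : \forall s \near t, 0 < Y s w.
    have Yt : 0 < Y t w by apply: al; rewrite t0 lexx.
    exact: (cvgr_gt (Y t w) (@cY w t)).
  move=> /nbhs_ballP[e /= e0 eY].
  have : ((t + e)%:E <= first_zero w)%E.
    apply: le_ereal_inf_tmp => _ [s [s0 Ys] <-]; rewrite lee_fin leNgt; apply/negP => ste.
    suff : 0 < Y s w by rewrite ltNge Ys.
    have [st|ts] := leP s t; first by apply: al; rewrite s0.
    by apply: eY; rewrite /ball/= distrC ger0_norm ?subr_ge0 ?(ltW ts)// ltrBlDl.
  by move=> /le_trans/(_ le); rewrite lee_fin leNgt ltrDl e0.
move=> /existsNP[s /not_implyP[/andP[s0 st] Ys]].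
apply: (@le_trans _ _ s%:E); last by rewrite lee_fin.
by apply: ereal_inf_lbound; exists s => //; split => //; rewrite leNgt; exact/negP.
Qed.

Lemma stopping_time_first_zero : stopping_time F first_zero.
Proof.
split => [w|t t0].
  by apply: le_ereal_inf_tmp => _ [s [s0 _] <-]; rewrite lee_fin.
rewrite (_ : [set w | _] = ~` alive t).
  by apply: sigma_algebra_setC; [exact: (cbm_filtration bm)|exact: F_alive].
by apply/seteqP; split => w /=; [move/first_zero_le => /(_ t0)|move=> ?; exact/first_zero_le].
Qed.

Lemma before_first_zero s w : 0 <= s -> ~ (first_zero w <= s%:E)%E -> 0 < k (x + B s w).
Proof.
move=> s0 ns; have /contrapT : ~ ~ alive s w by move=> /(first_zero_le w s0).
by apply; rewrite s0 lexx.
Qed.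

(** [k] is positive before the first zero, hence nonnegative there by continuity
    from the left. *)
Lemma at_first_zero w : (first_zero w < +oo)%E -> k (x + B (fine (first_zero w)) w) = 0.
Proof.
have [tau0 _] := stopping_time_first_zero.
move=> fin; set T := fine _.
have TE : T%:E = first_zero w by rewrite /T fineK// ge0_fin_numE.
have T0 : 0 <= T by rewrite -lee_fin TE.
have before s : 0 <= s -> s < T -> 0 < Y s w.
  move=> s0 sT; apply: before_first_zero => //; apply/negP.
  by rewrite -ltNge -TE lte_fin.
have YT : Y T w <= 0.
  have /first_zero_le := T0 => /(_ w)[+ _]; rewrite TE => /(_ (lexx _)).
  move=> /existsNP[s /not_implyP[/andP[s0 sT] Ys]].
  move: sT; rewrite le_eqVlt => /predU1P[sT|/(before _ s0)//].
  by rewrite leNgt; apply/negP; rewrite -sT.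
apply/eqP; rewrite eq_le YT/=; have [T1|T1] := eqVneq T 0.
  by exfalso; move: YT; rewrite T1 /Y (cbm_nonpositive_time bm)// addr0 leNgt kx.
have {}T0 : 0 < T by rewrite lt_neqAle eq_sym T1.
have cv : Y s w @[s --> T^'-] --> Y T w by apply: cvg_at_left_filter; exact: cY.
rewrite -[leRHS]/(Y T w) -(cvg_lim _ cv)//; apply: limr_ge; first by apply/cvg_ex; eexists; exact: cv.
near=> s; apply/ltW/before; last by near: s; exact: nbhs_left_lt.
by near: s; exact: nbhs_left_ge.
Unshelve. all: by end_near. Qed.

End first_zero.

(** * From almost surely to everywhere continuous paths *)

Section continuous_version.
Context {R : realType} d (Omega : measurableType d) (P : probability Omega R).
Variables (F : R -> set (set Omega)) (W : R -> Omega -> R).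
Hypotheses (Fus : usual_filtration P F) (Wbm : brownian_motion P F W).

Definition regular_path (w : Omega) :=
  W 0 w = 0 /\ {within `[0, +oo[, continuous (fun t => W t w)}.

(** Paths that are not regular are replaced by [0]. They form a null set, which
    belongs to [F 0] by completeness, so that the new process is still adapted. *)
Definition continuous_version (t : R) (w : Omega) : R :=
  if `[< regular_path w >] then W (Num.max t 0) w else 0.

Let B := continuous_version.
Let N := ~` [set w | regular_path w].

Let N_negl : P.-negligible N.
Proof.
have := negligibleU (bm_start Wbm) (bm_continuous Wbm).
apply: negligibleS => w /=; rewrite /N /= /regular_path => /not_andP[h|h]; [by left|by right].
Qed.

Let FN t : 0 <= t -> F t N.
Proof. by move=> t0; apply: (usual_nondecreasing Fus (lexx 0) t0); exact: (usual_complete Fus). Qed.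

Let mN : measurable N. Proof. exact: (usual_measurable Fus (lexx 0) (FN (lexx 0))). Qed.

Let PN : P N = 0%E. Proof. by move: N_negl => /negligibleP; exact. Qed.

Let eq_off X Y : measurable X -> measurable Y -> X `\` N = Y `\` N -> P X = P Y.
Proof.
move=> mX mY XY; rewrite (measureDI P mX mN) (measureDI P mY mN) XY; congr (_ + _)%E.
rewrite (@subset_measure0 _ _ _ P (X `&` N) N); [|exact: measurableI|exact: mN|exact: subIsetr|exact: PN].
by rewrite (@subset_measure0 _ _ _ P (Y `&` N) N); [|exact: measurableI|exact: mN|exact: subIsetr|exact: PN].
Qed.

Let BE t w : 0 <= t -> ~ N w -> B t w = W t w.
Proof.
by move=> t0 /contrapT Nw; rewrite /B /continuous_version asboolT// max_l.
Qed.

Let mW t : 0 <= t -> measurable_fun setT (W t).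
Proof.
move=> t0 _ D mD; rewrite setTI; apply: (usual_measurable Fus t0); exact: (bm_adapted Wbm).
Qed.

Lemma continuous_version_bm : continuous_bm P F B.
Proof.
have adB t : 0 <= t -> forall D : set R, measurable D -> F t (B t @^-1` D).
  move=> t0 D mD; have sF := usual_sigma Fus t0.
  have -> : B t @^-1` D = (W t @^-1` D `\` N) `|` (N `&` [set w | D 0]).
    apply/seteqP; split => w /=.
      have [Nw|Nw] := pselect (N w); last by rewrite BE//; left.
      by rewrite /B /continuous_version asboolF//; right.
    move=> [[Dw Nw]|[Nw D0]]; first by rewrite BE.
    by rewrite /B /continuous_version asboolF.
  apply: sigma_algebra_setU => //.
    by apply: sigma_algebra_setD => //; [exact: (bm_adapted Wbm)|exact: FN].
  apply: sigma_algebra_setI => //; first exact: FN.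
  have [D0|D0] := pselect (D 0).
    rewrite (_ : [set _ | _] = ~` set0); last by rewrite setC0; apply/seteqP; split.
    by apply: sigma_algebra_setC => //; case: sF.
  by rewrite (_ : [set _ | _] = set0); [case: sF|apply/seteqP; split].
have mB t : 0 <= t -> measurable_fun setT (B t).
  by move=> t0 _ D mD; rewrite setTI; apply: (usual_measurable Fus t0); exact: adB.
split.
- exact: (usual_sigma Fus).
- exact: (usual_measurable Fus).
- exact: (usual_nondecreasing Fus).
- exact: adB.
- move=> t w t0; rewrite /B /continuous_version; case: asboolP => // -[W0 _].
  by rewrite max_r.
- move=> w; rewrite /B /continuous_version; case: asboolP => [[_ cW]|_]; last first.
    by move=> t; exact: cst_continuous.
  move=> t; have m0 : Num.max t 0 \in `[0, +oo[%classic.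
    by rewrite inE/= in_itv/= andbT le_max lexx orbT.
  have cm : continuous (fun s : R => Num.max s 0).
    by move=> s; apply: continuous_max; [exact: cvg_id|exact: cvg_cst].
  apply: (@cvg_comp _ _ _ (fun s => Num.max s 0) (W ^~ w) _ (within `[0, +oo[%classic (nbhs (Num.max t 0)))).
    move=> A wA.
    have wA' : nbhs t (fun s => `[0, +oo[%classic (Num.max s 0) -> A (Num.max s 0)) := cm t _ wA.
    change (nbhs t (fun s => A (Num.max s 0))); apply: filterS wA' => s; apply => /=.
    by rewrite in_itv/= andbT le_max lexx orbT.
  have := cW (Num.max t 0).
  rewrite /continuous_at nbhs_subspace_in//; last by rewrite -in_setE.
- move=> s t s0 st A D FA mD.
  have t0 := le_trans s0 (ltW st).
  rewrite -(bm_gaussian Wbm)// -(bm_independent Wbm)//.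
  have mA := usual_measurable Fus s0 FA.
  apply: eq_off.
  + apply: measurableI => //; rewrite -[_ @^-1` _]setTI; apply: measurable_funB => //; exact: mB.
  + apply: measurableI => //; rewrite -[_ @^-1` _]setTI; apply: measurable_funB => //; exact: mW.
  + by apply/seteqP; split => w /= [[Aw Dw] Nw]; move: Dw; rewrite !BE.
Qed.

End continuous_version.

(** * Verification: bounds on the value of a stopping problem *)

Section verification.
Local Open Scope ereal_scope.
Context {R : realType} d (Omega : measurableType d) (P : probability Omega R).
Variables (F : R -> set (set Omega)) (W : R -> Omega -> R).
Hypotheses (Fus : usual_filtration P F) (Wbm : brownian_motion P F W).
Variables (alpha lambda : R).
Hypotheses (al0 : (0 < alpha)%R) (la0 : (0 < lambda)%R).
Let B := continuous_version W.
Let bm : continuous_bm P F B := continuous_version_bm Fus Wbm.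
Let beta := Num.sqrt (2 * alpha).
Let p := perpetual_cost alpha lambda.

Let beta2 : (beta ^+ 2 / 2 = alpha)%R.
Proof. by rewrite sqr_sqrtr ?mulr_ge0 ?ltW// mulrAC divff ?mul1r. Qed.

Let beta0 : (0 < beta)%R. Proof. by rewrite sqrtr_gt0 mulr_gt0. Qed.

Section one_stopping_time.
Variables (tau : Omega -> \bar R) (x : R) (g : R -> \bar R).
Hypotheses (stau : stopping_time F tau) (mg : measurable_fun setT g)
  (g0 : forall z, 0 <= g z).
Local Notation finite := [set w | tau w < +oo].
Local Notation expM a := (fun t z : R => expR (a * z - a ^+ 2 / 2 * t)).

Let tau0 w : 0 <= tau w. Proof. by case: stau => + _; exact. Qed.

Definition stopped_gain w : \bar R :=
  (expR (- (alpha * fine (tau w))))%:E * g (x + B (fine (tau w)) w)%R.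

Let mfinite : measurable finite. Proof. exact: (measurable_finite bm stau). Qed.

Let gain_ge0 w : 0 <= stopped_gain w.
Proof. by rewrite mule_ge0// lee_fin expR_ge0. Qed.

Let mgain : measurable_fun setT stopped_gain.
Proof.
have mtau := stopping_time_measurable bm stau.
have mft : measurable_fun setT (fun w => fine (tau w)) by exact: measurableT_comp.
apply: emeasurable_funM.
  apply/measurable_EFinP; apply: measurableT_comp => //; apply: measurableT_comp => //.
  exact: measurable_funM.
apply: (measurableT_comp mg); apply: measurable_funD => //.
apply: (measurableT_comp (cbm_jointly_measurable bm) (g := fun w => (fine (tau w), w))).
exact: measurable_fun_pair.
Qed.

Let terminal_costE w : terminal_cost B alpha g x tau w = (stopped_gain \_ finite) w.
Proof.
rewrite /terminal_cost patchE (mem_set_bool (fun w => tau w < +oo)) /stopped_gain.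
by have := tau0 w; case: (tau w) => [r| |]//= _; rewrite ltry.
Qed.

(** [W] and its continuous version have the same costs off a null set. *)
Lemma expected_cost :
  \int[P]_w (running_cost W alpha lambda x tau w + terminal_cost W alpha g x tau w) =
  \int[P]_w running_cost B alpha lambda x tau w + \int[P]_(w in finite) stopped_gain w.
Proof.
have mr := measurable_running_cost bm x stau alpha la0.
have r0 := running_cost_ge0 B tau x alpha la0.
have mpatch : measurable_fun setT (stopped_gain \_ finite).
  by apply/(measurable_restrictT _ mfinite); exact: measurable_funTS.
rewrite [X in _ = _ + X]integral_mkcond -ge0_integralD; first last.
- exact: mpatch.
- by move=> w _; exact: erestrict_ge0.
- exact: mr.
- by move=> w _; exact: r0.
- exact: measurableT.
have := negligibleU (bm_start Wbm) (bm_continuous Wbm).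
set N := _ `|` _ => negN.
have ae : ae_eq P setT (fun w => running_cost B alpha lambda x tau w + (stopped_gain \_ finite) w)
   (fun w => running_cost W alpha lambda x tau w + terminal_cost W alpha g x tau w).
  apply: negligibleS negN => w /= /not_implyP[_ h].
  apply: contrapT => /not_orP[/contrapT W0 /contrapT cW]; apply: h.
  have BW t : (0 <= t)%R -> B t w = W t w.
    by move=> t0; rewrite /B /continuous_version asboolT// max_l.
  rewrite -terminal_costE /terminal_cost; congr (_ + _).
    by apply: eq_integral => t; rewrite inE/= => -[t0 _]; rewrite BW.
  by have := tau0 w; case: (tau w) => [r| |]//; rewrite lee_fin => r0'; rewrite BW.
have cP : measure_is_complete P.
  by move=> M /(usual_complete Fus); exact: (usual_measurable Fus (lexx 0%R)).
have m1 : measurable_fun setT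
   (fun w => running_cost B alpha lambda x tau w + (stopped_gain \_ finite) w).
  exact: emeasurable_funD.
apply: ae_eq_integral.
- exact: measurableT.
- exact: (ae_measurable_fun cP ae m1).
- exact: m1.
- exact: ae_eq_sym.
Qed.

Let mexp a : measurable_fun setT (fun w => (stopped B tau x (expM a) w)%:E).
Proof.
apply/measurable_EFinP; apply: (measurable_stopped bm x stau).
exact: (caloric_jointly_measurable (caloric_expR 0 a)).
Qed.

Let mcost : measurable_fun setT
  (fun w => (stopped B tau x (fun t z => expR (- (alpha * t)) * p z)%R w)%:E).
Proof.
apply/measurable_EFinP; apply: (measurable_stopped bm x stau).
apply: measurable_funM.
  apply: measurableT_comp => //; apply: measurableT_comp => //.
  by apply: measurable_funM => //; exact: measurable_fst.
apply: measurable_funD => //; apply: measurable_funM => //.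
by apply: measurable_funX; exact: measurable_snd.
Qed.

Let p0 z : (0 <= p z)%R.
Proof.
apply: addr_ge0; last by rewrite divr_ge0 ?sqr_ge0// ltW.
by rewrite mulr_ge0 ?sqr_ge0// divr_ge0// ltW.
Qed.

Let discount a z t : (a ^+ 2 / 2 = alpha)%R ->
  expM a t z = (expR (- (alpha * t)) * expR (a * z))%R.
Proof. by move=> aE; rewrite -expRD aE addrC. Qed.

Let betaN2 : ((- beta) ^+ 2 / 2 = alpha)%R. Proof. by rewrite sqrrN. Qed.

Let mcombination (a c : R) : measurable_fun finite (fun w => stopped_gain w +
  (expR (- (alpha * fine (tau w))) * (a * expR (beta * (x + B (fine (tau w)) w))
    + c * expR (- beta * (x + B (fine (tau w)) w))))%:E).
Proof.
apply: measurable_funTS; apply: emeasurable_funD; first exact: mgain.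
have := mexp beta; have := mexp (- beta) => m2 m1.
have : measurable_fun setT (fun w => a%:E * (stopped B tau x (expM beta) w)%:E +
    c%:E * (stopped B tau x (expM (- beta)) w)%:E).
  by apply: emeasurable_funD; exact: emeasurable_funM.
apply: eq_measurable_fun => w _.
rewrite /stopped (discount _ _ beta2) (discount _ _ betaN2) -!EFinM -EFinD; congr EFin; ring.
Qed.

Let finite_combination (a c : R) : (0 <= a)%R -> (0 <= c)%R ->
  \int[P]_(w in finite) stopped_gain w +
  (a%:E * \int[P]_(w in finite) (stopped B tau x (expM beta) w)%:E +
   c%:E * \int[P]_(w in finite) (stopped B tau x (expM (- beta)) w)%:E) =
  \int[P]_(w in finite) (stopped_gain w +
    (expR (- (alpha * fine (tau w))) * (a * expR (beta * (x + B (fine (tau w)) w))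
      + c * expR (- beta * (x + B (fine (tau w)) w))))%:E).
Proof.
move=> a0 c0.
have e0 b w : 0 <= (stopped B tau x (expM b) w)%:E by rewrite lee_fin expR_ge0.
have mD b : measurable_fun finite (fun w => (stopped B tau x (expM b) w)%:E).
  by apply: measurable_funTS; exact: mexp.
have ec0 b (r : R) w : (0 <= r)%R -> 0 <= r%:E * (stopped B tau x (expM b) w)%:E.
  by move=> r0; rewrite mule_ge0.
have mcD b (r : R) : measurable_fun finite (fun w => r%:E * (stopped B tau x (expM b) w)%:E).
  by apply: emeasurable_funM => //; exact: mD.
have Zl b (r : R) : (0 <= r)%R ->
    r%:E * \int[P]_(w in finite) (stopped B tau x (expM b) w)%:E =
    \int[P]_(w in finite) (r%:E * (stopped B tau x (expM b) w)%:E).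
  move=> r0; apply/esym/ge0_integralZl.
  - exact: mfinite.
  - exact: mD.
  - by move=> w _; exact: e0.
  - by rewrite lee_fin.
rewrite (Zl beta _ a0) (Zl (- beta)%R _ c0).
rewrite -ge0_integralD; first last.
- exact: mcD.
- by move=> w _; exact: ec0.
- exact: mcD.
- by move=> w _; exact: ec0.
- exact: mfinite.
rewrite -ge0_integralD; first last.
- by apply: emeasurable_funD; exact: mcD.
- by move=> w _; rewrite adde_ge0// ec0.
- exact: measurable_funTS.
- by move=> w _; exact: gain_ge0.
- exact: mfinite.
apply: eq_integral => w _; congr (_ + _).
rewrite /stopped (discount _ _ beta2) (discount _ _ betaN2) -!EFinM -EFinD; congr EFin; ring.
Qed.

(** The perpetual cost is a martingale together with the running cost, whereas the
    two discounted exponentials can only lose mass: their stopped means are at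
    most their initial values. *)
Lemma stopping_cost_ge (a c : R) : (0 <= a)%R -> (0 <= c)%R ->
  (forall z, (p z)%:E <= g z + (a * expR (beta * z) + c * expR (- beta * z))%:E) ->
  (p x - (a * expR (beta * x) + c * expR (- beta * x)))%:E <=
  \int[P]_w (running_cost W alpha lambda x tau w + terminal_cost W alpha g x tau w).
Proof.
move=> a0 c0 le; rewrite expected_cost.
have := expected_running_cost bm x stau al0 la0.
set I := \int[P]_w _; set J := \int[P]_(w in _) stopped_gain _ => IE.
have E1 := exponential_stopping_finite_le bm x stau beta.
have E2 := exponential_stopping_finite_le bm x stau (- beta).
have := finite_combination a0 c0; rewrite -/J.
move: E1 E2; set K1 := \int[P]_(w in _) _; set K2 := \int[P]_(w in _) _ => E1 E2 comb.
have : \int[P]_(w in finite) (stopped B tau x (fun t z => expR (- (alpha * t)) * p z)%R w)%:E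
    <= J + (a%:E * K1 + c%:E * K2).
  rewrite comb; apply: ge0_le_integral.
  - exact: mfinite.
  - by move=> w _; rewrite lee_fin mulr_ge0 ?expR_ge0 ?p0.
  - by apply: measurable_funTS; exact: mcost.
  - exact: mcombination.
  - move=> w _; rewrite /stopped /stopped_gain EFinM [in leRHS]EFinM -ge0_muleDr//.
    + by apply: lee_wpmul2l; [rewrite lee_fin expR_ge0|exact: le].
    + by rewrite lee_fin addr_ge0// mulr_ge0// expR_ge0.
move: IE; set Q := \int[P]_(w in _) _ => IE QJ.
clearbody I J Q K1 K2.
rewrite EFinB leeBlDr// -[(p x)%:E]IE -addeA; apply: leeD; first exact: lexx.
apply: le_trans QJ _; apply: leeD; first exact: lexx.
by rewrite EFinD !EFinM; apply: leeD; apply: lee_wpmul2l => //; rewrite lee_fin.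
Qed.

(** The converse inequality, for a stopping time at which an exponential that is
    actually used loses no mass. *)
Lemma stopping_cost_le (a c : R) : (0 <= a)%R -> (0 <= c)%R ->
  (forall w, tau w < +oo -> let z := (x + B (fine (tau w)) w)%R in
    g z + (a * expR (beta * z) + c * expR (- beta * z))%:E <= (p z)%:E) ->
  (a != 0%R -> (expR (beta * x))%:E <=
     \int[P]_(w in finite) (stopped B tau x (expM beta) w)%:E) ->
  (c != 0%R -> (expR (- beta * x))%:E <=
     \int[P]_(w in finite) (stopped B tau x (expM (- beta)) w)%:E) ->
  \int[P]_w (running_cost W alpha lambda x tau w + terminal_cost W alpha g x tau w) <=
  (p x - (a * expR (beta * x) + c * expR (- beta * x)))%:E.
Proof.
move=> a0 c0 le; rewrite expected_cost.
have := expected_running_cost bm x stau al0 la0.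
set I := \int[P]_w _; set J := \int[P]_(w in _) stopped_gain _ => IE.
have := finite_combination a0 c0; rewrite -/J.
set K1 := \int[P]_(w in _) _; set K2 := \int[P]_(w in _) _ => comb E1 E2.
have : J + (a%:E * K1 + c%:E * K2) <=
    \int[P]_(w in finite) (stopped B tau x (fun t z => expR (- (alpha * t)) * p z)%R w)%:E.
  rewrite comb; apply: ge0_le_integral.
  - exact: mfinite.
  - move=> w _; rewrite adde_ge0 ?gain_ge0// lee_fin mulr_ge0 ?expR_ge0//.
    by rewrite addr_ge0// mulr_ge0// expR_ge0.
  - exact: mcombination.
  - by apply: measurable_funTS; exact: mcost.
  - move=> w tw; rewrite /stopped /stopped_gain EFinM [in leRHS]EFinM -ge0_muleDr//.
    + by apply: lee_wpmul2l; [rewrite lee_fin expR_ge0|exact: le].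
    + by rewrite lee_fin addr_ge0// mulr_ge0// expR_ge0.
move: IE; set Q := \int[P]_(w in _) _ => IE QJ.
clearbody I J Q K1 K2.
rewrite EFinB leeBrDr// -[(p x)%:E]IE -addeA; apply: leeD; first exact: lexx.
apply: le_trans _ QJ; apply: leeD; first exact: lexx.
rewrite EFinD !EFinM; apply: leeD.
- have [->|an0] := eqVneq a 0%R; first by rewrite !mul0e.
  by apply: lee_wpmul2l; [rewrite lee_fin|exact: E1].
- have [->|cn0] := eqVneq c 0%R; first by rewrite !mul0e.
  by apply: lee_wpmul2l; [rewrite lee_fin|exact: E2].
Qed.

End one_stopping_time.

End verification.

Section stopping_value_bounds.
Local Open Scope ereal_scope.
Context {R : realType} d (Omega : measurableType d) (P : probability Omega R).
Variables (F : R -> set (set Omega)) (W : R -> Omega -> R).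
Hypotheses (Fus : usual_filtration P F) (Wbm : brownian_motion P F W).
Variables (alpha lambda : R).
Hypotheses (al0 : (0 < alpha)%R) (la0 : (0 < lambda)%R).
Let B := continuous_version W.
Let bm : continuous_bm P F B := continuous_version_bm Fus Wbm.
Let beta := Num.sqrt (2 * alpha).
Let p := perpetual_cost alpha lambda.
Variable g : R -> \bar R.
Hypotheses (mg : measurable_fun setT g) (g0 : forall z, 0 <= g z).
Let value := stopping_value P F W alpha lambda g.

Lemma stopping_value_ge (x a c : R) : (0 <= a)%R -> (0 <= c)%R ->
  (forall z, (p z)%:E <= g z + (a * expR (beta * z) + c * expR (- beta * z))%:E) ->
  (p x - (a * expR (beta * x) + c * expR (- beta * x)))%:E <= value x.
Proof.
move=> a0 c0 le; apply: le_ereal_inf_tmp => _ [tau stau <-].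
exact: (stopping_cost_ge Fus Wbm).
Qed.

(** Up to the first zero of [k] the state stays in the region [0 < k], where the
    exponentials in use are bounded and so lose no mass. *)
Lemma stopping_value_le_first_zero (k : R -> R) (x a c : R) :
  continuous k -> (0 < k x)%R -> (0 <= a)%R -> (0 <= c)%R ->
  (forall z, k z = 0%R ->
    g z + (a * expR (beta * z) + c * expR (- beta * z))%:E <= (p z)%:E) ->
  (a != 0%R -> exists M, forall z, (0 < k z)%R -> (expR (beta * z) <= M)%R) ->
  (c != 0%R -> exists M, forall z, (0 < k z)%R -> (expR (- beta * z) <= M)%R) ->
  value x <= (p x - (a * expR (beta * x) + c * expR (- beta * x)))%:E.
Proof.
move=> ck kx a0 c0 le bnda bndc.
have stau := stopping_time_first_zero bm x ck.
have beta0 : (beta != 0)%R by rewrite gt_eqF// sqrtr_gt0 mulr_gt0.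
have ge b : (b != 0)%R -> (exists M, forall z, (0 < k z)%R -> (expR (b * z) <= M)%R) ->
    (expR (b * x))%:E <= \int[P]_(w in [set w | first_zero B k x w < +oo])
      (stopped B (first_zero B k x) x (fun t z => expR (b * z - b ^+ 2 / 2 * t))%R w)%:E.
  move=> b0 [M bM].
  have M0 : (0 <= M)%R by apply: le_trans (bM _ kx); exact: expR_ge0.
  apply: (@exponential_stopping_finite_ge _ _ _ _ _ _ bm _ x stau b M b0 M0).
  by move=> s w s0 ns; apply: bM; exact: (before_first_zero bm ck s0 ns).
apply: (@le_trans _ _ (\int[P]_w (running_cost W alpha lambda x (first_zero B k x) w +
  terminal_cost W alpha g x (first_zero B k x) w))).
  by apply: ereal_inf_lbound; exists (first_zero B k x).
apply: (stopping_cost_le Fus Wbm) => //.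
- by move=> w fin /=; apply: le; exact: (at_first_zero bm ck kx).
- by move=> an0; apply: ge => //; exact: bnda.
- by move=> cn0; apply: ge; [rewrite oppr_eq0|exact: bndc].
Qed.

Lemma stopping_value_le_now x : value x <= g x.
Proof.
pose tau (w : Omega) : \bar R := 0.
have stau : stopping_time F tau.
  split => // t t0; rewrite (_ : [set w | _] = ~` set0).
    by apply: sigma_algebra_setC; have := cbm_filtration bm t0 => // -[].
  by rewrite setC0; apply/seteqP; split => w //= _; rewrite /tau lee_fin.
apply: (@le_trans _ _ (\int[P]_w (running_cost W alpha lambda x tau w +
  terminal_cost W alpha g x tau w))).
  by apply: ereal_inf_lbound; exists tau.
rewrite (expected_cost Fus Wbm)//.
rewrite (_ : \int[P]_w running_cost _ _ _ _ _ w = 0); last first.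
  apply: integral0_eq => w _; rewrite /running_cost.
  rewrite (_ : [set t : R | _] = [set 0%R]); first by rewrite integral_set1.
  apply/seteqP; split => t /=; rewrite /tau lee_fin; last by move=> ->.
  by move=> [t0 t0']; apply/eqP; rewrite eq_le t0 t0'.
rewrite add0e (_ : [set w | tau w < +oo] = setT); last first.
  by apply/seteqP; split => w //= _; rewrite /tau ltry.
rewrite (eq_integral (cst (g x))); last first.
  move=> w _; rewrite /stopped_gain /tau /= mulr0 oppr0 expR0 mul1e.
  by rewrite -/B (cbm_nonpositive_time bm)// addr0.
by rewrite integral_cst//= probability_setT mule1.
Qed.

End stopping_value_bounds.

(** * Functions glued at a point *)

Section glue.
Context {R : realType}.
Implicit Types (f g : R -> R) (a t d : R).

Definition glue a f1 f2 (t : R) : R := if t <= a then f1 t else f2 t.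

Lemma glue_le a f1 f2 t : t <= a -> glue a f1 f2 t = f1 t.
Proof. by rewrite /glue => ->. Qed.

Lemma glue_ge a f1 f2 t : f1 a = f2 a -> a <= t -> glue a f1 f2 t = f2 t.
Proof.
move=> e; rewrite /glue le_eqVlt => /predU1P[<-|at_]; first by rewrite lexx.
by rewrite leNgt at_.
Qed.

Lemma glue_continuous a f1 f2 t : f1 a = f2 a ->
  (t <= a -> {for t, continuous f1}) -> (a <= t -> {for t, continuous f2}) ->
  {for t, continuous (glue a f1 f2)}.
Proof.
move=> e c1 c2; apply/cvgrPdist_lt => eps eps0.
have [ta|at_|ta] := ltgtP t a.
- have /cvgrPdist_lt/(_ _ eps0) := c1 (ltW ta); apply: filterS2 (lt_nbhsl ta) => s sa.
  by rewrite /glue (ltW sa) (ltW ta).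
- have /cvgrPdist_lt/(_ _ eps0) := c2 (ltW at_); apply: filterS2 (lt_nbhsr at_) => s sa.
  by rewrite /glue !leNgt sa at_.
- subst t; have /cvgrPdist_lt/(_ _ eps0) := c1 (lexx a).
  have /cvgrPdist_lt/(_ _ eps0) := c2 (lexx a).
  by apply: filterS2 => s; rewrite glue_le// /glue -e; case: ifP.
Qed.

(** With the difference quotient expressed through the end point [z], a glued
    function is locally one of its pieces on each side of the junction. *)
Lemma is_derive_quotient f t d : is_derive t 1 f d <->
  (f z - f t) / (z - t) @[z --> t^'] --> d.
Proof.
have shift_eq : (f z - f t) / (z - t) @[z --> t^'] =
    h^-1 *: ((f \o shift t) (h *: 1) - f t) @[h --> 0^'].
  rewrite funeqE => A; rewrite propeqE.
  have near_t (Q : set R) : (\forall z \near t^', Q z) <-> (\forall h \near 0^', Q (h + t)).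
    have := @near_shift _ R 0 t (fun z : R => z != t -> Q z).
    rewrite subr0; have -> : ((fun z : R => z != t -> Q z) \o shift t) =
      (fun h => h != 0 -> Q (h + t)).
      by apply/funext => h /=; rewrite -{2}[t]add0r (inj_eq (addIr t)).
    move=> e; split => [h|h].
      have h' : \forall x \near t, x != t -> Q x by exact: h.
      by rewrite e in h'.
    suff h' : \forall x \near t, x != t -> Q x by exact: h'.
    by rewrite e.
  rewrite /= !near_simpl near_t.
  by split; apply: filterS => h /=; rewrite addrK mulrC /GRing.scale /= mulr1.
rewrite shift_eq; split => [df|qd]; last first.
  by apply: DeriveDef; [apply/cvg_ex; exists d|exact: cvg_lim qd].
by have [+ <-] := df; exact.
Qed.

Lemma glue_is_derive a f1 f2 g1 g2 t : f1 a = f2 a -> g1 a = g2 a ->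
  (t <= a -> is_derive t 1 f1 (g1 t)) -> (a <= t -> is_derive t 1 f2 (g2 t)) ->
  is_derive t 1 (glue a f1 f2) (glue a g1 g2 t).
Proof.
move=> e eg d1 d2; apply/is_derive_quotient/cvgrPdist_lt => eps eps0.
have [ta|at_|ta] := ltgtP t a.
- have /is_derive_quotient/cvgrPdist_lt/(_ _ eps0) := d1 (ltW ta).
  apply: filterS2 (nbhs_dnbhs (lt_nbhsl ta)) => s sa.
  by rewrite /glue (ltW sa) (ltW ta).
- have /is_derive_quotient/cvgrPdist_lt/(_ _ eps0) := d2 (ltW at_).
  apply: filterS2 (nbhs_dnbhs (lt_nbhsr at_)) => s sa.
  by rewrite /glue !leNgt sa at_.
- subst t; have /is_derive_quotient/cvgrPdist_lt/(_ _ eps0) := d1 (lexx a).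
  have /is_derive_quotient/cvgrPdist_lt/(_ _ eps0) := d2 (lexx a).
  apply: filterS2 => s; rewrite !(glue_le _ _ (lexx a)) /glue -e -eg.
  by case: ifP.
Qed.

End glue.

(** * Convex functions through a monotone derivative *)

Section convex_calculus.
Context {R : realType}.
Implicit Types (f g : R -> R) (a b d x y z : R).

(** Together with [derive_le_left] this replaces Fermat's rule at minimisers that
    may be end points. *)
Lemma derive_ge_right f x b d a : x < b -> is_derive x 1 f d ->
  (forall z, x < z -> z < b -> f x + a * (z - x) <= f z) -> a <= d.
Proof.
move=> xb /is_derive_quotient/cvg_dnbhs_at_right dq le_f.
apply: (cvgr_to_ge dq); near=> z.
have xz : x < z by near: z; exact: nbhs_right_gt.
have zb : z < b by near: z; exact: nbhs_right_lt.
by rewrite ler_pdivlMr ?subr_gt0// lerBrDl le_f.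
Unshelve. all: by end_near. Qed.

Lemma derive_le_left f x b d a : b < x -> is_derive x 1 f d ->
  (forall z, b < z -> z < x -> f x + a * (z - x) <= f z) -> d <= a.
Proof.
move=> bx /is_derive_quotient/cvg_dnbhs_at_left dq le_f.
apply: (cvgr_to_le dq); near=> z.
have zx : z < x by near: z; exact: nbhs_left_lt.
have bz : b < z by near: z; exact: nbhs_left_gt.
by rewrite ler_ndivrMr ?subr_lt0// lerBrDl le_f.
Unshelve. all: by end_near. Qed.

Lemma mean_value f g (i : interval R) y z :
  (forall t, t \in i -> is_derive t 1 f (g t)) ->
  y \in i -> z \in i -> y != z ->
  exists2 t, t \in i & f z = f y + g t * (z - y) /\
    (y < t /\ y < z \/ t < y /\ z < y).
Proof.
move=> df yi zi.
have sub_i u v t : u \in i -> v \in i -> u <= t -> t <= v -> t \in i.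
  by move=> ui vi ut tv; apply: (interval_is_interval ui vi); rewrite ut tv.
have cf u v : u \in i -> v \in i -> {within `[u, v], continuous f}.
  move=> ui vi; apply: derivable_within_continuous => t; rewrite in_itv/= => /andP[ut tv].
  exact: is_derive_derivable (df t (sub_i _ _ _ ui vi ut tv)).
case: ltgtP => // [yz|zy] _.
- have [||t] := @MVT R f g y z yz.
  + move=> t; rewrite in_itv/= => /andP[yt tz]; apply: df.
    exact: sub_i yi zi (ltW yt) (ltW tz).
  + exact: cf.
  + rewrite in_itv/= => /andP[yt tz] e; exists t; first exact: sub_i yi zi (ltW yt) (ltW tz).
    by split; [rewrite -e addrC subrK|left].
- have [||t] := @MVT R f g z y zy.
  + move=> t; rewrite in_itv/= => /andP[zt ty]; apply: df.
    exact: sub_i zi yi (ltW zt) (ltW ty).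
  + exact: cf.
  + rewrite in_itv/= => /andP[zt ty] e; exists t; first exact: sub_i zi yi (ltW zt) (ltW ty).
    by split; [rewrite -(opprB y) mulrN -e opprB addrC subrK|right].
Qed.

Lemma tangent_le f g (i : interval R) y z :
  (forall t, t \in i -> is_derive t 1 f (g t)) ->
  {in i &, {homo g : s t / s <= t}} ->
  y \in i -> z \in i -> f y + g y * (z - y) <= f z.
Proof.
move=> df mono_g yi zi; have [->|yz] := eqVneq y z; first by rewrite subrr mulr0 addr0.
have [t ti [-> [[yt lt_yz]|[ty lt_zy]]]] := mean_value df yi zi yz; rewrite lerD2l.
  by rewrite ler_pM2r ?subr_gt0// mono_g// ltW.
by rewrite ler_nM2r ?subr_lt0// mono_g// ltW.
Qed.

Lemma tangent_lt f g (i : interval R) y z :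
  (forall t, t \in i -> is_derive t 1 f (g t)) ->
  {in i &, {homo g : s t / s < t}} ->
  y \in i -> z \in i -> y != z -> f y + g y * (z - y) < f z.
Proof.
move=> df mono_g yi zi yz.
have [t ti [-> [[yt lt_yz]|[ty lt_zy]]]] := mean_value df yi zi yz; rewrite ltrD2l.
  by rewrite ltr_pM2r ?subr_gt0// mono_g.
by rewrite ltr_nM2r ?subr_lt0// mono_g.
Qed.

(** The tangent inequalities at the intermediate point, averaged. *)
Lemma chord_le f g (i : interval R) y z t :
  (forall t, t \in i -> is_derive t 1 f (g t)) ->
  {in i &, {homo g : s t / s <= t}} ->
  y \in i -> z \in i -> 0 <= t -> t <= 1 ->
  f (t * y + (1 - t) * z) <= t * f y + (1 - t) * f z.
Proof.
move=> df mono_g yi zi t0 t1; set m := t * y + (1 - t) * z.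
have mi : m \in i.
  by have [yz|/ltW zy] := leP y z; [apply: (interval_is_interval yi zi)|
    apply: (interval_is_interval zi yi)]; rewrite /m; apply/andP; split; nra.
have := tangent_le df mono_g mi yi; have := tangent_le df mono_g mi zi.
rewrite /m; nra.
Qed.

Lemma strict_chord f g (i : interval R) :
  (forall t, t \in i -> is_derive t 1 f (g t)) ->
  {in i &, {homo g : s t / s < t}} -> strictly_convex_on [set` i] f.
Proof.
move=> df mono_g y z t yi zi yz t0 t1; set m := t * y + (1 - t) * z.
have mi : m \in i.
  by have [le_yz|/ltW zy] := leP y z; [apply: (interval_is_interval yi zi)|
    apply: (interval_is_interval zi yi)]; rewrite /m; apply/andP; split; nra.
have my : m != y.
  rewrite -subr_eq0 (_ : m - y = (1 - t) * (z - y)) ?mulf_neq0 ?subr_eq0//; last by rewrite /m; ring.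
    by rewrite gt_eqF.
  by rewrite eq_sym.
have mz : m != z.
  rewrite -subr_eq0 (_ : m - z = t * (y - z)) ?mulf_neq0 ?subr_eq0//; last by rewrite /m; ring.
  by rewrite gt_eqF.
have := tangent_lt df mono_g mi yi my; have := tangent_lt df mono_g mi zi mz.
rewrite /m; nra.
Qed.

End convex_calculus.

Section bitangent.
Context {R : realType}.
Implicit Types (f g : R -> R) (a p q r u v : R).

(** The concave conjugate of [f] on a segment: Lipschitz in the slope because
    the minimised functions [f u - a * u] are, uniformly in [u]. *)
Lemma conjugate_segment f p q : p <= q -> (forall t, p <= t <= q -> {for t, continuous f}) ->
  exists2 m : R -> R, continuous m & forall a,
    (forall u, p <= u <= q -> m a <= f u - a * u) /\
    exists2 u, p <= u <= q & m a = f u - a * u.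
Proof.
move=> pq cf.
have min_ex a : exists u, p <= u <= q /\ forall v, p <= v <= q -> f u - a * u <= f v - a * v.
  have [|u] := @EVT_min R (fun u => f u - a * u) p q pq.
    apply: continuous_in_subspaceT => t; rewrite inE/= in_itv/= => tpq.
    apply: continuousB; first exact: cf.
    by apply: continuousM; [exact: cvg_cst|exact: cvg_id].
  rewrite in_itv/= => upq le_u; exists u; split=> // v vpq; exact: le_u.
pose s a := projT1 (cid (min_ex a)).
have sP a : p <= s a <= q /\ forall v, p <= v <= q -> f (s a) - a * s a <= f v - a * v.
  exact: (projT2 (cid (min_ex a))).
exists (fun a => f (s a) - a * s a); last first.
  by move=> a; have [? ?] := sP a; split=> //; exists (s a).
pose K := `|p| + `|q| + 1.
have K0 : 0 < K by rewrite /K; have := normr_ge0 p; have := normr_ge0 q; lra.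
have sK a : `|s a| <= K.
  have [/andP[ps sq] _] := sP a; rewrite ler_norml /K.
  have := ler_norm q; have := ler_norm (- p); rewrite normrN => hp hq.
  have := normr_ge0 p; have := normr_ge0 q => q0 p0.
  by apply/andP; split; lra.
have lip a b : (f (s a) - a * s a) - (f (s b) - b * s b) <= K * `|a - b|.
  have [_ /(_ (s b) (sP b).1) le_a] := sP a.
  have : (b - a) * s b <= K * `|a - b|.
    by rewrite (le_trans (ler_norm _))// normrM distrC mulrC ler_wpM2r.
  lra.
move=> a; apply/cvgrPdist_le => e e0; near=> b.
have ab : `|a - b| <= e / K.
  near: b; apply: cvgr_dist_le; [exact: cvg_id|exact: divr_gt0].
have Kab : K * `|a - b| <= e by rewrite mulrC -ler_pdivlMr.
have := lip a b; have := lip b a; rewrite [in `|b - a|]distrC => h1 h2.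
rewrite ler_norml; apply/andP; split; lra.
Unshelve. all: by end_near. Qed.

(** Two functions that agree at [q], where the slope drops, have a common tangent
    touching the first before [q] and the second after: the conjugates
    [m1], [m2] of the two pieces cross at some slope between the two slopes at
    [q], and there the minimisers cannot be end points. *)
Lemma bitangent_exists f1 g1 f2 g2 p q r : p < q -> q < r ->
  (forall t, p <= t <= q -> is_derive t 1 f1 (g1 t)) ->
  (forall t, q <= t <= r -> is_derive t 1 f2 (g2 t)) ->
  (forall s t, p <= s -> s <= t -> t <= q -> g1 s <= g1 t) ->
  (forall s t, q <= s -> s <= t -> t <= r -> g2 s <= g2 t) ->
  f1 q = f2 q -> g2 q < g1 q -> g1 p < g2 q -> g1 q < g2 r ->
  exists u v, [/\ p < u < q, q < v < r, g1 u = g2 v &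
    f1 u - g1 u * u = f2 v - g2 v * v].
Proof.
move=> lt_pq lt_qr df1 df2 mg1 mg2 fq g21 g1p g2r.
have [pq qr] := (ltW lt_pq, ltW lt_qr).
have [m1 cm1 m1P] := conjugate_segment pq (fun t tpq => is_derive_continuous (df1 t tpq)).
have [m2 cm2 m2P] := conjugate_segment qr (fun t tqr => is_derive_continuous (df2 t tqr)).
have tangent1 u : p <= u <= q -> f1 q + g1 q * (u - q) <= f1 u.
  move=> upq; apply: (@tangent_le _ _ g1 `[p, q]); rewrite ?in_itv/= ?lexx ?pq//.
  by move=> s t; rewrite !in_itv/= => /andP[ps _] /andP[_ tq] st; exact: mg1.
have tangent2 v : q <= v <= r -> f2 q + g2 q * (v - q) <= f2 v.
  move=> vqr; apply: (@tangent_le _ _ g2 `[q, r]); rewrite ?in_itv/= ?lexx ?qr//.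
  by move=> s t; rewrite !in_itv/= => /andP[ps _] /andP[_ tq] st; exact: mg2.
have q1 : p <= q <= q by rewrite pq lexx.
have q2 : q <= q <= r by rewrite qr lexx.
have le_m12 : m1 (g2 q) - m2 (g2 q) <= 0.
  have [/(_ q q1) le1 _] := m1P (g2 q); have [_ [v vqr ->]] := m2P (g2 q).
  have := tangent2 v vqr; rewrite mulrBr; lra.
have ge_m12 : 0 <= m1 (g1 q) - m2 (g1 q).
  have [/(_ q q2) le2 _] := m2P (g1 q); have [_ [u upq ->]] := m1P (g1 q).
  have := tangent1 u upq; rewrite mulrBr; lra.
have [||a /[!in_itv]/= /andP[a1 a2] ea] :=
    @IVT R (fun a => m1 a - m2 a) (g2 q) (g1 q) 0 (ltW g21).
- by apply: continuous_subspaceT => t; apply: continuousB; [exact: cm1|exact: cm2].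
- by rewrite ge_min le_max le_m12 ge_m12 orbT.
have [le1 [u /andP[pu uq] eu]] := m1P a; have [le2 [v /andP[qv vr] ev]] := m2P a.
have e12 : m1 a = m2 a by apply/eqP; rewrite -subr_eq0 ea.
have right1 : u < q -> a <= g1 u.
  move=> lt_uq; apply: (derive_ge_right lt_uq (df1 u _)) => [|z uz zq]; first by rewrite pu.
  have := le1 z; rewrite (le_trans pu (ltW uz)) (ltW zq) eu mulrBr => /(_ isT); lra.
have left1 : p < u -> g1 u <= a.
  move=> lt_pu; apply: (derive_le_left lt_pu (df1 u _)) => [|z pz zu]; first by rewrite pu.
  have := le1 z; rewrite (ltW pz) (le_trans (ltW zu) uq) eu mulrBr => /(_ isT); lra.
have right2 : v < r -> a <= g2 v.
  move=> lt_vr; apply: (derive_ge_right lt_vr (df2 v _)) => [|z vz zr]; first by rewrite qv.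
  have := le2 z; rewrite (le_trans qv (ltW vz)) (ltW zr) ev mulrBr => /(_ isT); lra.
have left2 : q < v -> g2 v <= a.
  move=> lt_qv; apply: (derive_le_left lt_qv (df2 v _)) => [|z qz zv]; first by rewrite qv.
  have := le2 z; rewrite (ltW qz) (le_trans (ltW zv) vr) ev mulrBr => /(_ isT); lra.
(* a common minimum at [q] would give [g1 q <= a <= g2 q] *)
have not_q : m1 a <> f1 q - a * q.
  move=> eq; suff : g1 q <= g2 q by rewrite leNgt g21.
  apply: (@le_trans _ _ a).
    apply: (derive_le_left lt_pq (df1 q q1)) => z pz zq.
    by have := le1 z; rewrite (ltW pz) (ltW zq) eq mulrBr => /(_ isT); lra.
  apply: (derive_ge_right lt_qr (df2 q q2)) => z qz zr.
  by have := le2 z; rewrite (ltW qz) (ltW zr) -e12 eq fq mulrBr => /(_ isT); lra.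
have lt_uq : u < q.
  by rewrite lt_neqAle uq andbT; apply/eqP => e; apply: not_q; rewrite eu e.
have lt_qv : q < v.
  rewrite lt_neqAle qv andbT; apply/eqP => e; apply: not_q.
  by rewrite e12 ev -e fq.
have lt_pu : p < u.
  rewrite lt_neqAle pu andbT; apply/eqP => e; move: (right1 lt_uq).
  by rewrite -e leNgt (lt_le_trans g1p a1).
have lt_vr : v < r.
  rewrite lt_neqAle vr andbT; apply/eqP => e; move: (left2 lt_qv).
  by rewrite e leNgt (le_lt_trans a2 g2r).
have e1 : g1 u = a by apply/eqP; rewrite eq_le left1// right1.
have e2 : g2 v = a by apply/eqP; rewrite eq_le left2// right2.
exists u, v; rewrite lt_pu lt_uq lt_qv lt_vr e1 e2; split=> //.
by rewrite -eu e12.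
Qed.

(** If the slope at [u'] were larger than that at [u], the difference of the two
    tangents would be nonnegative at [u'], where the steeper one touches [f1], and
    nonpositive at [v], where the other one touches [f2]; but this difference
    increases and [u' < v]. *)
Lemma bitangent_unique f1 g1 f2 g2 (i j : interval R) u v u' v' :
  (forall t, t \in i -> is_derive t 1 f1 (g1 t)) ->
  (forall t, t \in j -> is_derive t 1 f2 (g2 t)) ->
  {in i &, {homo g1 : s t / s < t}} -> {in j &, {homo g2 : s t / s < t}} ->
  {in i & j, forall s t, s < t} ->
  u \in i -> v \in j -> g1 u = g2 v -> f1 u - g1 u * u = f2 v - g2 v * v ->
  u' \in i -> v' \in j -> g1 u' = g2 v' -> f1 u' - g1 u' * u' = f2 v' - g2 v' * v' ->
  u = u' /\ v = v'.
Proof.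
move=> df1 df2 mg1 mg2 ij ui vj e1 e2 ui' vj' e1' e2'.
have mono1 := ltW_homo_in mg1; have mono2 := ltW_homo_in mg2.
have no_lt x y x' y' : x \in i -> y \in j -> g1 x = g2 y ->
    f1 x - g1 x * x = f2 y - g2 y * y -> x' \in i -> y' \in j -> g1 x' = g2 y' ->
    f1 x' - g1 x' * x' = f2 y' - g2 y' * y' -> g1 x' <= g1 x.
  move=> xi yj h1 h2 xi' yj' h1' h2'; rewrite leNgt; apply/negP => lt_g.
  have t1 := tangent_le df1 mono1 xi xi'; have t2 := tangent_le df2 mono2 yj' yj.
  have xy := ij _ _ xi' yj; rewrite -h1' in t2 h2'; rewrite -h1 in h2.
  have : 0 < (g1 x' - g1 x) * (y - x') by rewrite mulr_gt0 ?subr_gt0.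
  nra.
have eg : g1 u = g1 u'.
  by apply/eqP; rewrite eq_le (no_lt u' v' u v) ?(no_lt u v u' v').
have inj (g : R -> R) (k : interval R) : {in k &, {homo g : s t / s < t}} ->
    {in k &, injective g}.
  move=> mg s t sk tk es; case: (ltgtP s t) => // st.
    by have := mg s t sk tk st; rewrite es ltxx.
  by have := mg t s tk sk st; rewrite es ltxx.
have inj1 := inj _ _ mg1; have inj2 := inj _ _ mg2.
by split; [exact: inj1|apply: inj2 => //; rewrite -e1 -e1'].
Qed.

(** Replacing the graphs between the contact points by the common tangent
    keeps the derivative monotone. *)
Lemma bitangent_glue f1 g1 f2 g2 p q u v : p <= u -> u < q -> q < v ->
  (forall t, p <= t <= q -> is_derive t 1 f1 (g1 t)) ->
  (forall t, q <= t -> is_derive t 1 f2 (g2 t)) ->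
  (forall s t, p <= s -> s <= t -> t <= q -> g1 s <= g1 t) ->
  (forall s t, q <= s -> s <= t -> g2 s <= g2 t) ->
  g1 u = g2 v -> f1 u - g1 u * u = f2 v - g2 v * v ->
  let W := glue u f1 (glue v (fun t => g1 u * t + (f1 u - g1 u * u)) f2) in
  let gW := glue u g1 (glue v (cst (g1 u)) g2) in
  (forall t, p <= t -> is_derive t 1 W (gW t)) /\
  {in `[p, +oo[ &, {homo gW : s t / s <= t}}.
Proof.
move=> pu uq qv df1 df2 mg1 mg2 eg eb W gW; have uv := ltW (lt_trans uq qv).
split => [t pt|s t].
  apply: glue_is_derive => [||tu|ut].
  - by rewrite glue_le// addrC subrK.
  - by rewrite glue_le.
  - by apply: df1; rewrite pt (le_trans tu (ltW uq)).
  - apply: glue_is_derive => [||_|vt].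
    + by rewrite eb eg addrC subrK.
    + exact: eg.
    + by apply: is_derive_eq; rewrite /GRing.scale /=; ring.
    + by apply: df2; exact: le_trans (ltW qv) vt.
rewrite !in_itv/= !andbT => ps pt st; rewrite /gW /glue /=.
have [su|us] := leP s u; have [tu|ut] := leP t u.
- by apply: mg1 => //; exact: le_trans tu (ltW uq).
- have le_su : g1 s <= g1 u by apply: mg1 => //; exact: ltW.
  by case: ifP => // /negbT; rewrite -ltNge => vt; rewrite (le_trans le_su)// eg mg2 ?ltW.
- by have := lt_le_trans us (le_trans st tu); rewrite ltxx.
- case: ifP => sv; case: ifP => tv //.
  + by rewrite eg mg2 ?ltW// ltNge tv.
  + by have := le_trans st tv; rewrite sv.
  + by rewrite mg2// (le_trans (ltW qv))// ltW// ltNge sv.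
Qed.

End bitangent.

Section minorant.
Context {R : realType}.
Implicit Types (f g K W : R -> R) (a b p u v : R).

Lemma convex_functionE (D : set R) f : @convex_function R R^o D f <->
  (forall y z t, D y -> D z -> 0 <= t -> t <= 1 ->
     f (t * y + (1 - t) * z) <= t * f y + (1 - t) * f z).
Proof.
split => [cf y z t Dy Dz t0 t1|cf t y z].
  by have := cf (Itv01 t0 t1) y z (mem_set Dy) (mem_set Dz); rewrite !convRE.
rewrite !inE => Dy Dz; have := cf y z t%:num Dy Dz.
by rewrite !convRE; apply; rewrite ?ge0// le1.
Qed.

Lemma C1_from_derive W g a : (forall t, a <= t -> is_derive t 1 W (g t)) ->
  (forall t, a <= t -> {for t, continuous g}) -> C1_from a W.
Proof.
move=> dW cg; exists g => [|y ay].
  by apply: continuous_in_subspaceT => t; rewrite inE/= in_itv/= andbT; exact: cg.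
have /is_derive_quotient := dW y ay; apply: cvg_trans.
by apply: cvg_app; exact: cvg_within.
Qed.

(** Above the chord from [u] to [v] no convex minorant of [K] fits, so a convex
    [W] that equals [K] outside the gap and is affine inside is the greatest. *)
Lemma greatest_minorant_gap K W p u v a b : p <= u -> u < v ->
  @convex_function R R^o `[p, +oo[ W ->
  (forall y, p <= y -> W y <= 0 /\ W y <= K y) ->
  (forall y, p <= y -> y <= u -> W y = K y) -> (forall y, v <= y -> W y = K y) ->
  (forall y, u <= y -> y <= v -> W y = a * y + b) ->
  greatest_nonpositive_convex_minorant `[p, +oo[ K W.
Proof.
move=> pu uv cW W_le Wu Wv Wuv; split.
  by split=> // y; rewrite /= in_itv/= andbT; exact: W_le.
move=> U [/convex_functionE cU U_le] y; rewrite /= in_itv/= andbT => py.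
have UK z : p <= z -> U z <= K z by move=> pz; apply: (U_le z _).2; rewrite /= in_itv/= pz.
have [yu|uy] := leP y u; first by rewrite Wu// UK.
have [vy|yv] := leP v y; first by rewrite Wv// UK.
pose t := (v - y) / (v - u).
have vu0 : 0 < v - u by rewrite subr_gt0.
have t0 : 0 <= t by rewrite divr_ge0 ?subr_ge0 ?ltW.
have t1 : t <= 1 by rewrite ler_pdivrMr// mul1r lerB// ltW.
have ey : t * u + (1 - t) * v = y by rewrite /t; field; rewrite gt_eqF.
have := cU u v t; rewrite /= !in_itv/= !andbT ey => /(_ pu (le_trans pu (ltW uv)) t0 t1) cUy.
apply: (le_trans cUy); apply: (@le_trans _ _ (t * W u + (1 - t) * W v)).
  by rewrite (Wu u)// (Wv v)// lerD// ler_wpM2l ?UK ?subr_ge0// (le_trans pu) ?ltW.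
rewrite (Wuv u (lexx u) (ltW uv)) (Wuv v (ltW uv) (lexx v)) (Wuv y (ltW uy) (ltW yv)).
by rewrite -[X in _ <= a * X + b]ey le_eqVlt; apply/orP; left; apply/eqP; ring.
Qed.

End minorant.

Section monotone.
Context {R : realType}.
Implicit Types (f g : R -> R) (a p : R).

Lemma derive_ge0_homo f g (i : interval R) :
  (forall t, t \in i -> is_derive t 1 f (g t)) -> (forall t, t \in i -> 0 <= g t) ->
  {in i &, {homo f : s t / s <= t}}.
Proof.
move=> df g0 s t si ti; rewrite le_eqVlt => /predU1P[->//|st].
have [u ui [-> _]] := mean_value df si ti (negbT (lt_eqF st)).
by rewrite lerDl mulr_ge0 ?g0// subr_ge0 ltW.
Qed.

Lemma derive_gt0_homo f g (i : interval R) :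
  (forall t, t \in i -> is_derive t 1 f (g t)) -> (forall t, t \in i -> 0 < g t) ->
  {in i &, {homo f : s t / s < t}}.
Proof.
move=> df g0 s t si ti st.
have [u ui [-> _]] := mean_value df si ti (negbT (lt_eqF st)).
by rewrite ltrDl mulr_gt0 ?g0// subr_gt0.
Qed.

Lemma glue_homo_le f g p a : f a = g a ->
  {in `[p, a] &, {homo f : s t / s <= t}} -> {in `[a, +oo[ &, {homo g : s t / s <= t}} ->
  {in `[p, +oo[ &, {homo glue a f g : s t / s <= t}}.
Proof.
move=> e mf mg s t; rewrite !in_itv/= !andbT => ps pt st; rewrite /glue.
have [sa|as_] := leP s a; have [ta|at_] := leP t a.
- by apply: mf => //; rewrite in_itv/= ?ps ?pt.
- apply: (@le_trans _ _ (f a)).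
    by apply: mf => //; rewrite in_itv/= ?ps ?lexx ?(le_trans ps).
  by rewrite e; apply: mg; rewrite ?in_itv/= ?lexx ?andbT// ltW.
- by have := lt_le_trans as_ (le_trans st ta); rewrite ltxx.
- by apply: mg => //; rewrite in_itv/= ltW.
Qed.

Lemma glue_homo_lt f g p a : f a = g a ->
  {in `[p, a] &, {homo f : s t / s < t}} -> {in `[a, +oo[ &, {homo g : s t / s < t}} ->
  {in `[p, +oo[ &, {homo glue a f g : s t / s < t}}.
Proof.
move=> e mf mg s t; rewrite !in_itv/= !andbT => ps pt st; rewrite /glue.
have [sa|as_] := leP s a; have [ta|at_] := leP t a.
- by apply: mf => //; rewrite in_itv/= ?ps ?pt.
- apply: (@le_lt_trans _ _ (f a)).
    by apply: (ltW_homo_in mf) => //; rewrite in_itv/= ?ps ?lexx ?(le_trans ps).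
  by rewrite e; apply: mg; rewrite ?in_itv/= ?lexx ?andbT// ltW.
- by have := lt_trans as_ (lt_le_trans st ta); rewrite ltxx.
- by apply: mg => //; rewrite in_itv/= ltW.
Qed.

End monotone.

(** * The transformed obstacles *)

Section transform.
Context {R : realType}.
Variables alpha : R.
Hypothesis al0 : 0 < alpha.
Implicit Types (k dk : R -> R) (x y c s : R).

Notation beta := (Num.sqrt (2 * alpha)).

Lemma beta_gt0 : 0 < beta.
Proof. by rewrite sqrtr_gt0 mulr_gt0. Qed.

Lemma beta_sqr : beta * beta = 2 * alpha.
Proof. by rewrite -expr2 sqr_sqrtr// mulr_ge0// ltW. Qed.

Let beta0 := beta_gt0.
Let beta2 := beta_sqr.

Lemma Psi_gt0 x : 0 < Psi alpha x.
Proof. exact: expR_gt0. Qed.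

Lemma Psi0 : Psi alpha 0 = 1.
Proof. by rewrite /Psi mulr0 expR0. Qed.

Lemma Psi_le x s : (Psi alpha x <= Psi alpha s) = (x <= s).
Proof. by rewrite /Psi ler_expR ler_pM2l// mulr_gt0. Qed.

Lemma Psi_lt x s : (Psi alpha x < Psi alpha s) = (x < s).
Proof. by rewrite /Psi ltr_expR ltr_pM2l// mulr_gt0. Qed.

Lemma Psi_inv1 : Psi_inv alpha 1 = 0.
Proof. by rewrite /Psi_inv ln1 mul0r. Qed.

Lemma Psi_inv_le y z : 0 < y -> 0 < z -> (Psi_inv alpha y <= Psi_inv alpha z) = (y <= z).
Proof. by move=> y0 z0; rewrite -Psi_le !Psi_invK. Qed.

Lemma Psi_inv_lt y z : 0 < y -> 0 < z -> (Psi_inv alpha y < Psi_inv alpha z) = (y < z).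
Proof. by move=> y0 z0; rewrite -Psi_lt !Psi_invK. Qed.

Lemma transform_Psi k x : transform alpha k (Psi alpha x) = expR (beta * x) * k x.
Proof. by rewrite /transform PsiK. Qed.

Lemma is_derive_Psi_inv y : 0 < y -> is_derive y 1 (Psi_inv alpha) (y^-1 / (2 * beta)).
Proof.
move=> y0; have ? := is_derive1_ln y0; rewrite /Psi_inv; apply: is_derive_eq.
by rewrite /GRing.scale /=; ring.
Qed.

(** The derivative of [transform k] at [Psi x] as a function of [x]. *)
Definition tslope k dk x := expR (- (beta * x)) * (dk x + beta * k x) / (2 * beta).

Lemma is_derive_transform k dk y : 0 < y ->
  is_derive (Psi_inv alpha y) 1 k (dk (Psi_inv alpha y)) ->
  is_derive y 1 (transform alpha k) (tslope k dk (Psi_inv alpha y)).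
Proof.
move=> y0 dk_; have dinv := is_derive_Psi_inv y0.
have dcomp : is_derive y 1 (k \o Psi_inv alpha) (y^-1 / (2 * beta) * dk (Psi_inv alpha y)).
  by have := is_derive1_comp dk_ dinv; rewrite mulrC.
have dexp : is_derive y 1 (expR \o (fun z => beta * Psi_inv alpha z))
    (expR (beta * Psi_inv alpha y) * (beta * (y^-1 / (2 * beta)))).
  by apply: is_derive_eq; rewrite /GRing.scale /=; ring.
have -> : transform alpha k = (expR \o (fun z => beta * Psi_inv alpha z)) * (k \o Psi_inv alpha).
  by [].
apply: is_derive_eq; rewrite /GRing.scale /= /tslope; set x := Psi_inv alpha y.
have -> : y^-1 = (expR (beta * x) * expR (beta * x))^-1.
  by rewrite -[in LHS](Psi_invK al0 y0) -expRD /Psi -/x; congr (expR _)^-1; ring.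
by rewrite expRN; field; rewrite !gt_eqF ?expR_gt0.
Qed.

(** The first order terms cancel since [beta ^+ 2 = 2 * alpha]. *)
Lemma is_derive_tslope k dk x d2 : is_derive x 1 k (dk x) -> is_derive x 1 dk d2 ->
  is_derive x 1 (tslope k dk) (expR (- (beta * x)) * (d2 / 2 - alpha * k x) / beta).
Proof.
move=> d1 d2_; rewrite /tslope; apply: is_derive_eq; rewrite /GRing.scale /=.
have ea : alpha = beta * beta / 2 by rewrite beta2; field.
have := gt_eqF beta0; move: (beta) ea => b ->.
by move=> b0; field; rewrite b0.
Qed.

End transform.

Section obstacle.
Context {R : realType}.
Variables (alpha delta lambda : R).
Hypotheses (al0 : 0 < alpha) (de0 : 0 < delta) (la0 : 0 < lambda)
  (lad : lambda < alpha * delta)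
  (f0_gt : alpha / (2 * lambda) < f0 alpha delta lambda).
Implicit Types (x y c s t : R).

Notation beta := (Num.sqrt (2 * alpha)).
Notation f0 := (f0 alpha delta lambda).
Notation B0 := (B0 alpha delta lambda).
Notation kappa := (delta - lambda / alpha).

Let beta0 : 0 < beta := beta_gt0 al0.
Let beta2 : beta * beta = 2 * alpha := beta_sqr al0.

Lemma kappa_gt0 : 0 < kappa.
Proof. by rewrite subr_gt0 ltr_pdivrMr// mulrC. Qed.

Lemma f0_gt0 : 0 < f0.
Proof. by apply: lt_trans f0_gt; rewrite divr_gt0// mulr_gt0. Qed.

(** [B0] is such that [B0 * expR (- (beta * x))] has the slope of [h_l] at [f0];
    this equation for [f0] says that the values agree there as well. *)
Lemma f0_root : kappa * f0 ^+ 2 + 2 * f0 / beta * kappa = lambda / alpha ^+ 2.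
Proof.
rewrite /Defs.f0; set D := alpha * delta - lambda; set q := Num.sqrt (_ / D).
have D0 : 0 < D by rewrite subr_gt0.
have q2 : q ^+ 2 = (alpha * delta + lambda) / D.
  by rewrite sqr_sqrtr// divr_ge0 ?(ltW D0)// addr_ge0 ?(ltW la0)// mulr_ge0// ltW.
have -> : kappa = D / alpha by rewrite /D; field; rewrite gt_eqF.
have -> : D / alpha * (beta^-1 * (q - 1)) ^+ 2 + 2 * (beta^-1 * (q - 1)) / beta * (D / alpha) =
   D / (alpha * (beta * beta)) * (q ^+ 2 - 1).
  by field; rewrite !gt_eqF.
by rewrite q2 beta2 /D; field; rewrite !gt_eqF.
Qed.

Lemma B0_f0 : B0 * expR (- (f0 * beta)) = - (2 * f0 * kappa / beta).
Proof.
by rewrite /Defs.B0 expRN; field; rewrite !gt_eqF ?expR_gt0.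
Qed.

Lemma B0_lt0 : B0 < 0.
Proof.
rewrite -(pmulr_llt0 _ (expR_gt0 (- (f0 * beta)))) B0_f0 oppr_lt0.
by rewrite divr_gt0// mulr_gt0 ?kappa_gt0// mulr_gt0 ?f0_gt0.
Qed.

Definition dh_r1 c x := 2 * kappa * x - 2 * delta * c.
Definition dh_r2 c x := - (2 * lambda * c / alpha) - beta * B0 * expR (- ((x - c) * beta)).
Definition dh_r c := glue (f0 + c) (dh_r1 c) (dh_r2 c).

Lemma is_derive_h_r1 c x : is_derive x 1 (h_r1 alpha delta lambda c) (dh_r1 c x).
Proof.
by rewrite /h_r1 /dh_r1; apply: is_derive_eq; rewrite /GRing.scale /=; ring.
Qed.

Lemma is_derive_h_r2 c x : is_derive x 1 (h_r2 alpha delta lambda c) (dh_r2 c x).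
Proof.
by rewrite /h_r2 /dh_r2; apply: is_derive_eq; rewrite /GRing.scale /=; field; rewrite gt_eqF.
Qed.

Lemma h_r_glue c : h_r alpha delta lambda c =
  glue (f0 + c) (h_r1 alpha delta lambda c) (h_r2 alpha delta lambda c).
Proof. by []. Qed.

Lemma h_r12 c : h_r1 alpha delta lambda c (f0 + c) = h_r2 alpha delta lambda c (f0 + c).
Proof.
rewrite /h_r1 /h_r2 addrK B0_f0.
have -> : - (2 * f0 * kappa / beta) = kappa * f0 ^+ 2 - lambda / alpha ^+ 2.
  by rewrite -f0_root; field; rewrite !gt_eqF.
by field; rewrite gt_eqF.
Qed.

Lemma dh_r12 c : dh_r1 c (f0 + c) = dh_r2 c (f0 + c).
Proof.
rewrite /dh_r1 /dh_r2 addrK -[beta * B0 * _]mulrA B0_f0.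
by field; rewrite !gt_eqF.
Qed.

Lemma is_derive_h_r c x : is_derive x 1 (h_r alpha delta lambda c) (dh_r c x).
Proof.
apply: glue_is_derive; [exact: h_r12|exact: dh_r12| |] => _.
  exact: is_derive_h_r1.
exact: is_derive_h_r2.
Qed.

(** The discounted generator [h^`(2) / 2 - alpha * h] at [h := h_r1 c]; up to a
    positive factor it is the second derivative of the transform of [h_r1 c]. *)
Definition curvature c x := delta - alpha * delta * (x - c) ^+ 2 + lambda * x ^+ 2 - alpha * c.

Definition slope_r1 c := tslope alpha (h_r1 alpha delta lambda c) (dh_r1 c).
(** The exponential in [h_r2] has a constant transform and drops out of the
    slope. *)
Definition slope_r2 c x :=
  expR (- (beta * x)) * (beta * (lambda / alpha * c * (c - 2 * x) + c) - 2 * lambda * c / alpha)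
  / (2 * beta).

Lemma slope_r2E c x : slope_r2 c x = tslope alpha (h_r2 alpha delta lambda c) (dh_r2 c) x.
Proof. by rewrite /slope_r2 /tslope /h_r2 /dh_r2; congr (_ * _ / _); ring. Qed.

Definition slope_r c := glue (f0 + c) (slope_r1 c) (slope_r2 c).

Lemma slope_rE c x : slope_r c x = tslope alpha (h_r alpha delta lambda c) (dh_r c) x.
Proof.
rewrite /slope_r /slope_r1 /tslope /dh_r h_r_glue /glue; case: ifP => // _.
exact: slope_r2E.
Qed.

Lemma is_derive_slope_r1 c x :
  is_derive x 1 (slope_r1 c) (expR (- (beta * x)) * curvature c x / beta).
Proof.
have d2 : is_derive x 1 (dh_r1 c) (2 * kappa).
  by rewrite /dh_r1; apply: is_derive_eq; rewrite /GRing.scale /=; ring.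
suff <- : expR (- (beta * x)) * (2 * kappa / 2 - alpha * h_r1 alpha delta lambda c x) / beta =
    expR (- (beta * x)) * curvature c x / beta.
  rewrite /slope_r1; apply: (is_derive_tslope al0 _ d2).
  exact: is_derive_h_r1.
by rewrite /curvature /h_r1; congr (_ * _ / _); field; rewrite gt_eqF.
Qed.

Lemma is_derive_slope_r2 c x : is_derive x 1 (slope_r2 c)
  (expR (- (beta * x)) * (c * (2 * lambda * x - lambda * c - alpha)) / beta).
Proof.
rewrite /slope_r2; apply: is_derive_eq; rewrite /GRing.scale /=.
have := gt_eqF al0; have := gt_eqF beta0; have ea : alpha = beta * beta / 2 by rewrite beta2; field.
move: (beta) ea => b -> b0 _.
by field; rewrite b0.
Qed.

Lemma slope_r12 c : slope_r1 c (f0 + c) = slope_r2 c (f0 + c).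
Proof. by rewrite slope_r2E /slope_r1 /tslope h_r12 dh_r12. Qed.

(** [curvature c] is a concave quadratic polynomial, so it is enough to look at
    the two ends. At [f0 + c] the equation of [f0] and [alpha < 2 * lambda * f0]
    make it positive. *)
Lemma curvature_gt0 c x : 0 <= c -> 0 < curvature c 0 -> 0 <= x <= f0 + c ->
  0 < curvature c x.
Proof.
move=> c0 Q0 /andP[x0 xf].
have D0 : 0 < alpha * delta - lambda by rewrite subr_gt0.
have Qf : 0 < curvature c (f0 + c).
  have f0f0 : (alpha * delta - lambda) * f0 ^+ 2 < delta.
    have := f0_root; have : 0 < 2 * f0 / beta * kappa.
      by rewrite mulr_gt0 ?kappa_gt0// divr_gt0// mulr_gt0 ?f0_gt0.
    have -> : kappa = (alpha * delta - lambda) / alpha by field; rewrite gt_eqF.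
    have -> : lambda / alpha ^+ 2 = lambda / alpha / alpha by field; rewrite gt_eqF.
    rewrite [_ / alpha * f0 ^+ 2]mulrAC.
    set Z := 2 * f0 / beta * _ => Z0 root.
    have : (alpha * delta - lambda) * f0 ^+ 2 / alpha < lambda / alpha / alpha by lra.
    rewrite ltr_pM2r ?invr_gt0// => /lt_trans; apply.
    by rewrite ltr_pdivrMr// mulrC.
  have : alpha < 2 * lambda * f0 by move: f0_gt; rewrite ltr_pdivrMr ?mulr_gt0// mulrC.
  rewrite -subr_gt0 => /ltW/(mulr_ge0 c0) h1; have := mulr_ge0 (ltW la0) (sqr_ge0 c).
  by rewrite /curvature addrK !expr2 in f0f0 h1 *; lra.
have f0c : 0 < f0 + c by rewrite ltr_wpDr ?f0_gt0.
rewrite -(pmulr_rgt0 _ f0c).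
have -> : (f0 + c) * curvature c x = (f0 + c - x) * curvature c 0 +
  x * curvature c (f0 + c) + (f0 + c) * (alpha * delta - lambda) * x * (f0 + c - x).
  by rewrite /curvature; ring.
have xf' : 0 <= f0 + c - x by rewrite subr_ge0.
have D1 := mulr_ge0 (mulr_ge0 (mulr_ge0 (ltW f0c) (ltW D0)) x0) xf'.
have [->|x_neq0] := eqVneq x 0; first by rewrite subr0 !mul0r !mulr0 mul0r !addr0 mulr_gt0.
have xgt0 : 0 < x by rewrite lt0r x_neq0.
have := mulr_gt0 xgt0 Qf; have := mulr_ge0 xf' (ltW Q0); lra.
Qed.

Lemma two_lambda_f0 : alpha < 2 * lambda * f0.
Proof. by move: f0_gt; rewrite ltr_pdivrMr ?mulr_gt0// mulrC. Qed.

Lemma slope_r1_lt c : 0 <= c -> 0 < curvature c 0 ->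
  {in `[0, f0 + c] &, {homo slope_r1 c : s t / s < t}}.
Proof.
move=> c0 Q0; apply: (derive_gt0_homo (fun t _ => is_derive_slope_r1 c t)) => t.
rewrite in_itv/= => t01.
exact: divr_gt0 (mulr_gt0 (expR_gt0 _) (curvature_gt0 c0 Q0 t01)) beta0.
Qed.

Lemma slope_r2_factor_gt0 c x : 0 <= c -> f0 + c <= x -> 0 < 2 * lambda * x - lambda * c - alpha.
Proof.
move=> c0 fx; have := two_lambda_f0; have := mulr_ge0 (ltW la0) c0.
have : lambda * (f0 + c) <= lambda * x by rewrite ler_pM2l.
lra.
Qed.

Lemma slope_r2_lt c : 0 < c -> {in `[f0 + c, +oo[ &, {homo slope_r2 c : s t / s < t}}.
Proof.
move=> c0; apply: (derive_gt0_homo (fun t _ => is_derive_slope_r2 c t)) => t.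
rewrite in_itv/= andbT => ft.
have factor0 := slope_r2_factor_gt0 (ltW c0) ft.
exact: divr_gt0 (mulr_gt0 (expR_gt0 _) (mulr_gt0 c0 factor0)) beta0.
Qed.

Lemma slope_r2_le c : 0 <= c -> {in `[f0 + c, +oo[ &, {homo slope_r2 c : s t / s <= t}}.
Proof.
move=> c0; apply: (derive_ge0_homo (fun t _ => is_derive_slope_r2 c t)) => t.
rewrite in_itv/= andbT => ft.
have factor0 := slope_r2_factor_gt0 c0 ft.
exact: divr_ge0 (mulr_ge0 (expR_ge0 _) (mulr_ge0 c0 (ltW factor0))) (ltW beta0).
Qed.

Lemma slope_r_lt c : 0 < c -> 0 < curvature c 0 ->
  {in `[0, +oo[ &, {homo slope_r c : s t / s < t}}.
Proof.
move=> c0 Q0; apply: glue_homo_lt; [exact: slope_r12|exact: slope_r1_lt (ltW c0) Q0|].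
exact: slope_r2_lt.
Qed.

Lemma slope_r_le c : 0 <= c -> 0 < curvature c 0 ->
  {in `[0, +oo[ &, {homo slope_r c : s t / s <= t}}.
Proof.
move=> c0 Q0; apply: glue_homo_le; [exact: slope_r12| |exact: slope_r2_le].
exact: ltW_homo_in (slope_r1_lt c0 Q0).
Qed.

Lemma slope_r2_le0 c x : 0 <= c -> f0 + c <= x -> slope_r2 c x <= 0.
Proof.
move=> c0 fx; rewrite /slope_r2 ler_pdivrMr ?mulr_gt0// mul0r pmulr_rle0 ?expR_gt0//.
have -> : beta * (lambda / alpha * c * (c - 2 * x) + c) - 2 * lambda * c / alpha =
  - (c / alpha * (beta * (2 * lambda * x - lambda * c - alpha) + 2 * lambda)).
  by field; rewrite gt_eqF.
rewrite oppr_le0 mulr_ge0 ?divr_ge0 ?(ltW al0)// addr_ge0 ?mulr_ge0 ?(ltW la0) ?(ltW beta0)//.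
exact/ltW/slope_r2_factor_gt0.
Qed.

(** The slope increases and is nonpositive on the second piece. *)
Lemma slope_r_le0 c x : 0 <= c -> 0 < curvature c 0 -> 0 <= x -> slope_r c x <= 0.
Proof.
move=> c0 Q0 x0; have f0c : 0 <= f0 + c by rewrite addr_ge0// ltW// f0_gt0.
apply: (@le_trans _ _ (slope_r c (Num.max x (f0 + c)))).
  by apply: slope_r_le => //; rewrite ?in_itv/= ?le_max ?x0 ?lexx.
rewrite /slope_r glue_ge ?le_max ?lexx ?orbT//; last exact: slope_r12.
by apply: slope_r2_le0 => //; rewrite le_max lexx orbT.
Qed.

Lemma slope_r00 : slope_r 0 0 = h_r alpha delta lambda 0 0 / 2.
Proof.
have f00 : 0 <= f0 + 0 by rewrite addr0 ltW// f0_gt0.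
rewrite slope_rE /tslope /dh_r glue_le// /dh_r1 !mulr0 oppr0 expR0.
by field; rewrite gt_eqF.
Qed.

Lemma slope_r_continuous c x : {for x, continuous (slope_r c)}.
Proof.
apply: glue_continuous; [exact: slope_r12| |] => _.
  by apply: is_derive_continuous; exact: is_derive_slope_r1.
by apply: is_derive_continuous; exact: is_derive_slope_r2.
Qed.

Lemma h_r0_left x : x <= f0 -> h_r alpha delta lambda 0 x = h_l alpha delta lambda x.
Proof. by move=> xf; rewrite /h_r addr0 xf /h_r1 /h_l; ring. Qed.

Lemma h_l_le_h_r c x : 0 <= c -> x_c delta c <= f0 + c -> x <= x_c delta c ->
  h_l alpha delta lambda x <= h_r alpha delta lambda c x.
Proof.
move=> c0 xcf xxc; rewrite /h_r (le_trans xxc xcf) /h_l /h_r1.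
have -> : delta * c * (c - 2 * x) + kappa * x ^+ 2 + c - lambda / alpha ^+ 2 =
   kappa * x ^+ 2 - lambda / alpha ^+ 2 + 2 * delta * c * (x_c delta c - x).
  by rewrite /x_c; field; rewrite !gt_eqF.
by rewrite lerDl !mulr_ge0// ?(ltW de0)// subr_ge0.
Qed.

(** On the first piece the difference of the obstacles is affine and vanishes at
    [x_c]. On the second piece, the exponential is above its tangent at [f0]
    and [B0 < 0], which leaves [kappa * (x - c - f0) ^+ 2] plus nonnegative
    terms. *)
Lemma h_r_le_h_l c x : 0 <= c -> (2 * delta)^-1 < f0 -> x_c delta c <= x ->
  h_r alpha delta lambda c x <= h_l alpha delta lambda x.
Proof.
move=> c0 df xcx; rewrite /h_r; have [xf|fx] := leP x (f0 + c).
  have -> : h_r1 alpha delta lambda c x =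
     h_l alpha delta lambda x - 2 * delta * c * (x - x_c delta c).
    by rewrite /x_c /h_r1 /h_l; field; rewrite !gt_eqF.
  by rewrite gerBl !mulr_ge0 ?(ltW de0)// subr_ge0.
set s := x - c; have fs : f0 < s by rewrite /s; lra.
(* the exponential lies above its tangent at [f0] *)
have B_le : B0 * expR (- (s * beta)) <= kappa * s ^+ 2 - lambda / alpha ^+ 2.
  have e1 : expR (- (s * beta)) = expR (- (f0 * beta)) * expR (- ((s - f0) * beta)).
    by rewrite -expRD; congr expR; ring.
  rewrite e1 mulrA B0_f0 -f0_root.
  have := expR_ge1Dx (- ((s - f0) * beta)) => e2.
  have Z0 : 0 <= 2 * f0 * kappa / beta :=
    divr_ge0 (mulr_ge0 (mulr_ge0 (ler0n R 2) (ltW f0_gt0)) (ltW kappa_gt0)) (ltW beta0).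
  have := ler_wpM2l Z0 e2.
  have -> : 2 * f0 * kappa / beta * (1 + - ((s - f0) * beta)) =
    2 * f0 / beta * kappa - 2 * f0 * kappa * (s - f0) by field; rewrite !gt_eqF.
  have := mulr_ge0 (ltW kappa_gt0) (sqr_ge0 (s - f0)); rewrite !expr2; lra.
rewrite /h_r2 /h_l -/s.
have ds : 1 < 2 * delta * s.
  have d2 : 0 < 2 * delta by rewrite mulr_gt0.
  by rewrite mulrC -ltr_pdivrMr// mul1r; exact: lt_trans fs.
have cs : 0 <= c * (2 * delta * s - 1) by rewrite mulr_ge0// subr_ge0 ltW.
have cc := mulr_ge0 (ltW de0) (sqr_ge0 c).
have -> : x = s + c by rewrite /s; ring.
rewrite !expr2 in B_le cc *.
have -> : lambda / alpha * c * (c - 2 * (s + c)) =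
  - (lambda / alpha * (2 * c * s + c * c)) by ring.
lra.
Qed.

End obstacle.

(** * Common tangent and convex minorant *)

Section small_cost.
Context {R : realType}.
Variables (alpha delta lambda : R).
Hypotheses (al0 : 0 < alpha) (de0 : 0 < delta) (la0 : 0 < lambda)
  (lad : lambda < alpha * delta)
  (f0_gt : alpha / (2 * lambda) < f0 alpha delta lambda).
Implicit Types (x y c s t : R).

Notation beta := (Num.sqrt (2 * alpha)).
Notation f0 := (f0 alpha delta lambda).
Notation slope_r := (slope_r alpha delta lambda).
Notation curvature := (curvature alpha delta lambda).
Notation x_c := (x_c delta).

Let beta0 : 0 < beta := beta_gt0 al0.
Let f0_pos : 0 < f0 := f0_gt0 al0 la0 f0_gt.

Lemma x_0_lt_f0 : (2 * delta)^-1 < f0.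
Proof.
apply: lt_trans f0_gt; rewrite ltr_pdivlMr ?mulr_gt0//.
by rewrite mulrC ltr_pdivrMr ?mulr_gt0// mulrCA ltr_pM2l.
Qed.

Lemma curvature0 : 0 < curvature 0 0.
Proof. by rewrite /curvature; have := de0; rewrite !expr2; lra. Qed.

(** At [x_c] the two obstacles agree, so that only their slopes contribute to
    the jump of the derivative of the transforms. *)
Lemma slope_r_xc c : 0 <= c -> x_c c <= f0 ->
  slope_r c (x_c c) = slope_r 0 (x_c c) - expR (- (beta * x_c c)) * (delta * c / beta).
Proof.
move=> c0 xf; rewrite /slope_r !glue_le ?addr0//; last by rewrite (le_trans xf)// lerDl.
rewrite /slope_r1 /tslope /dh_r1 /h_r1 /x_c; move: (expR _) => E.
by field; rewrite !gt_eqF.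
Qed.

Let K := (lambda / alpha * (2 * f0 + 1) * beta + 2 * lambda / alpha) / (2 * beta).

Let K_num_gt0 : 0 < lambda / alpha * (2 * f0 + 1) * beta + 2 * lambda / alpha.
Proof.
have la : 0 < lambda / alpha by exact: divr_gt0.
rewrite -[2 * lambda / alpha]mulrA addr_gt0 ?(mulr_gt0 _ la)// mulr_gt0// mulr_gt0//.
by have := f0_pos; lra.
Qed.

Lemma slope_r2_ge c : 0 <= c -> c <= 1 -> - (c * K) <= slope_r c (f0 + c).
Proof.
move=> c0 c1; rewrite /slope_r glue_ge ?lexx//; last exact: slope_r12.
rewrite /slope_r2 ler_pdivlMr ?mulr_gt0//.
have -> : - (c * K) * (2 * beta) =
    - (c * (lambda / alpha * (2 * f0 + 1) * beta + 2 * lambda / alpha)).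
  by rewrite /K; field; rewrite !gt_eqF.
set N := c * _; have N0 : 0 <= N.
  exact: mulr_ge0 c0 (ltW K_num_gt0).
have E1 : expR (- (beta * (f0 + c))) <= 1.
  rewrite -[leRHS]expR0 ler_expR oppr_le0.
  exact: mulr_ge0 (ltW beta0) (addr_ge0 (ltW f0_pos) c0).
apply: (@le_trans _ _ (expR (- (beta * (f0 + c))) * - N)).
  by rewrite mulrN lerN2 -[leRHS]mul1r ler_wpM2r.
rewrite ler_pM2l ?expR_gt0// /N -subr_ge0.
have -> : beta * (lambda / alpha * c * (c - 2 * (f0 + c)) + c) - 2 * lambda * c / alpha -
    - (c * (lambda / alpha * (2 * f0 + 1) * beta + 2 * lambda / alpha)) =
  beta * c * (1 + lambda / alpha * (1 - c)) by ring.
have la : 0 <= lambda / alpha by apply: ltW; exact: divr_gt0.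
apply: (mulr_ge0 (mulr_ge0 (ltW beta0) c0)); rewrite addr_ge0// mulr_ge0// subr_ge0.
exact: c1.
Qed.

(** For small [c] the slope of [H_r] at [y_c] is still above that of [H_l] at
    [1], and the slope of [H_l] at [y_c], which is bounded away from [0], is
    below that of [H_r] at the end of its first piece, which tends to [0]. *)
Lemma small_cost : exists2 c1, 0 < c1 & forall c, 0 < c < c1 ->
  [/\ 0 < curvature c 0, x_c c < f0, c < f0,
      slope_r 0 0 < slope_r c (x_c c) & slope_r 0 (x_c c) < slope_r c (f0 + c)].
Proof.
pose x0 := (2 * delta)^-1; pose m := (x0 + f0) / 2.
have x0f : x0 < f0 := x_0_lt_f0.
have x00 : 0 < x0 by rewrite invr_gt0 mulr_gt0.
have slope_lt s t : 0 <= s -> s < t -> t <= f0 -> slope_r 0 s < slope_r 0 t.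
  move=> s0 st tf; rewrite /slope_r !glue_le ?addr0// ?(le_trans (ltW st))//.
  apply: (slope_r1_lt al0 de0 la0 lad f0_gt (lexx 0) curvature0) => //;
    rewrite in_itv/= addr0; apply/andP; split=> //; lra.
have ad0 : 0 < alpha * delta + alpha by rewrite addr_gt0// mulr_gt0.
pose gap1 := slope_r 0 x0 - slope_r 0 0; pose gap2 := - slope_r 0 m.
have gap1_0 : 0 < gap1 by rewrite subr_gt0 slope_lt// ltW.
have gap2_0 : 0 < gap2.
  rewrite oppr_gt0; apply: (@lt_le_trans _ _ (slope_r 0 f0)).
    by apply: slope_lt; rewrite /m//; lra.
  by apply: (slope_r_le0 al0 de0 la0 lad f0_gt (lexx 0) curvature0); exact: ltW.
have K0 : 0 < K.
  by rewrite /K divr_gt0// mulr_gt0.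
exists (Num.min 1 (Num.min (f0 - x0) (Num.min (delta / (alpha * delta + alpha))
  (Num.min (gap1 * beta / delta) (gap2 / K))))).
  have gb0 : 0 < gap1 * beta by exact: mulr_gt0.
  rewrite !lt_min ltr01 subr_gt0 x0f /= (divr_gt0 de0 ad0) (divr_gt0 gb0 de0).
  exact: divr_gt0.
move=> c /andP[c0]; rewrite !lt_min => /and5P[c1 cf cQ cg1 cg2].
have ec : x_c c = x0 + c / 2 by [].
have xm : x_c c < m by rewrite ec /m; lra.
have xf : x_c c < f0 by rewrite (lt_trans xm)// /m; lra.
split => //.
- have : c * (alpha * delta + alpha) < delta by rewrite -ltr_pdivlMr.
  have : c * c <= c by rewrite -[leRHS]mulr1 ler_wpM2l ?ltW.
  rewrite -(ler_pM2l (mulr_gt0 al0 de0)) /curvature !expr2; lra.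
- lra.
- rewrite slope_r_xc ?ltW//; have h1 : slope_r 0 x0 < slope_r 0 (x_c c).
    by apply: slope_lt; rewrite ?(ltW x00) ?(ltW xf)// ec; lra.
  have h2 : delta * c / beta < gap1.
    by rewrite ltr_pdivrMr// mulrC -ltr_pdivlMr.
  have h3 : expR (- (beta * x_c c)) * (delta * c / beta) <= delta * c / beta.
    rewrite ger_pMl ?divr_gt0 ?mulr_gt0// -[leRHS]expR0 ler_expR oppr_le0 mulr_ge0 ?(ltW beta0)// ec.
    by lra.
  by rewrite /gap1 in h2; lra.
- apply: lt_le_trans (slope_r2_ge (ltW c0) (ltW c1)).
  apply: (@lt_trans _ _ (slope_r 0 m)).
    by apply: slope_lt => //; [rewrite ec; lra|rewrite /m; lra].
  by rewrite ltrNr; rewrite -ltr_pdivlMr.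
Qed.

End small_cost.

Section tangency.
Context {R : realType}.
Variables (alpha delta lambda : R).
Hypotheses (al0 : 0 < alpha) (de0 : 0 < delta) (la0 : 0 < lambda)
  (lad : lambda < alpha * delta)
  (f0_gt : alpha / (2 * lambda) < f0 alpha delta lambda).
Implicit Types (x y c s t : R).

Notation f0 := (f0 alpha delta lambda).
Notation Hr := (H_r alpha delta lambda).
Notation Hl := (H_l alpha delta lambda).
Notation slope_r := (slope_r alpha delta lambda).
Notation curvature := (curvature alpha delta lambda).
Notation y_c := (y_c alpha delta).
Notation Psi := (Psi alpha).
Notation Psi_inv := (Psi_inv alpha).

Definition dH_r c y := slope_r c (Psi_inv y).

Lemma is_derive_H_r c y : 0 < y -> is_derive y 1 (Hr c) (dH_r c y).
Proof.
move=> y0; rewrite /dH_r slope_rE//; apply: is_derive_transform => //.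
exact: is_derive_h_r.
Qed.

Lemma Psi_inv_ge0 y : 1 <= y -> 0 <= Psi_inv y.
Proof. by move=> y1; rewrite -(Psi_inv1 alpha) Psi_inv_le// (lt_le_trans ltr01). Qed.

Lemma dH_r_le c : 0 <= c -> 0 < curvature c 0 ->
  {in `[1, +oo[ &, {homo dH_r c : s t / s <= t}}.
Proof.
move=> c0 Q0 s t; rewrite !in_itv/= !andbT => s1 t1 st.
apply: slope_r_le; rewrite ?in_itv/= ?Psi_inv_ge0//.
by rewrite Psi_inv_le// (lt_le_trans ltr01).
Qed.

Lemma dH_r_lt c : 0 < c -> 0 < curvature c 0 ->
  {in `[1, +oo[ &, {homo dH_r c : s t / s < t}}.
Proof.
move=> c0 Q0 s t; rewrite !in_itv/= !andbT => s1 t1 st.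
apply: slope_r_lt; rewrite ?in_itv/= ?Psi_inv_ge0//.
by rewrite Psi_inv_lt// (lt_le_trans ltr01).
Qed.

Lemma dH_r0_lt : {in `[1, Psi f0] &, {homo dH_r 0 : s t / s < t}}.
Proof.
move=> s t; rewrite !in_itv/= => /andP[s1 sf] /andP[t1 tf] st.
have [s0 t0] : 0 < s /\ 0 < t by rewrite !(lt_le_trans ltr01).
have inv_le y : 0 < y -> y <= Psi f0 -> Psi_inv y <= f0 + 0.
  by move=> y0 yf; rewrite addr0 -(Psi_le al0) Psi_invK.
rewrite /dH_r /slope_r !glue_le ?inv_le//.
apply: (slope_r1_lt al0 de0 la0 lad f0_gt (lexx 0) (curvature0 _ _ de0));
  by rewrite ?in_itv/= ?Psi_inv_ge0 ?inv_le ?Psi_inv_lt.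
Qed.

Lemma dH_r_continuous c y : 0 < y -> {for y, continuous (dH_r c)}.
Proof.
move=> y0; apply: continuous_comp; last exact: slope_r_continuous.
exact: is_derive_continuous (is_derive_Psi_inv alpha y0).
Qed.

(** The left obstacle agrees with the right one for [c = 0] up to [Psi f0]; unlike
    [H_l], [H_r 0] is convex on the whole half-line, and it replaces [H_l] in the
    arguments on tangents. *)
Lemma H_r0_left y : y <= Psi f0 -> Hr 0 y = Hl y.
Proof.
move=> yf; rewrite /H_r /H_l /transform h_r0_left//.
have [y0|y0] := ltP 0 y; first by rewrite -(Psi_le al0) Psi_invK.
by rewrite /Defs.Psi_inv ln0// mul0r ltW// f0_gt0.
Qed.

Lemma is_derive_H_l y : 0 < y -> y < Psi f0 -> is_derive y 1 Hl (dH_r 0 y).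
Proof.
move=> y0 yf; apply: near_eq_is_derive (is_derive_H_r 0 y0).
by apply: filterS (lt_nbhsl yf) => s /ltW; exact: H_r0_left.
Qed.

Lemma H_r_strictly_convex c p : 0 < c -> 0 < curvature c 0 -> 1 <= p ->
  strictly_convex_on `]p, +oo[ (Hr c).
Proof.
move=> c0 Q0 p1; apply: (strict_chord (g := dH_r c)) => [t|s t].
  by rewrite in_itv/= andbT => pt; apply: is_derive_H_r; rewrite (lt_le_trans ltr01)// (le_trans p1) ?ltW.
rewrite !in_itv/= !andbT => ps pt; apply: dH_r_lt => //; rewrite in_itv/= andbT.
  by rewrite (le_trans p1) ?ltW.
by rewrite (le_trans p1) ?ltW.
Qed.

(** [H_r] is convex on the whole half-line, so that the interval of concavity
    is empty and the threshold is [y_c]. *)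
Lemma convexity_threshold_y_c c : 0 < c -> 0 < curvature c 0 -> x_c delta c < f0 ->
  unique (convexity_threshold alpha delta lambda c) (y_c c).
Proof.
move=> c0 Q0 xf.
have yc1 : 1 <= y_c c.
  rewrite -(Psi0 alpha) Psi_le// /x_c addr_ge0 ?invr_ge0 ?mulr_ge0 ?(ltW de0) ?invr_ge0//.
  exact: ltW.
have ycf : y_c c < y_hat3 alpha delta lambda c.
  by rewrite Psi_lt// (lt_trans xf)// ltrDl.
split=> [|y [/andP[ycy _] _ concave]]; first split.
- by rewrite lexx.
- exact: H_r_strictly_convex.
- move=> s t u; rewrite /= !in_itv/= => /andP[h1 h2].
  by have := lt_trans h1 h2; rewrite ltxx.
apply/eqP; rewrite eq_le ycy /= leNgt; apply/negP => lt_y.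
pose s := (2 * y_c c + y) / 3; pose t := (y_c c + 2 * y) / 3.
have [sy ty] : (y_c c < s < y) /\ (y_c c < t < y).
  by rewrite /s /t; split; apply/andP; split; lra.
have st : s != t by rewrite lt_eqF// /s /t; lra.
have := concave s t 2^-1; rewrite /= !in_itv/= sy ty => /(_ isT isT st).
have := H_r_strictly_convex c0 Q0 yc1 (x := s) (y := t) (t := 2^-1).
rewrite /= !in_itv/= !andbT (andP sy).1 (andP ty).1 => /(_ isT isT st).
have [h1 h2] : (0 : R) < 2^-1 /\ (2^-1 : R) < 1 by split; lra.
by move=> /(_ h1 h2) + /(_ h1 h2); lra.
Qed.

Lemma tangency_coupleE c yv z1 z2 : 0 < c -> x_c delta c < f0 ->
  tangency_couple alpha delta lambda c yv z1 z2 <->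
  [/\ 1 < z1, z1 < y_c c, y_c c <= yv, yv < z2 &
     dH_r 0 z1 = dH_r c z2 /\ Hr 0 z1 - dH_r 0 z1 * z1 = Hr c z2 - dH_r c z2 * z2].
Proof.
move=> c0 xf.
have sys : 1 < z1 -> z1 < y_c c -> y_c c <= yv -> yv < z2 ->
    tangency_system alpha delta lambda c z1 z2 <->
    dH_r 0 z1 = dH_r c z2 /\ Hr 0 z1 - dH_r 0 z1 * z1 = Hr c z2 - dH_r c z2 * z2.
  move=> z11 z1c yvc yvz.
  have zf : z1 < Psi f0 by rewrite (lt_trans z1c)// Psi_lt.
  have z20 : 0 < z2 by rewrite (lt_trans _ yvz)// (lt_le_trans _ yvc)// Psi_gt0.
  rewrite /tangency_system (is_derive_derive1 (is_derive_H_l (lt_trans ltr01 z11) zf)).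
  by rewrite (is_derive_derive1 (is_derive_H_r c z20)) H_r0_left// ltW.
by split=> -[h1 h2 h3 h4 h5]; split=> //; apply/(sys h1 h2 h3 h4).
Qed.

Lemma y_c_gt1 c : 0 < c -> 1 < y_c c.
Proof.
move=> c0; rewrite -(Psi0 alpha) Psi_lt// /x_c addr_gt0 ?invr_gt0 ?mulr_gt0//.
Qed.

(** [bitangent_exists] at the junction [y_c], where the obstacles cross and the
    slope drops from that of [H_l] to that of [H_r]. *)
Lemma tangency_couple_exists c : 0 < c -> 0 < curvature c 0 -> x_c delta c < f0 ->
  slope_r 0 0 < slope_r c (x_c delta c) -> slope_r 0 (x_c delta c) < slope_r c (f0 + c) ->
  exists y1 y2, tangency_couple alpha delta lambda c (y_c c) y1 y2.
Proof.
move=> c0 Q0 xf slope1 slope2.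
have yc1 := y_c_gt1 c0; have yc0 : 0 < y_c c by exact: Psi_gt0.
have ycr : y_c c < Psi (f0 + c) by rewrite Psi_lt// (lt_trans xf)// ltrDl.
have dPsi e x : dH_r e (Psi x) = slope_r e x by rewrite /dH_r PsiK.
have Q00 := curvature0 alpha lambda de0.
have [||||||||u [v [/andP[u1 uq] /andP[qv _] e1 e2]]] :=
  @bitangent_exists R (Hr 0) (dH_r 0) (Hr c) (dH_r c) 1 (y_c c) (Psi (f0 + c)) yc1 ycr.
- by move=> t /andP[t1 _]; apply: is_derive_H_r; exact: lt_le_trans ltr01 t1.
- by move=> t /andP[t1 _]; apply: is_derive_H_r; exact: lt_le_trans yc0 t1.
- move=> s t s1 st _; apply: dH_r_le; rewrite ?in_itv/= ?andbT//; exact: le_trans s1 st.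
- move=> s t s1 st _; have s1' := le_trans (ltW yc1) s1.
  by apply: dH_r_le; rewrite ?in_itv/= ?andbT ?(ltW c0)//; exact: le_trans s1' st.
- rewrite /H_r !transform_Psi//; congr (_ * _).
  rewrite /h_r addr0 !ifT; last 2 first.
  + by rewrite (le_trans (ltW xf))// lerDl ltW.
  + exact: ltW.
  by rewrite /h_r1 /x_c; field; rewrite !gt_eqF.
- rewrite !dPsi slope_r_xc ?(ltW xf) ?(ltW c0)// gtrBl mulr_gt0 ?expR_gt0//.
  by rewrite divr_gt0 ?mulr_gt0 ?beta_gt0.
- by rewrite -[in X in dH_r 0 X](Psi0 alpha) !dPsi.
- by rewrite !dPsi.
by exists u, v; apply/tangency_coupleE.
Qed.

Lemma tangency_couple_unique c y1 y2 z1 z2 :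
  0 < c -> 0 < curvature c 0 -> x_c delta c < f0 ->
  tangency_couple alpha delta lambda c (y_c c) y1 y2 ->
  tangency_couple alpha delta lambda c (y_c c) z1 z2 -> z1 = y1 /\ z2 = y2.
Proof.
move=> c0 Q0 xf /(tangency_coupleE _ _ _ c0 xf) [y11 y1c _ cy2 [e1 e2]].
move=> /(tangency_coupleE _ _ _ c0 xf) [z11 z1c _ cz2 [e1' e2']].
have yc1 := y_c_gt1 c0; have yc0 : 0 < y_c c by exact: Psi_gt0.
apply: (@bitangent_unique R (Hr 0) (dH_r 0) (Hr c) (dH_r c) `[1, y_c c[ `]y_c c, +oo[);
  rewrite ?in_itv/= ?andbT ?z1c ?y1c ?ltW//.
- move=> t; rewrite in_itv/= => /andP[t1 _]; apply: is_derive_H_r; exact: lt_le_trans ltr01 t1.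
- by move=> t; rewrite in_itv/= andbT => ct; apply: is_derive_H_r; exact: lt_trans yc0 ct.
- move=> s t; rewrite !in_itv/= => /andP[s1 sc] /andP[t1 tc].
  have ycf : y_c c < Psi f0 by rewrite Psi_lt.
  by apply: dH_r0_lt; rewrite in_itv/= ?s1 ?t1 ltW// (lt_trans _ ycf).
- move=> s t; rewrite !in_itv/= !andbT => cs ct.
  by apply: dH_r_lt => //; rewrite in_itv/= andbT (le_trans (ltW yc1))// ltW.
- by move=> s t; rewrite !in_itv/= andbT => /andP[_ sc] ct; exact: lt_trans sc ct.
Qed.

End tangency.

Section minorant_of_obstacle.
Context {R : realType}.
Variables (alpha delta lambda c y1 y2 : R).
Hypotheses (al0 : 0 < alpha) (de0 : 0 < delta) (la0 : 0 < lambda)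
  (lad : lambda < alpha * delta)
  (f0_gt : alpha / (2 * lambda) < f0 alpha delta lambda).
Implicit Types (x y s t : R).

Notation f0 := (f0 alpha delta lambda).
Notation Hr := (H_r alpha delta lambda).
Notation Hl := (H_l alpha delta lambda).
Notation H := (H alpha delta lambda c).
Notation slope_r := (slope_r alpha delta lambda).
Notation curvature := (curvature alpha delta lambda).
Notation y_c := (y_c alpha delta c).
Notation Psi := (Psi alpha).
Notation Psi_inv := (Psi_inv alpha).
Notation dH_r := (dH_r alpha delta lambda).
Notation W := (W_piecewise alpha delta lambda c y1 y2).
Notation A := (slope_A alpha delta lambda y1).
Notation B := (intercept_B alpha delta lambda y1).

Hypotheses (c0 : 0 < c) (Q0 : 0 < curvature c 0) (xf : x_c delta c < f0).
Hypothesis couple : tangency_couple alpha delta lambda c y_c y1 y2.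

Let y1_gt1 : 1 < y1. Proof. by case: couple. Qed.
Let y1c : y1 < y_c. Proof. by case: couple. Qed.
Let cy2 : y_c < y2. Proof. by case: couple. Qed.
Let y1f : y1 < Psi f0. Proof. by rewrite (lt_trans y1c)// Psi_lt. Qed.
Let y12 : y1 < y2 := lt_trans y1c cy2.
Let Q00 : 0 < curvature 0 0 := curvature0 alpha lambda de0.

Lemma tangency_AB : [/\ A = dH_r 0 y1, A = dH_r c y2, B = Hr 0 y1 - A * y1 &
  B = Hr c y2 - A * y2].
Proof.
have [_ _ _ _ [e1 e2]] :=
  (tangency_coupleE al0 de0 la0 lad f0_gt y_c y1 y2 c0 xf).1 couple.
have eA : A = dH_r 0 y1.
  by apply: is_derive_derive1; apply: is_derive_H_l => //; exact: lt_trans ltr01 y1_gt1.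
have eB : B = Hr 0 y1 - A * y1 by rewrite /intercept_B H_r0_left// ltW.
by split=> //; [rewrite eA e1|rewrite eB eA e2 e1].
Qed.

Definition slope_W := glue y1 (dH_r 0) (glue y2 (cst A) (dH_r c)).

Lemma W_glue : W = glue y1 (Hr 0) (glue y2 (fun t => A * t + B) (Hr c)).
Proof.
have [eA1 eA2 eB1 eB2] := tangency_AB.
apply/funext => y; rewrite /W_piecewise /glue; case: ifP => [yy1|_].
  by rewrite H_r0_left// (le_trans yy1)// ltW.
rewrite le_eqVlt; case: eqVneq => [->|_] //=.
by rewrite ltxx eB2 addrC subrK.
Qed.

Let W_derivative : (forall t, 1 <= t -> is_derive t 1 W (slope_W t)) /\
  {in `[1, +oo[ &, {homo slope_W : s t / s <= t}}.
Proof.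
have [eA1 eA2 eB1 eB2] := tangency_AB.
rewrite W_glue /slope_W eB1 eA1; have yc1 := y_c_gt1 al0 de0 c0.
apply: (@bitangent_glue R (Hr 0) (dH_r 0) (Hr c) (dH_r c) 1 y_c) => //.
- exact: ltW.
- move=> t /andP[t1 _]; apply: is_derive_H_r => //; exact: lt_le_trans ltr01 t1.
- move=> t ct; apply: is_derive_H_r => //; apply: lt_le_trans ct; exact: Psi_gt0.
- move=> s t s1 st _; apply: dH_r_le; rewrite ?in_itv/= ?andbT//; exact: le_trans s1 st.
- move=> s t s1 st; have s1' := le_trans (ltW yc1) s1.
  by apply: dH_r_le; rewrite ?in_itv/= ?andbT ?(ltW c0)//; exact: le_trans s1' st.
- by rewrite -eA1.
- by rewrite -eA1 -eA2 -eB1 -eB2.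
Qed.

Lemma is_derive_W t : 1 <= t -> is_derive t 1 W (slope_W t). Proof. exact: W_derivative.1. Qed.

Lemma slope_W_homo : {in `[1, +oo[ &, {homo slope_W : s t / s <= t}}. Proof. exact: W_derivative.2. Qed.

Lemma slope_W_continuous t : 1 <= t -> {for t, continuous slope_W}.
Proof.
have [eA1 eA2 _ _] := tangency_AB.
move=> t1; have t0 : 0 < t := lt_le_trans ltr01 t1.
apply: glue_continuous; first by rewrite glue_le//= ltW.
  by move=> _; exact: dH_r_continuous.
move=> _; apply: glue_continuous => // _; first exact: cvg_cst.
exact: dH_r_continuous.
Qed.

Lemma W1 : W 1 = - (lambda / alpha ^+ 2).
Proof.
rewrite /W_piecewise (ltW y1_gt1) /H_l /transform Psi_inv1 mulr0 expR0 mul1r /h_l.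
by rewrite [0 ^+ 2]expr2 !mulr0 sub0r.
Qed.

(** At [x = 0] the even function [h_l] has no slope, so that the slope and the
    intercept of the tangent at [y = 1] are equal. *)
Lemma slope_W1 : 2 * slope_W 1 = W 1.
Proof.
rewrite /slope_W glue_le ?ltW// /Defs.Psi_inv /dH_r Psi_inv1 slope_r00// W1.
rewrite /h_r addr0 (ltW (f0_gt0 _ _ _))//.
by rewrite /h_r1 expr2 !mulr0 !mul0r !addr0 add0r mulrCA divff ?mulr1// pnatr_eq0.
Qed.

Lemma slope_W_le0 t : 1 <= t -> slope_W t <= 0.
Proof.
move=> t1; have y21 : 1 <= y2 := ltW (lt_trans y1_gt1 y12).
apply: (@le_trans _ _ (slope_W (Num.max t y2))).
  by apply: slope_W_homo; rewrite ?in_itv/= ?le_max ?t1 ?lexx.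
have [eA1 eA2 _ _] := tangency_AB.
have ty2 : y2 <= Num.max t y2 by rewrite le_max lexx orbT.
rewrite /slope_W glue_ge ?(le_trans (ltW y12))//; last by rewrite glue_le// ltW.
rewrite glue_ge//; apply: slope_r_le0 => //; first exact: ltW.
by apply: Psi_inv_ge0 => //; rewrite le_max t1.
Qed.

Lemma W_tangent y z : 1 <= y -> 1 <= z -> W y + slope_W y * (z - y) <= W z.
Proof.
move=> y1' z1'; apply: (tangent_le (i := `[1, +oo[)); rewrite ?in_itv/= ?y1' ?z1'//.
  by move=> t; rewrite in_itv/= andbT; exact: is_derive_W.
exact: slope_W_homo.
Qed.

(** [W] is nonincreasing, from a negative value at [1]. *)
Lemma W_lt0 y : 1 <= y -> W y < 0.
Proof.
move=> y1'; have W10 : W 1 < 0 by rewrite W1 oppr_lt0 divr_gt0// exprn_gt0.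
apply: le_lt_trans W10; have := W_tangent y1' (lexx 1).
have : slope_W y * (y - 1) <= 0 by rewrite mulr_le0_ge0 ?slope_W_le0// subr_ge0.
by rewrite -[1 - y]opprB mulrN; lra.
Qed.

Lemma W_ge1 y : y <= y1 -> W y = Hl y.
Proof. by move=> h; rewrite /W_piecewise h. Qed.

Lemma W_line y : y1 <= y -> y <= y2 -> W y = A * y + B.
Proof.
have [eA1 eA2 eB1 eB2] := tangency_AB.
move=> h1 h2; rewrite W_glue glue_ge ?glue_le//; last exact: ltW.
by rewrite eB1 addrC subrK.
Qed.

Lemma W_ge2 y : y2 <= y -> W y = Hr c y.
Proof.
move=> h; rewrite /W_piecewise [y <= y1]leNgt (lt_le_trans y12 h)/=.
by rewrite ltNge h.
Qed.

Let HE y : H y = Num.min (Hl y) (Hr c y).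
Proof.
rewrite /Defs.H /H_l /H_r /transform /h.
by rewrite minr_pMr ?expR_ge0.
Qed.

Let transform_le k k' y : k (Psi_inv y) <= k' (Psi_inv y) ->
  transform alpha k y <= transform alpha k' y.
Proof. by move=> h; rewrite ler_pM2l ?expR_gt0. Qed.

Let H_left y : 0 < y -> y <= y_c -> Hl y <= Hr c y.
Proof.
move=> y0 yc; apply: transform_le; apply: h_l_le_h_r => //; first exact: ltW.
  by rewrite (le_trans (ltW xf))// lerDl ltW.
by rewrite -(Psi_le al0) Psi_invK.
Qed.

Let H_right y : y_c <= y -> Hr c y <= Hl y.
Proof.
move=> yc; apply: transform_le; apply: h_r_le_h_l => //; first exact: ltW.
  exact: x_0_lt_f0.
by rewrite -(Psi_le al0) Psi_invK// posrE (lt_le_trans _ yc)// Psi_gt0.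
Qed.

(** The line is tangent to the two convex functions [H_r 0] and [H_r c], and
    [H_r 0] is below [H_l]. *)
Lemma line_le_H y : 1 <= y -> A * y + B <= H y.
Proof.
have [eA1 eA2 eB1 eB2] := tangency_AB.
move=> y1'; rewrite HE le_min; apply/andP; split.
  apply: (@le_trans _ _ (Hr 0 y)).
    have := tangent_le (i := `[1, +oo[) (y := y1) (z := y) (f := Hr 0) (g := dH_r 0).
    rewrite !in_itv/= y1' (ltW y1_gt1) => /(_ _ _ isT isT); rewrite eB1 -eA1 mulrBr.
    rewrite (_ : A * y + (Hr 0 y1 - A * y1) = Hr 0 y1 + (A * y - A * y1)); last by ring.
    apply => [t|]; last exact: dH_r_le.
    by rewrite in_itv/= andbT => t1; apply: is_derive_H_r => //; exact: lt_le_trans ltr01 t1.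
  have [yf|fy] := leP y (Psi f0); first by rewrite H_r0_left.
  apply: transform_le; apply: h_r_le_h_l => //; first exact: x_0_lt_f0.
  have x0f : (2 * delta)^-1 < f0 by exact: x_0_lt_f0.
  rewrite /x_c mul0r addr0 (le_trans (ltW x0f))//.
  by rewrite -(Psi_le al0) Psi_invK ?posrE ?(ltW fy)// (lt_le_trans ltr01).
have := tangent_le (i := `[1, +oo[) (y := y2) (z := y) (f := Hr c) (g := dH_r c).
rewrite !in_itv/= y1' (ltW (lt_trans y1_gt1 y12)) => /(_ _ _ isT isT); rewrite eB2 -eA2 mulrBr.
rewrite (_ : A * y + (Hr c y2 - A * y2) = Hr c y2 + (A * y - A * y2)); last by ring.
apply => [t|]; last by apply: dH_r_le => //; exact: ltW.
by rewrite in_itv/= andbT => t1; apply: is_derive_H_r => //; exact: lt_le_trans ltr01 t1.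
Qed.

Lemma W_eq_left y : 1 <= y -> y <= y1 -> W y = H y.
Proof.
move=> y1' h; rewrite W_ge1// HE (min_idPl _)// H_left ?(lt_le_trans ltr01)//.
exact: le_trans h (ltW y1c).
Qed.

Lemma W_eq_right y : y2 <= y -> W y = H y.
Proof.
by move=> h; rewrite W_ge2// HE (min_idPr _)// H_right// (le_trans (ltW cy2)).
Qed.

Lemma W_le_H y : 1 <= y -> W y <= H y.
Proof.
move=> y1'; have [h|/ltW h] := leP y y1; first by rewrite W_eq_left.
have [h'|/ltW h'] := leP y y2; first by rewrite W_line// line_le_H.
by rewrite W_eq_right.
Qed.

Lemma W_greatest_minorant : greatest_nonpositive_convex_minorant `[1, +oo[ H W.
Proof.
apply: (@greatest_minorant_gap R H W 1 y1 y2 A B) => //.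
- exact: ltW.
- apply/convex_functionE => y z t; rewrite /= => yi zi t0 t1.
  apply: (chord_le (g := slope_W) (i := `[1, +oo[)) => //; last exact: slope_W_homo.
  by move=> s; rewrite in_itv/= andbT; exact: is_derive_W.
- by move=> y y1'; split; [exact/ltW/W_lt0|exact: W_le_H].
- exact: W_eq_left.
- exact: W_eq_right.
- exact: W_line.
Qed.

Lemma W_C1 : C1_from 1 W.
Proof. exact: C1_from_derive is_derive_W slope_W_continuous. Qed.

End minorant_of_obstacle.

(** * Value functions *)

Section value_below_minorant.
Context {R : realType} d (Omega : measurableType d) (P : probability Omega R).
Variables (Filt : R -> set (set Omega)) (B : R -> Omega -> R).
Hypotheses (Fus : usual_filtration P Filt) (Bbm : brownian_motion P Filt B).
Variables (alpha lambda : R).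
Hypotheses (al0 : 0 < alpha) (la0 : 0 < lambda).
Variable g : R -> \bar R.
Hypotheses (mg : measurable_fun setT g) (g0 : forall z, (0 <= g z)%E).

Notation beta := (Num.sqrt (2 * alpha)).
Notation p := (perpetual_cost alpha lambda).
Notation value := (stopping_value P Filt B alpha lambda g).
Notation Psi := (Psi alpha).

Let beta0 : 0 < beta := beta_gt0 al0.

(** A tangent of [U] at [Psi x], read as the combination
    [a * expR (beta * z) + b * expR (- beta * z)] of the two exponential
    martingales, stays below the transformed gain; for [z < 0] this needs
    [b <= a], which is where the value of the slope at [1] enters. *)
Lemma stopping_value_ge_convex (U dU : R -> R) :
  (forall y z, 1 <= y -> 1 <= z -> U y + dU y * (z - y) <= U z) ->
  (forall y, 1 <= y -> dU y <= 0) -> (forall y, 1 <= y -> dU 1 <= dU y) ->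
  2 * dU 1 = U 1 ->
  (forall z, ((p z + expR (- (beta * `|z|)) * U (Psi `|z|))%:E <= g z)%E) ->
  forall x, ((p x + expR (- (beta * `|x|)) * U (Psi `|x|))%:E <= value x)%E.
Proof.
move=> tangent dU0 dU1 U1 Ug x.
have Psi_ge1 (z : R) : 1 <= Psi `|z| by rewrite -(Psi0 alpha) Psi_le.
pose y := Psi `|x|; pose a := dU y; pose b := U y - dU y * y.
have a0 : a <= 0 by exact: dU0 (Psi_ge1 x).
have ba : b <= a.
  have := tangent y 1 (Psi_ge1 x) (lexx 1); have := dU1 y (Psi_ge1 x).
  by rewrite mulrBr mulr1 -U1 /a /b; lra.
have PsiE z : Psi z = expR (beta * z) * expR (beta * z).
  by rewrite -expRD; congr expR; ring.
have expE (z : R) : expR (- (beta * `|z|)) * (a * Psi `|z| + b) =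
    a * expR (beta * `|z|) + b * expR (- (beta * `|z|)).
  by rewrite PsiE expRN; field; rewrite gt_eqF ?expR_gt0.
have le_abs (z : R) : a * expR (beta * `|z|) + b * expR (- (beta * `|z|)) <=
    expR (- (beta * `|z|)) * U (Psi `|z|).
  rewrite -expE ler_pM2l ?expR_gt0//.
  by have := tangent y (Psi `|z|) (Psi_ge1 x) (Psi_ge1 z); rewrite /a /b mulrBr; lra.
have le_swap (z : R) : b * expR (beta * `|z|) + a * expR (- (beta * `|z|)) <=
    expR (- (beta * `|z|)) * U (Psi `|z|).
  apply: le_trans (le_abs z).
  have : 0 <= (a - b) * (expR (beta * `|z|) - expR (- (beta * `|z|))).
    rewrite mulr_ge0 ?subr_ge0// ler_expR -subr_ge0 opprK addr_ge0// mulr_ge0// ltW//.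
  lra.
have le_any a' b' z : (a', b') = (a, b) \/ (a', b') = (b, a) ->
    ((p z)%:E <= g z + (- a' * expR (beta * z) + - b' * expR (- beta * z))%:E)%E.
  move=> ab; apply: (@le_trans _ _
      ((p z + expR (- (beta * `|z|)) * U (Psi `|z|))%:E +
       (- a' * expR (beta * z) + - b' * expR (- beta * z))%:E)%E); last exact: leeD2r.
  rewrite -EFinD lee_fin (mulNr beta); have := le_abs z; have := le_swap z.
  by case: ab => -[-> ->]; have [_|_] := ger0P z; rewrite ?mulrN ?opprK; lra.
have line_y : a * y + b = U y by rewrite /b /a addrC subrK.
have ex := expE x; rewrite -/y line_y in ex; rewrite -/y ex.
have [x0|x0] := ger0P x.
  have := @stopping_value_ge _ _ _ _ _ _ Fus Bbm _ _ al0 la0 _ mg g0 x (- a) (- b).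
  rewrite !oppr_ge0 => /(_ a0 (le_trans ba a0)) H.
  apply: le_trans (H _) => [|z]; last by apply: le_any; left.
  by rewrite lee_fin (mulNr beta) lerD2l; lra.
have := @stopping_value_ge _ _ _ _ _ _ Fus Bbm _ _ al0 la0 _ mg g0 x (- b) (- a).
rewrite !oppr_ge0 => /(_ (le_trans ba a0) a0) H.
apply: le_trans (H _) => [|z]; last by apply: le_any; right.
by rewrite lee_fin (mulNr beta) !mulrN opprK lerD2l; lra.
Qed.

End value_below_minorant.

Lemma derive_continuous {R : realType} (f df : R -> R) :
  (forall t : R, is_derive t 1 f (df t)) -> continuous f.
Proof. by move=> fdf t; exact: is_derive_continuous (fdf t). Qed.

Section value_functions.
Context {R : realType} d (Omega : measurableType d) (P : probability Omega R).
Variables (Filt : R -> set (set Omega)) (Wt : R -> Omega -> R).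
Hypotheses (Fus : usual_filtration P Filt) (Wbm : brownian_motion P Filt Wt).
Variables (alpha delta lambda : R).
Hypotheses (al0 : 0 < alpha) (de0 : 0 < delta) (la0 : 0 < lambda)
  (lad : lambda < alpha * delta)
  (f0_gt : alpha / (2 * lambda) < f0 alpha delta lambda).
Implicit Types (x y z c : R).

Notation beta := (Num.sqrt (2 * alpha)).
Notation f0 := (f0 alpha delta lambda).
Notation B0 := (B0 alpha delta lambda).
Notation kappa := (delta - lambda / alpha).
Notation p := (perpetual_cost alpha lambda).
Notation Psi := (Psi alpha).
Notation hl := (h_l alpha delta lambda).
Notation hr := (h_r alpha delta lambda).
Notation Hr := (H_r alpha delta lambda).
Notation V0 := (V0 P Filt Wt alpha lambda delta).

Let beta0 : 0 < beta := beta_gt0 al0.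
Let f0_pos : 0 < f0 := f0_gt0 al0 la0 f0_gt.
Let x0f : (2 * delta)^-1 < f0 := x_0_lt_f0 de0 la0 lad f0_gt.

Definition value_V0 z := p z + hr 0 `|z|.

Lemma perpetual_cost_h_l z : p z + hl z = delta * z ^+ 2.
Proof. by rewrite /perpetual_cost /h_l; ring. Qed.

Lemma perpetual_cost_abs z : p `|z| = p z.
Proof. by rewrite /perpetual_cost real_normK ?num_real. Qed.

Lemma h_l_abs z : hl `|z| = hl z.
Proof. by rewrite /h_l real_normK ?num_real. Qed.

Lemma continuous_square : continuous (fun z => delta * z ^+ 2).
Proof.
apply: (@derive_continuous _ _ (fun z => 2 * delta * z)) => t.
by apply: is_derive_eq; rewrite /GRing.scale /=; ring.
Qed.

Lemma continuous_EFin_measurable (f : R -> R) : continuous f ->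
  measurable_fun setT (fun z => (f z)%:E).
Proof. by move=> cf; apply/measurable_EFinP; exact: continuous_measurable_fun. Qed.

Lemma expR_h_r0 z : expR (- (beta * z)) * Hr 0 (Psi z) = hr 0 z.
Proof. by rewrite /H_r transform_Psi// mulrA -expRD addNr expR0 mul1r. Qed.

Lemma h_r_le0_h_l z : 0 <= z -> hr 0 z <= hl z.
Proof.
move=> z0; have [zf|fz] := leP z f0; first by rewrite h_r0_left.
apply: h_r_le_h_l => //; rewrite /x_c mul0r addr0.
exact: le_trans (ltW x0f) (ltW fz).
Qed.

Lemma B0_boundary : p f0 + B0 * expR (- (beta * f0)) = delta * f0 ^+ 2.
Proof.
rewrite -perpetual_cost_h_l [beta * f0]mulrC B0_f0// /h_l -(f0_root al0 de0 la0 lad).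
by congr (_ + _); field; rewrite !gt_eqF.
Qed.

Lemma v0_right x : f0 < `|x| -> value_V0 x = p x + B0 * expR (- (beta * `|x|)).
Proof.
move=> fx; rewrite /value_V0 /h_r addr0 leNgt fx /= /h_r2 subr0 [_ * beta]mulrC.
by congr (_ + _); ring.
Qed.

(** The transform of the value is [H_r 0]: its convexity gives the lower bound. The
    upper bound comes from stopping at once when [`|x| <= f0], and otherwise from
    stopping at the first passage to [f0] or [- f0]. *)
Lemma V0E x : V0 x = (value_V0 x)%:E.
Proof.
have msq := continuous_EFin_measurable continuous_square.
have sq0 z : (0 <= (delta * z ^+ 2)%:E)%E by rewrite lee_fin mulr_ge0 ?sqr_ge0 ?ltW.
have value_le := stopping_value_le_first_zero Fus Wbm al0 la0 msq sq0.
have NB0 : 0 <= - B0 by rewrite oppr_ge0; exact/ltW/(B0_lt0 al0 la0 lad f0_gt).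
apply/eqP; rewrite eq_le; apply/andP; split; last first.
  have Q00 := curvature0 alpha lambda de0.
  have mono := dH_r_le al0 de0 la0 lad f0_gt (lexx 0) Q00.
  have gain_ge z : ((p z + expR (- (beta * `|z|)) * Hr 0 (Psi `|z|))%:E <=
      (delta * z ^+ 2)%:E)%E.
    by rewrite lee_fin expR_h_r0 -perpetual_cost_h_l lerD2l -h_l_abs h_r_le0_h_l.
  rewrite /value_V0 -expR_h_r0; apply: (stopping_value_ge_convex Fus Wbm al0 la0 msq sq0 _ _ _ _ gain_ge
    (dU := dH_r alpha delta lambda 0)).
  - move=> y z y1 z1; apply: (tangent_le (i := `[1, +oo[)); rewrite ?in_itv/= ?y1 ?z1//.
    move=> t; rewrite in_itv/= andbT => t1; apply: is_derive_H_r => //.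
    exact: lt_le_trans ltr01 t1.
  - by move=> y y1; apply: slope_r_le0 => //; exact: Psi_inv_ge0.
  - by move=> y y1; apply: mono; rewrite ?in_itv/= ?lexx ?y1.
  - rewrite /dH_r Psi_inv1 slope_r00// /H_r /transform Psi_inv1 mulr0 expR0 mul1r.
    by rewrite mulrC divfK// pnatr_eq0.
have [xf|fx] := leP `|x| f0.
  rewrite /value_V0 h_r0_left// h_l_abs perpetual_cost_h_l.
  exact: (stopping_value_le_now Fus Wbm alpha la0 msq sq0 x).
rewrite v0_right//; have [x0|x0] := leP 0 x.
  rewrite ger0_norm// in fx *.
  have -> : B0 * expR (- (beta * x)) = - (0 * expR (beta * x) + - B0 * expR (- beta * x)).
    by rewrite mul0r add0r mulNr opprK mulNr.
  apply: (value_le (fun z => z - f0)) => //.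
  - apply: (@derive_continuous _ _ (fun=> 1)) => t.
    by apply: is_derive_eq; rewrite subr0.
  - by rewrite subr_gt0.
  - move=> z /eqP; rewrite subr_eq0 => /eqP ->.
    by rewrite -EFinD lee_fin mul0r add0r mulNr mulNr -B0_boundary addrK.
  - by rewrite eqxx.
  - move=> _; exists 1 => z; rewrite subr_gt0 => fz.
    by rewrite -[leRHS]expR0 ler_expR mulNr oppr_le0 mulr_ge0 ?ltW// (lt_trans f0_pos).
rewrite ltr0_norm// in fx *.
have -> : B0 * expR (- (beta * - x)) = - (- B0 * expR (beta * x) + 0 * expR (- beta * x)).
  by rewrite mul0r addr0 mulNr opprK mulrN opprK.
apply: (value_le (fun z => - f0 - z)) => //.
- apply: (@derive_continuous _ _ (fun=> -1)) => t.
  by apply: is_derive_eq; rewrite /GRing.scale /=; ring.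
- by rewrite subr_gt0 ltrNr.
- move=> z /eqP; rewrite subr_eq0 => /eqP <-.
  rewrite -EFinD lee_fin mul0r addr0 mulNr mulrN.
  have -> : p (- f0) = p f0 by rewrite /perpetual_cost sqrrN.
  by rewrite sqrrN -B0_boundary addrK.
- move=> _; exists 1 => z; rewrite subr_gt0 => fz.
  rewrite -[leRHS]expR0 ler_expR mulr_ge0_le0 ?ltW//.
  by rewrite (lt_trans fz)// oppr_lt0.
- by rewrite eqxx.
Qed.

End value_functions.

Section value_with_switch.
Context {R : realType} d (Omega : measurableType d) (P : probability Omega R).
Variables (Filt : R -> set (set Omega)) (Wt : R -> Omega -> R).
Hypotheses (Fus : usual_filtration P Filt) (Wbm : brownian_motion P Filt Wt).
Variables (alpha delta lambda c y1 y2 : R).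
Hypotheses (al0 : 0 < alpha) (de0 : 0 < delta) (la0 : 0 < lambda)
  (lad : lambda < alpha * delta)
  (f0_gt : alpha / (2 * lambda) < f0 alpha delta lambda).
Implicit Types (x y z : R).

Notation beta := (Num.sqrt (2 * alpha)).
Notation f0 := (f0 alpha delta lambda).
Notation B0 := (B0 alpha delta lambda).
Notation p := (perpetual_cost alpha lambda).
Notation Psi := (Psi alpha).
Notation Psi_inv := (Psi_inv alpha).
Notation hl := (h_l alpha delta lambda).
Notation hr := (h_r alpha delta lambda).
Notation v0 := (value_V0 alpha delta lambda).
Notation curvature := (curvature alpha delta lambda).
Notation y_c := (y_c alpha delta c).
Notation W := (W_piecewise alpha delta lambda c y1 y2).
Notation dW := (slope_W alpha delta lambda c y1 y2).
Notation A := (slope_A alpha delta lambda y1).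
Notation B := (intercept_B alpha delta lambda y1).
Notation V0 := (V0 P Filt Wt alpha lambda delta).
Notation V := (V P Filt Wt alpha lambda delta c).

Hypotheses (c0 : 0 < c) (Q0 : 0 < curvature c 0) (xf : x_c delta c < f0) (cf : c < f0).
Hypothesis couple : tangency_couple alpha delta lambda c y_c y1 y2.

Let beta0 : 0 < beta := beta_gt0 al0.
Let f0_pos : 0 < f0 := f0_gt0 al0 la0 f0_gt.
Let y1_gt1 : 1 < y1. Proof. by case: couple. Qed.
Let y12 : y1 < y2. Proof. by case: couple => _ h1 _ h2 _; exact: lt_trans h1 h2. Qed.
Let y1_gt0 : 0 < y1 := lt_trans ltr01 y1_gt1.
Let y2_gt0 : 0 < y2 := lt_trans y1_gt0 y12.
Let F := Psi_inv y1.
Let G := Psi_inv y2.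
Let F0 : 0 < F. Proof. by rewrite -(Psi_lt al0) Psi0 Psi_invK. Qed.
Let FG : F < G. Proof. by rewrite -(Psi_lt al0) !Psi_invK. Qed.
Let PsiF : Psi F = y1. Proof. by rewrite Psi_invK. Qed.
Let PsiG : Psi G = y2. Proof. by rewrite Psi_invK. Qed.

Lemma v0N z : v0 (- z) = v0 z.
Proof. by rewrite /value_V0 normrN /perpetual_cost sqrrN. Qed.

Lemma v0_left z : `|z| <= f0 -> v0 z = delta * z ^+ 2.
Proof. by move=> zf; rewrite /value_V0 h_r0_left// h_l_abs perpetual_cost_h_l. Qed.

Lemma is_derive_cost_h_r z : is_derive z 1 (fun x => p x + hr 0 x)
  (2 * (lambda / alpha) * z + dh_r alpha delta lambda 0 z).
Proof.
have dp : is_derive z 1 p (2 * (lambda / alpha) * z).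
  by rewrite /perpetual_cost; apply: is_derive_eq; rewrite /GRing.scale /=; ring.
by apply: is_deriveD => //; exact: is_derive_h_r.
Qed.

Lemma v0_homo : {in `[0, +oo[ &, {homo v0 : s t / s <= t}}.
Proof.
pose w := fun z => p z + hr 0 z.
have v0w z : 0 <= z -> v0 z = w z by move=> z0; rewrite /value_V0 ger0_norm.
move=> s t si ti st; move: (si) (ti); rewrite !in_itv/= !andbT => s0 t0; rewrite !v0w//.
have la : 0 < lambda / alpha by exact: divr_gt0.
apply: (derive_ge0_homo (fun z _ => is_derive_cost_h_r z) _ si ti st) => // z; rewrite in_itv/= andbT => z0.
have lz : 0 <= 2 * (lambda / alpha) * z by rewrite mulr_ge0// mulr_ge0// ltW.
rewrite /dh_r /glue addr0; case: ifP => zf.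
  rewrite /dh_r1 mulr0 subr0; have := mulr_ge0 (ltW de0) z0; lra.
rewrite /dh_r2 mulr0 mul0r oppr0 add0r addr_ge0// -mulNr mulr_ge0 ?expR_ge0//.
have := B0_lt0 al0 la0 lad f0_gt; rewrite oppr_ge0 => b; exact: mulr_ge0_le0 (ltW beta0) (ltW b).
Qed.

Lemma v0_ge0 z : 0 <= v0 z.
Proof.
suff h x : 0 <= x -> 0 <= v0 x.
  by have [/h//|/ltW z0] := leP 0 z; rewrite -v0N h// oppr_ge0.
move=> x0; apply: (@le_trans _ _ (v0 0)).
  by rewrite v0_left ?normr0 ?(ltW f0_pos)// expr0n mulr0.
by apply: v0_homo; rewrite ?in_itv/= ?lexx ?x0.
Qed.

Lemma v0_continuous : continuous v0.
Proof.
have -> : v0 = (fun x => p x + hr 0 x) \o Num.norm.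
  by apply/funext => z; rewrite /= perpetual_cost_abs.
move=> z; apply: continuous_comp; first exact: norm_continuous.
exact: is_derive_continuous (is_derive_cost_h_r _).
Qed.

(** Switching at cost [c] and continuing optimally: this is the origin of the
    obstacle [h_r]. *)
Lemma v0_shift x : 0 <= x -> p x + hr c x = c + v0 (x - c).
Proof.
move=> x0; rewrite /h_r; case: leP => [xfc|fcx].
  rewrite v0_left; last first.
    rewrite ler_norml lerBlDr xfc andbT lerBrDr (le_trans _ x0)//.
    by rewrite addrC subr_le0 ltW.
  by rewrite /h_r1 /perpetual_cost; ring.
have fx : f0 < x - c by rewrite ltrBrDr.
rewrite v0_right ger0_norm ?(ltW (lt_trans f0_pos fx))//.
by rewrite /h_r2 /perpetual_cost [_ * beta]mulrC; ring.
Qed.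

Definition gain z := Num.min (c + v0 (z - c)) (delta * z ^+ 2).

Lemma V_gain : V = stopping_value P Filt Wt alpha lambda (fun z => (gain z)%:E).
Proof.
rewrite /Defs.V; congr stopping_value; apply/funext => z.
by rewrite V0E// -EFinD -EFin_min.
Qed.

Let measurable_gain : measurable_fun setT (fun z => (gain z)%:E).
Proof.
apply/measurable_EFinP; apply: (measurable_minr (f := fun z => c + v0 (z - c))
  (g := fun z => delta * z ^+ 2)); apply: continuous_measurable_fun; last first.
  exact: continuous_square.
move=> z; apply: (@cvgD _ _ _ _ _ (fun=> c) (fun x => v0 (x - c))); first exact: cvg_cst.
apply: (@continuous_comp _ _ _ (fun x => x - c) v0); last exact: v0_continuous.
by apply: (@cvgD _ _ _ _ _ id (fun=> - c)); [exact: cvg_id|exact: cvg_cst].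
Qed.

Let gain_ge0 z : (0 <= (gain z)%:E)%E.
Proof.
by rewrite lee_fin le_min addr_ge0 ?(ltW c0) ?v0_ge0//= mulr_ge0 ?sqr_ge0 ?ltW.
Qed.

Let expR_H z : expR (- (beta * z)) * H alpha delta lambda c (Psi z) = h alpha delta lambda c z.
Proof. by rewrite /H transform_Psi// mulrA -expRD addNr expR0 mul1r. Qed.

Definition value_V z := p z + expR (- (beta * z)) * W (Psi z).

Let Psi_ge1 z : 0 <= z -> 1 <= Psi z.
Proof. by move=> z0; rewrite -(Psi0 alpha) Psi_le. Qed.

(** For nonnegative states this is [W <= H]. At a negative state [z], the shift by
    [c] moves away from the origin, where [v0] is larger than at the point [- z - c]
    reached from the mirror state. *)
Let value_V_le_gain z : p z + expR (- (beta * `|z|)) * W (Psi `|z|) <= gain z.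
Proof.
have z1 := Psi_ge1 (normr_ge0 z).
apply: (@le_trans _ _ (p z + h alpha delta lambda c `|z|)).
  by rewrite lerD2l -expR_H ler_pM2l ?expR_gt0// W_le_H.
rewrite /h /gain le_min addr_minr !ge_min; apply/andP; split; last first.
  by rewrite h_l_abs perpetual_cost_h_l lexx.
apply/orP; right; rewrite -perpetual_cost_abs v0_shift// lerD2l.
have [z0|z0] := ger0P z => //.
have -> : v0 (z - c) = v0 (- z + c) by rewrite -v0N opprB addrC.
have zc : 0 <= - z + c by rewrite addr_ge0 ?oppr_ge0 ?(ltW z0) ?(ltW c0).
have [zc'|/ltW zc'] := leP 0 (- z - c).
  by apply: v0_homo; rewrite ?in_itv/= ?zc ?zc'// lerD2l ge0_cp// ltW.
rewrite -[v0 (- z - c)]v0N opprB opprK; apply: v0_homo; rewrite ?in_itv/= ?andbT//.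
  by rewrite -oppr_le0 opprD addrC.
by rewrite addrC lerD2r (le_trans (ltW z0))// oppr_ge0 ltW.
Qed.

Let value_V_left x : x <= F -> value_V x = delta * x ^+ 2.
Proof.
move=> xF; rewrite /value_V W_ge1; last by rewrite -PsiF Psi_le.
by rewrite /H_l transform_Psi// mulrA -expRD addNr expR0 mul1r perpetual_cost_h_l.
Qed.

Let value_V_right x : G <= x -> value_V x = c + v0 (x - c).
Proof.
move=> Gx; rewrite -v0_shift ?(le_trans (ltW (lt_trans F0 FG)))// /value_V.
rewrite (W_ge2 couple); last by rewrite -PsiG Psi_le.
by rewrite /H_r transform_Psi// mulrA -expRD addNr expR0 mul1r.
Qed.

Let value_V_middle x : F <= x <= G ->
  value_V x = p x + A * expR (beta * x) + B * expR (- (beta * x)).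
Proof.
move=> /andP[Fx xG]; rewrite /value_V (W_line al0 de0 la0 lad f0_gt c0 xf couple);
  rewrite -?PsiF -?PsiG ?Psi_le//.
have -> : Psi x = expR (beta * x) * expR (beta * x) by rewrite -expRD; congr expR; ring.
by rewrite expRN; field; rewrite gt_eqF ?expR_gt0.
Qed.

Let AB_le0 : B <= A /\ A <= 0.
Proof.
have [eA1 eA2 eB1 eB2] := tangency_AB al0 de0 la0 lad f0_gt c0 xf couple.
have A_le0 : A <= 0.
  rewrite eA2; apply: slope_r_le0 => //; first exact: ltW.
  by apply: Psi_inv_ge0 => //; exact: ltW (lt_trans y1_gt1 y12).
have edW : dW y1 = A by rewrite /slope_W glue_le.
have eW : W y1 = A * y1 + B by rewrite (W_line al0 de0 la0 lad f0_gt c0 xf couple) ?lexx ?ltW.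
split=> //; have := W_tangent al0 de0 la0 lad f0_gt c0 Q0 xf couple (ltW y1_gt1) (lexx 1).
have := slope_W_homo al0 de0 la0 lad f0_gt c0 Q0 xf couple (x := 1) (y := y1).
rewrite !in_itv/= lexx (ltW y1_gt1) => /(_ isT isT isT).
have eW1 : 2 * dW 1 = W 1 by exact: slope_W1.
rewrite edW eW -eW1 mulrBr; lra.
Qed.

(** Lower bound by convexity of [W]. For the upper bound, stop at once outside
    the interval from [F] to [G], and inside it at the first exit, where the
    line through the two contact points equals the transformed gain. *)
Lemma VE x : 0 <= x -> V x = (value_V x)%:E.
Proof.
move=> x0; apply/eqP; rewrite eq_le; apply/andP; split; last first.
  have := stopping_value_ge_convex Fus Wbm al0 la0 measurable_gain gain_ge0 (U := W) (dU := dW)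
    (W_tangent al0 de0 la0 lad f0_gt c0 Q0 xf couple)
    (slope_W_le0 al0 de0 la0 lad f0_gt c0 Q0 xf couple).
  rewrite V_gain /value_V => /(_ _ _ _ x); rewrite (ger0_norm x0); apply.
  - move=> y y1'; apply: (slope_W_homo al0 de0 la0 lad f0_gt c0 Q0 xf couple) => //;
      by rewrite in_itv/= ?lexx ?y1'.
  - exact: slope_W1.
  - by move=> z; rewrite lee_fin; exact: value_V_le_gain.
have le_now := stopping_value_le_now Fus Wbm alpha la0 measurable_gain gain_ge0 x.
rewrite V_gain; have [xF|Fx] := leP x F.
  by rewrite (le_trans le_now)// lee_fin value_V_left// ge_min lexx orbT.
have [Gx|xG] := leP G x.
  by rewrite (le_trans le_now)// lee_fin value_V_right// ge_min lexx.
have [AB A_le0] := AB_le0; have [NA NB] : 0 <= - A /\ 0 <= - B.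
  by rewrite !oppr_ge0; split=> //; exact: le_trans AB A_le0.
have between z : 0 < (z - F) * (G - z) -> F < z /\ z < G.
  move=> k0; split; rewrite ltNge; apply/negP => le_z; move: k0; rewrite ltNge => /negP; apply.
    by rewrite mulr_le0_ge0 ?subr_le0// subr_ge0 (le_trans le_z)// ltW.
  by rewrite mulr_ge0_le0 ?subr_le0// subr_ge0 (le_trans _ le_z)// ltW.
have -> : value_V x = p x - (- A * expR (beta * x) + - B * expR (- beta * x)).
  by rewrite value_V_middle ?(ltW Fx) ?(ltW xG)// (mulNr beta); ring.
apply: (stopping_value_le_first_zero Fus Wbm al0 la0 measurable_gain gain_ge0
  (k := fun z => (z - F) * (G - z))) => //.
- apply: (@derive_continuous _ _ (fun z => F + G - 2 * z)) => t.
  by apply: is_derive_eq; rewrite /GRing.scale /=; ring.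
- by rewrite mulr_gt0 ?subr_gt0.
- move=> z /eqP; rewrite mulf_eq0 !subr_eq0 => zFG.
  have zz : F <= z <= G by case/orP: zFG => /eqP e; [rewrite e lexx ltW|rewrite -e lexx ltW].
  rewrite -EFinD lee_fin -lerBrDr opprD !mulNr !opprK addrA -value_V_middle//.
  case/orP: zFG => /eqP e.
    by rewrite e value_V_left ?lexx// ge_min lexx orbT.
  by rewrite -e value_V_right ?lexx// ge_min lexx.
- move=> _; exists (expR (beta * G)) => z /between[_ zG].
  by rewrite ler_expR ler_pM2l// ltW.
- move=> _; exists 1 => z /between[Fz _].
  rewrite -[leRHS]expR0 ler_expR mulNr oppr_le0.
  by apply: mulr_ge0; apply: ltW => //; exact: lt_trans F0 Fz.
Qed.

Definition dvalue_V z := 2 * (lambda / alpha) * z +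
  expR (- (beta * z)) * (2 * beta * Psi z * dW (Psi z) - beta * W (Psi z)).

Let is_derive_Psi z : is_derive z 1 Psi (2 * beta * Psi z).
Proof.
rewrite /Defs.Psi; apply: is_derive_eq; rewrite /GRing.scale /=; ring.
Qed.

Let is_derive_value_V z : 0 < z -> is_derive z 1 value_V (dvalue_V z).
Proof.
move=> z0; have dWz := is_derive_W al0 de0 la0 lad f0_gt c0 Q0 xf couple (Psi_ge1 (ltW z0)).
have := is_derive1_comp dWz (is_derive_Psi z) => dWPsi.
rewrite /value_V /perpetual_cost.
have -> : (fun z => lambda / alpha * z ^+ 2 + lambda / alpha ^+ 2 + expR (- (beta * z)) * W (Psi z)) =
  (fun z => lambda / alpha * z ^+ 2 + lambda / alpha ^+ 2 + expR (- (beta * z)) * (W \o Psi) z) by [].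
apply: is_derive_eq; rewrite /GRing.scale /= /dvalue_V; ring.
Qed.

Let dvalue_V_continuous z : 0 < z -> {for z, continuous dvalue_V}.
Proof.
move=> z0.
have cPsi : {for z, continuous Psi} := is_derive_continuous (is_derive_Psi z).
have cW : {for z, continuous (W \o Psi)}.
  apply: continuous_comp => //.
  exact: is_derive_continuous (is_derive_W al0 de0 la0 lad f0_gt c0 Q0 xf couple (Psi_ge1 (ltW z0))).
have cdW : {for z, continuous (dW \o Psi)}.
  apply: continuous_comp => //.
  exact: (slope_W_continuous al0 de0 la0 lad f0_gt c0 xf couple (Psi_ge1 (ltW z0))).
have cexp : {for z, continuous (fun t => expR (- (beta * t)))}.
  have dexp : is_derive z 1 (fun t : R => expR (- (beta * t))) (- beta * expR (- (beta * z))).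
    by apply: is_derive_eq; rewrite /GRing.scale /=; ring.
  exact: is_derive_continuous dexp.
rewrite /dvalue_V; apply: cvgD; first by apply: cvgM; [exact: cvg_cst|exact: cvg_id].
apply: cvgM; first exact: cexp.
apply: cvgB; last by apply: cvgM; [exact: cvg_cst|exact: cW].
by apply: cvgM; [apply: cvgM; [exact: cvg_cst|exact: cPsi]|exact: cdW].
Qed.

(** Away from the origin the value is [value_V], hence continuously
    differentiable: [W] is, across both contact points. *)
Lemma V_C1_at x : 0 < x -> C1_at (fun z => fine (V z)) x.
Proof.
move=> x0; have dV z : 0 < z -> is_derive z 1 (fun z => fine (V z)) (dvalue_V z).
  move=> z0; apply: near_eq_is_derive (is_derive_value_V z0).
  by apply: filterS (lt_nbhsr z0) => t /ltW t0; rewrite VE.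
split.
  by apply: filterS (lt_nbhsr x0) => z z0; exact: is_derive_derivable (dV z z0).
have := dvalue_V_continuous x0.
rewrite /prop_for /continuous_at -(is_derive_derive1 (dV x x0)).
apply: cvg_trans; apply: near_eq_cvg.
by apply: filterS (lt_nbhsr x0) => z z0; rewrite (is_derive_derive1 (dV z z0)).
Qed.

Lemma V_left x : 0 <= x -> x <= F -> V x = (delta * x ^+ 2)%:E.
Proof. by move=> x0 xF; rewrite VE// value_V_left. Qed.

Lemma V_middle x : F < x -> x < G -> V x =
  (lambda / alpha * x ^+ 2 + lambda / alpha ^+ 2 + A * expR (x * beta)
   + B * expR (- (x * beta)))%:E.
Proof.
move=> Fx xG; rewrite VE ?(ltW (lt_trans F0 Fx))// value_V_middle ?(ltW Fx) ?(ltW xG)//.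
by rewrite ![x * beta]mulrC.
Qed.

Lemma V_right x : G <= x -> V x = (V0 (x - c) + c%:E)%E.
Proof.
move=> Gx; rewrite VE ?(le_trans (ltW (lt_trans F0 FG)))// value_V_right//.
by rewrite V0E// -EFinD addrC.
Qed.

Lemma V_smooth_fit : C1_at (fun z => fine (V z)) F /\ C1_at (fun z => fine (V z)) G.
Proof. by split; apply: V_C1_at => //; exact: lt_trans F0 FG. Qed.

End value_with_switch.

Theorem proposition6 (R : realType) (alpha delta lambda : R)
    (alpha_gt0 : 0 < alpha) (delta_gt0 : 0 < delta)
    (lambda_gt0 : 0 < lambda) (lambda_lt : lambda < alpha * delta)
    (f0_gt : alpha / (2 * lambda) < f0 alpha delta lambda)
    (d : measure_display) (Omega : measurableType d) (P : probability Omega R)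
    (Filt : R -> set (set Omega)) (W : R -> Omega -> R)
    (Filt_usual : usual_filtration P Filt)
    (W_bm : brownian_motion P Filt W) :
  exists2 c1 : R, 0 < c1 &
  forall c : R, 0 < c < c1 ->
  exists2 yv : R, unique (convexity_threshold alpha delta lambda c) yv &
  exists y1 y2 : R,
  let A := slope_A alpha delta lambda y1 in
  let B := intercept_B alpha delta lambda y1 in
  let F := Psi_inv alpha y1 in
  let G := Psi_inv alpha y2 in
  let V0' := V0 P Filt W alpha lambda delta in
  let V' := V P Filt W alpha lambda delta c in
  [/\ [/\ tangency_couple alpha delta lambda c yv y1 y2,
          (forall z1 z2 : R, tangency_couple alpha delta lambda c yv z1 z2 ->
             z1 = y1 /\ z2 = y2) &
          y1 < Psi alpha (f0 alpha delta lambda)],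
      [/\ greatest_nonpositive_convex_minorant `[1, +oo[
            (H alpha delta lambda c) (W_piecewise alpha delta lambda c y1 y2),
          C1_from 1 (W_piecewise alpha delta lambda c y1 y2) &
          forall y : R, 1 < y -> A * y + B <= H alpha delta lambda c y] &
      [/\ (forall x : R, 0 <= x <= F -> V' x = (delta * x ^+ 2)%:E),
          (forall x : R, F < x < G ->
             V' x = (lambda / alpha * x ^+ 2 + lambda / alpha ^+ 2
                     + A * expR (x * Num.sqrt (2 * alpha))
                     + B * expR (- (x * Num.sqrt (2 * alpha))))%:E),
          (forall x : R, G <= x -> V' x = (V0' (x - c)%R + c%:E)%E),
          C1_at (fun x => fine (V' x)) F &
          C1_at (fun x => fine (V' x)) G]].
Proof.
have [c1 c1_gt0 small] := small_cost alpha_gt0 delta_gt0 lambda_gt0 lambda_lt f0_gt.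
exists c1 => // c /[dup] /andP[c0 _] /small[Q0 xf cf slope1 slope2].
exists (y_c alpha delta c); first exact: convexity_threshold_y_c.
have [y1 [y2 couple]] := tangency_couple_exists alpha_gt0 delta_gt0 lambda_gt0
  lambda_lt f0_gt c0 Q0 xf slope1 slope2.
exists y1, y2 => A B F G V0' V'.
have [fitF fitG] := V_smooth_fit Filt_usual W_bm alpha_gt0 delta_gt0 lambda_gt0
  lambda_lt f0_gt c0 Q0 xf cf couple.
split; split.
- exact: couple.
- move=> z1 z2; exact: tangency_couple_unique couple.
- by case: couple => _ y1c _ _ _; rewrite (lt_trans y1c)// Psi_lt.
- exact: W_greatest_minorant.
- exact: W_C1.
- move=> y y_gt1; rewrite /A /B.
  exact: (line_le_H alpha_gt0 delta_gt0 lambda_gt0 lambda_lt f0_gt c0 Q0 xf couple (ltW y_gt1)).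
- move=> x /andP[x0 xF].
  exact: (V_left Filt_usual W_bm alpha_gt0 delta_gt0 lambda_gt0 lambda_lt f0_gt c0 Q0 xf cf couple x0 xF).
- move=> x /andP[Fx xG].
  exact: (V_middle Filt_usual W_bm alpha_gt0 delta_gt0 lambda_gt0 lambda_lt f0_gt c0 Q0 xf cf couple Fx xG).
- move=> x Gx.
  exact: (V_right Filt_usual W_bm alpha_gt0 delta_gt0 lambda_gt0 lambda_lt f0_gt c0 Q0 xf cf couple Gx).
- exact: fitF.
- exact: fitG.
Qed.
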